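(* Let $R$ be a finite ring and let $S\subseteq U(R)$ be a non-empty subset with $S^{-1}\subseteq S$. Then $\Gamma(R,S)$ is projective if and only if one of the following conditions holds (where $S$ is identified with its image under the given isomorphism): (a) $R\cong \mathbb{Z}_5$ with $S\neq\{1\}$; (b) $R\cong \mathbb{Z}_3\times\mathbb{Z}_3$ with $S=\{(-1,-1)\}$, $S=\{(1,-1),(-1,-1)\}$ or $S=\{(-1,1),(-1,-1)\}$.
   Context: All rings are commutative with non-zero identity. $\mathbb{Z}_n$ is the ring of integers modulo $n$. $U(R)$ is the group of units of $R$, and $S^{-1}=\{s^{-1}\mid s\in S\}$. For a non-empty subset $S\subseteq U(R)$ with $S^{-1}\subseteq S$, $\Gamma(R,S)$ denotes the simple graph with vertex set $R$ in which two distinct vertices $x,y$ are adjacent if and only if there exists $s\in S$ with $x+sy\in U(R)$. The nonorientable genus (crosscap number) $\widetilde{\gamma}(\Gamma)$ of a finite simple graph $\Gamma$ is the minimum non-negative integer $k$ such that $\Gamma$ can be embedded in the sphere with $k$ crosscaps (the case $k=0$ being the sphere itself). A graph is projective if its nonorientable genus equals $1$ (so planar graphs are not projective). *)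

(* Defs.v *)
From HB Require Import structures.
From mathcomp Require Import all_boot all_order all_algebra.
From mathcomp Require Import all_classical all_reals all_analysis.
From mathcomp Require Import ring lra.

Set Implicit Arguments.
Unset Strict Implicit.
Unset Printing Implicit Defensive.

Import Order.TTheory GRing.Theory Num.Theory.
Import numFieldNormedType.Exports.

Local Open Scope ring_scope.

Definition Gamma (R : finComUnitRingType) (S : {set R}) : rel R :=
  fun x y => (x != y) && [exists s in S, x + s * y \is a GRing.unit].

Definition edge_set (V : finType) (e : rel V) : {set {set V}} :=
  [set [set xy.1; xy.2] | xy : V * V & e xy.1 xy.2].

Local Open Scope classical_set_scope.
Local Open Scope quotient_scope.

(* The sphere with k crosscaps: remove from the unit sphere of K^3 the k open
   caps of angular radius pi / (2k) whose centres are equally spaced on the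
   equator (their closures are pairwise disjoint), then identify antipodal
   points of each of the k boundary circles. For k = 0 this is the sphere, for
   k = 1 a closed hemisphere with antipodal boundary points identified. *)
Section CrosscapSphere.
Context {K : realType}.

Definition dot (p q : 'rV[K]_3) : K := \sum_(j < 3) p 0 j * q 0 j.

Definition cap_center (k i : nat) : 'rV[K]_3 :=
  let t := pi *+ 2 * i%:R / k%:R in
  \row_(j < 3) [:: cos t; sin t; 0]`_j.

(* The boundary circle of the i-th cap consists of the unit vectors p with
   dot p (cap_center k i) = cap_height k. *)
Definition cap_height (k : nat) : K := cos (pi / k.*2%:R).

Definition holed_sphere (k : nat) : set 'rV[K]_3 :=
  [set p | dot p p = 1 /\
           forall i : 'I_k, dot p (cap_center k i) <= cap_height k].

(* The i-th circle has centre h c, where h is the height and c the centre of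
   the cap, so the point of this circle antipodal to p is 2 h c - p. *)
Definition crosscap_eq (k : nat) (p q : holed_sphere k) : Prop :=
  p = q \/
  exists2 i : 'I_k, dot (val p) (cap_center k i) = cap_height k &
    val q = (cap_height k *+ 2) *: cap_center k i - val p.

Definition crosscap_eqb (k : nat) : rel (holed_sphere k) :=
  fun p q => `[< crosscap_eq p q >].

Lemma dotC p q : dot p q = dot q p.
Proof. by apply: eq_bigr => j _; rewrite mulrC. Qed.

Lemma dotBl p q r : dot (p - q) r = dot p r - dot q r.
Proof. by rewrite /dot -sumrB; apply: eq_bigr => j _; rewrite !mxE mulrBl. Qed.

Lemma dotZl a p q : dot (a *: p) q = a * dot p q.
Proof. by rewrite /dot mulr_sumr; apply: eq_bigr => j _; rewrite !mxE mulrA. Qed.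

Lemma dot_ge0 p : 0 <= dot p p.
Proof. by apply: sumr_ge0 => j _; rewrite -expr2 sqr_ge0. Qed.

Lemma dot_centers k i j : dot (cap_center k i) (cap_center k j) =
  cos (pi *+ 2 * i%:R / k%:R - pi *+ 2 * j%:R / k%:R).
Proof.
by rewrite /dot !big_ord_recl big_ord0 !mxE /= mulr0 !addr0 cosB.
Qed.

Lemma dot_center k i : dot (cap_center k i) (cap_center k i) = 1.
Proof. by rewrite dot_centers subrr cos0. Qed.

Lemma dot_antipode k i p : dot p (cap_center k i) = cap_height k ->
  dot ((cap_height k *+ 2) *: cap_center k i - p) (cap_center k i)
    = cap_height k.
Proof.
by move=> pE; rewrite dotBl dotZl dot_center mulr1 pE mulr2n addrK.
Qed.

Lemma cos_centers_le k i j : (j < i < k)%N ->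
  cos (pi *+ 2 * i%:R / k%:R - pi *+ 2 * j%:R / k%:R) <= cos (pi / k%:R *+ 2) :> K.
Proof.
move=> /andP[ji ik]; have k0 : 0 < k%:R :> K by rewrite ltr0n; case: (k) ik.
have pi0 := pi_gt0 K.
have le_cos (d : nat) : (0 < d)%N -> (d.*2 <= k)%N ->
    cos (pi *+ 2 * d%:R / k%:R) <= cos (pi / k%:R *+ 2) :> K.
  move=> d0 dk.
  have d1 : 1 <= d%:R :> K by rewrite ler1n.
  have d2 : d%:R * 2 <= k%:R :> K by rewrite -natrM ler_nat muln2.
  have piV : 0 < pi / k%:R :> K by rewrite divr_gt0.
  have dpi : pi / k%:R * (d%:R * 2) <= pi :> K.
    by rewrite mulrAC ler_pdivrMr // ler_pM2l.
  have -> : pi *+ 2 * d%:R / k%:R = pi / k%:R * (d%:R * 2) :> K by ring.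
  rewrite (_ : pi / k%:R *+ 2 = pi / k%:R * 2); last by rewrite mulr_natr.
  have le2 : pi / k%:R * 2 <= pi / k%:R * (d%:R * 2) :> K.
    by rewrite ler_pM2l // ler_peMl.
  by rewrite leNgt ltr_cos ?in_itv /= -?leNgt //; apply/andP; split=> //; lra.
have -> : pi *+ 2 * i%:R / k%:R - pi *+ 2 * j%:R / k%:R
    = pi *+ 2 * (i - j)%:R / k%:R :> K.
  by rewrite natrB 1?ltnW //; ring.
have [le2|gt2] := leqP (i - j).*2 k; first by apply: le_cos; rewrite ?subn_gt0.
rewrite -cosN -cosD2pi.
have -> : - (pi *+ 2 * (i - j)%:R / k%:R) + pi *+ 2
    = pi *+ 2 * (k - (i - j))%:R / k%:R :> K.
  rewrite [X in _ = _ * X / _]natrB; last by rewrite leq_subLR ltnW // ltn_addl.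
  by field; rewrite gt_eqF.
apply: le_cos; first by rewrite subn_gt0 (leq_ltn_trans (leq_subr _ _)).
by rewrite doubleB leq_subLR -addnn leq_add2r ltnW.
Qed.

Lemma cap_circles_disjoint k (i j : 'I_k) p : dot p p = 1 ->
  dot p (cap_center k i) = cap_height k ->
  dot p (cap_center k j) = cap_height k -> i = j.
Proof.
move=> p1.
wlog ji : i j / (j < i)%N => [hw|].
  case: (ltngtP i j) => [ij pci pcj|ji pci pcj|ij _ _]; last exact: val_inj.
    by apply/esym/hw.
  exact: hw.
move=> pci pcj; exfalso.
set h := cap_height k in pci pcj.
set g := dot (cap_center k i) (cap_center k j).
have gE : 0 <= 6 - 8 * h + 2 * g.
  have := dot_ge0 (2 *: p - cap_center k i - cap_center k j).
  rewrite !(dotBl, dotZl) !(dotC _ (_ - _)) !(dotBl, dotZl).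
  rewrite !dot_center p1 !(dotC _ p) pci pcj (dotC (cap_center k j)) -/g => H.
  by apply: le_trans H _; lra.
have k2 : (1 < k)%N by rewrite (leq_ltn_trans _ (ltn_ord i)) // (leq_ltn_trans _ ji).
have k2R : 2 <= k%:R :> K by rewrite ler_nat.
have pi0 := pi_gt0 K.
set x : K := pi / k.*2%:R.
have x2E : pi / k%:R = x *+ 2 :> K.
  by rewrite /x -muln2 natrM; field; rewrite gt_eqF //; lra.
have x0 : 0 < x by rewrite divr_gt0 // ltr0n double_gt0 ltnW.
have x2 : x *+ 2 <= pi / 2.
  rewrite -x2E ler_pM2l // lef_pV2 ?posrE //; lra.
have h1 : h < 1.
  by rewrite -[h]/(cos x) -cos0 ltr_cos ?in_itv //=; apply/andP; split; lra.
have h0 : 0 <= h.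
  by rewrite -[h]/(cos x); apply: cos_ge0_pihalf; apply/andP; split; lra.
have c0 : 0 <= cos (x *+ 2).
  by apply: cos_ge0_pihalf; apply/andP; split; lra.
have gle : g <= cos (x *+ 2 *+ 2).
  by rewrite /g dot_centers -x2E; apply: cos_centers_le; rewrite ji /=.
have hE : cos x = h by [].
rewrite cos_mulr2n in gle; rewrite cos_mulr2n hE in c0 gle.
have hh : 1 < 2 * h ^+ 2 * (1 + h) by nra.
have : 0 < (1 - h) * (2 * h ^+ 2 * (1 + h) - 1) by apply: mulr_gt0; lra.
have -> : (1 - h) * (2 * h ^+ 2 * (1 + h) - 1)
   = - (6 - 8 * h + 2 * ((h ^+ 2 *+ 2 - 1) ^+ 2 *+ 2 - 1)) / 8 by field.
lra.
Qed.

Lemma crosscap_eqb_refl k : reflexive (@crosscap_eqb k).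
Proof. by move=> p; apply/asboolP; left. Qed.

Lemma crosscap_eqb_sym k : symmetric (@crosscap_eqb k).
Proof.
suff sub p q : @crosscap_eqb k p q -> crosscap_eqb q p.
  by move=> p q; apply/idP/idP; apply: sub.
move=> /asboolP[->|[i pci qE]]; apply/asboolP; [by left|right; exists i].
  by rewrite qE dot_antipode.
by rewrite qE subKr.
Qed.

Lemma crosscap_eqb_trans k : transitive (@crosscap_eqb k).
Proof.
move=> q p r /asboolP[->//|[i pci qE]] /asboolP[<-|[j qj rE]].
  by apply/asboolP; right; exists i.
apply/asboolP; left; apply: val_inj.
have qi : dot (val q) (cap_center k i) = cap_height k by rewrite qE dot_antipode.
have q1 : dot (val q) (val q) = 1 by case: (q) => ? /= /set_mem[].
by rewrite rE -(cap_circles_disjoint q1 qi qj) qE subKr.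
Qed.

Canonical crosscap_equiv (k : nat) : equiv_rel (holed_sphere k) :=
  EquivRel (@crosscap_eqb k) (@crosscap_eqb_refl k) (@crosscap_eqb_sym k)
    (@crosscap_eqb_trans k).

End CrosscapSphere.

Definition crosscap_sphere (K : realType) (k : nat) : topologicalType :=
  quotient_topology {eq_quot (@crosscap_equiv K k)}.

(* Vertices become distinct points and every edge a simple arc joining its two
   ends; an arc contains no vertex other than its ends, and two arcs meet only
   at common ends. *)
Definition embeds (K : realType) (V : finType) (e : rel V)
    (X : topologicalType) : Prop :=
  exists (phi : V -> X) (arc : {set V} -> K -> X),
    [/\ injective phi,
        forall E, E \in edge_set e ->
          [/\ {within `[0, 1], continuous (arc E)},
              {in `[0, 1] &, injective (arc E)} &
              [set arc E 0; arc E 1] = phi @` [set` E]],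
        forall E v t, E \in edge_set e -> t \in `[0, 1] ->
          arc E t = phi v -> v \in E &
        forall E F t s, E \in edge_set e -> F \in edge_set e -> E != F ->
          t \in `[0, 1] -> s \in `[0, 1] -> arc E t = arc F s ->
          exists2 v, v \in E :&: F & arc E t = phi v].

Definition is_nonorientable_genus (K : realType) (V : finType) (e : rel V)
    (k : nat) : Prop :=
  embeds K e (crosscap_sphere K k) /\
  forall j, embeds K e (crosscap_sphere K j) -> (k <= j)%N.

Definition projective (K : realType) (V : finType) (e : rel V) : Prop :=
  is_nonorientable_genus K e 1.

(* Main.v *)
From HB Require Import structures.
Require Import Defs.
From mathcomp Require Import all_classical all_reals all_analysis.
From mathcomp Require Import all_boot all_order all_fingroup all_algebra all_solvable.
From mathcomp Require Import generic_quotient ring lra zify.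

Set Implicit Arguments.
Unset Strict Implicit.
Unset Printing Implicit Defensive.

Import Order.TTheory GRing.Theory Num.Theory.
Import numFieldNormedType.Exports.

Local Open Scope ring_scope.

(** Two facts are combined: a mod 2 obstruction that decides which small graphs embed in
the projective plane or in the sphere, and a case analysis of finite rings which shows
that every unit graph is planar, or contains a graph that does not embed in the
projective plane, or is one of the listed exceptions.

Obstruction.  Points of both surfaces are represented by unit vectors of [K^3] (up to
sign for the projective plane).  Given an embedding, sample every arc finely, lift the
samples to the sphere choosing each sign so that consecutive samples are close, and
perturb everything into general position.  By compactness two arcs without common end
stay apart, so their polygons do not cross.  Compare this with the reference drawing
that puts vertex [v] on the moment curve, where two disjoint edges [e] and [f] cross
exactly when their ends interlace.  The two drawings of an edge, joined by segments
between the two positions of each end, form a closed curve, and closed curves meet an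
even number of times, or, in the projective plane, a number of times congruent to the
product [x e * x f] of their classes.  Expanding this ([pair_identity]) gives for all
disjoint edges, modulo 2,
  [interlace e f + x e * x f + (kk e.1 f + kk e.2 f) + (kk f.1 e + kk f.2 e) = 0],
with [x = 0] on the sphere ([embeds_obstruction]).  A list of pairs of disjoint edges in
which each combination of a vertex with an edge occurs evenly often eliminates [kk] when the
identities are added up.  Each subdivision of a Kuratowski graph provides such a list.
For planarity one list with an odd number of interlacing pairs suffices
([not_planar]); for the projective plane several lists give quadratic equations in [x],
whose unsolvability is checked by a search ([not_projective]).

Drawings.  For embeddings every edge is a straight segment in [K^3] projected radially
onto the surface, possibly from [w x] to [- w y], that is through the crosscap.  Being an
embedding is then a finite set of sign conditions on determinants of integer points
([table_drawing]).  Infinitely many planar graphs occur, but each is a disjoint union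
of copies of a subgraph of one fixed graph, and copies are moved apart by shears
([copies_embed]).

Rings.  Let [J] be the Jacobson radical.  If [#|J| >= 3] the classes of [0] and of the
units contain a complete bipartite graph that is too large.  If [#|J| = 2], either all
units are in [1 + J] and the graph splits into components on four vertices, or a power
of [u - 1] is an idempotent [e] splitting off a factor with three residues whose
differences are invertible, and doubled hexagons appear.  If [J = 0] the ring is a
product of fields, the corners of its minimal idempotents; their orders and the action
of [S] on a factor of order four decide the matter ([reduced_trichotomy]).  The cases
left are the field with five elements and the square of the field with three elements,
where all possible sets [S] are examined one by one ([square_trichotomy]). *)

(** * Orientations and crossings of segments *)
Section Crossing.
Variable K : realFieldType.
Notation V3 := 'rV[K]_3.
Implicit Types p q r o : V3.

Definition det3 p q r : K :=
  p 0 0 * (q 0 1 * r 0 2 - q 0 2 * r 0 1)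
  - p 0 1 * (q 0 0 * r 0 2 - q 0 2 * r 0 0)
  + p 0 2 * (q 0 0 * r 0 1 - q 0 1 * r 0 0).

Definition neg_det p q r := det3 p q r < 0.

(** For vectors in general position, the cones over [p p'] and [q q'] meet when [p] and
[p'] are on different sides of the plane of [q, q'] and conversely.  This leaves the two
possibilities that the common line is met by both cones in the same half line or in
opposite ones; the last condition excludes the second one, unless [k] says that
antipodal points are identified. *)
Definition cross (k : bool) p p' q q' :=
  let a := neg_det p' q q' in let b := ~~ neg_det p q q' in
  let g := ~~ neg_det p p' q' in let d := neg_det p p' q in
  [&& a == b, g == d & k || (a == g)].

(** The ray of [q] is in the cone over the triangle [o p p'], where for [k] the opposite ray
is admitted as well. *)
Definition inside (k : bool) o p p' q :=
  [&& neg_det o p q == neg_det p p' q, neg_det p p' q == neg_det p' o q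
    & k || (neg_det p p' q == neg_det o p p')].

Lemma det3C1 p q r : det3 q p r = - det3 p q r.
Proof. by rewrite /det3; ring. Qed.
Lemma det3C2 p q r : det3 p r q = - det3 p q r.
Proof. by rewrite /det3; ring. Qed.
Lemma det3R p q r : det3 q r p = det3 p q r.
Proof. by rewrite /det3; ring. Qed.

Lemma negC1 p q r : det3 p q r != 0 -> neg_det q p r = ~~ neg_det p q r.
Proof. by rewrite /neg_det (det3C1 p q r) oppr_lt0 -leNgt le_eqVlt eq_sym => /negbTE->. Qed.
Lemma negR p q r : neg_det q r p = neg_det p q r.
Proof. by rewrite /neg_det det3R. Qed.

Lemma mul_lt0P (x y : K) : x != 0 -> y != 0 -> (x * y < 0) = (x < 0) (+) (y < 0).
Proof.
move=> x0 y0.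
case: (ltgtP x 0) (x0) => // hx _; case: (ltgtP y 0) (y0) => // hy _ /=.
- by apply/negbTE; rewrite -leNgt ltW // nmulr_rgt0.
- by rewrite nmulr_rlt0.
- by rewrite pmulr_rlt0.
- by apply/negbTE; rewrite -leNgt ltW // mulr_gt0.
Qed.

Lemma three_signs (x y z : K) : x != 0 -> y != 0 -> z != 0 -> x - y + z = 0 ->
  ~~ [&& (x < 0) == (z < 0) & (x < 0) != (y < 0)].
Proof.
move=> x0 y0 z0 e; apply/negP => /andP[/eqP h1 h2].
move: x0 y0 z0 h1 h2.
case: (ltgtP x 0) => // hx; case: (ltgtP y 0) => // hy; case: (ltgtP z 0) => // hz; lra.
Qed.

(** The three products in the Grassmann-Pluecker relation
[det3 i a b * det3 i c d - det3 i a c * det3 i b d + det3 i a d * det3 i b c = 0]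
cannot have signs that make all three summands positive, or all three negative. *)
Lemma plucker_signs i a b c d :
  det3 i a b != 0 -> det3 i c d != 0 -> det3 i a c != 0 -> det3 i b d != 0 ->
  det3 i a d != 0 -> det3 i b c != 0 ->
  ~~ [&& neg_det i a b (+) neg_det i c d == neg_det i a d (+) neg_det i b c &
   neg_det i a b (+) neg_det i c d != neg_det i a c (+) neg_det i b d].
Proof.
move=> h1 h2 h3 h4 h5 h6; rewrite /neg_det -!mul_lt0P //.
by apply: three_signs; rewrite ?mulf_neq0 //; rewrite /det3; ring.
Qed.

(** A segment crosses the boundary of a triangle an even number of times unless exactly one
of its ends is inside.  This is a statement about the signs of ten determinants, and
the Grassmann-Pluecker relations, one for each of the five points, are enough to imply
it, so that a check of all sign patterns remains. *)
Lemma cross_triangle k o p p' q q' :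
  det3 o p p' != 0 -> det3 o p q != 0 -> det3 o p q' != 0 ->
  det3 o p' q != 0 -> det3 o p' q' != 0 -> det3 o q q' != 0 ->
  det3 p p' q != 0 -> det3 p p' q' != 0 -> det3 p q q' != 0 -> det3 p' q q' != 0 ->
  cross k p p' q q' = cross k o p q q' (+) cross k o p' q q'
     (+) (inside k o p p' q (+) inside k o p p' q').
Proof.
move=> d1 d2 d3 d4 d5 d6 d7 d8 d9 d10.
have e1 := plucker_signs d1 d6 d2 d5 d3 d4.
have n1 : det3 p o p' != 0 by rewrite det3C1 oppr_eq0.
have n2 : det3 p o q != 0 by rewrite det3C1 oppr_eq0.
have n3 : det3 p o q' != 0 by rewrite det3C1 oppr_eq0.
have e2 := plucker_signs n1 d9 n2 d8 n3 d7.
have n4 : det3 p' o p != 0 by rewrite -det3R.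
have n5 : det3 p' o q != 0 by rewrite det3C1 oppr_eq0.
have n6 : det3 p' o q' != 0 by rewrite det3C1 oppr_eq0.
have n7 : det3 p' p q != 0 by rewrite det3C1 oppr_eq0.
have n8 : det3 p' p q' != 0 by rewrite det3C1 oppr_eq0.
have e3 := plucker_signs n4 d10 n5 n8 n6 n7.
have m1 : det3 q o p != 0 by rewrite -det3R.
have m2 : det3 q o p' != 0 by rewrite -det3R.
have m3 : det3 q o q' != 0 by rewrite det3C1 oppr_eq0.
have m4 : det3 q p q' != 0 by rewrite det3C1 oppr_eq0.
have m5 : det3 q p' q' != 0 by rewrite det3C1 oppr_eq0.
have m6 : det3 q p p' != 0 by rewrite -det3R.
have e4 := plucker_signs m1 m5 m2 m4 m3 m6.
have l1 : det3 q' o p != 0 by rewrite -det3R.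
have l2 : det3 q' o p' != 0 by rewrite -det3R.
have l3 : det3 q' o q != 0 by rewrite -det3R.
have l4 : det3 q' p q != 0 by rewrite -det3R.
have l5 : det3 q' p' q != 0 by rewrite -det3R.
have l6 : det3 q' p p' != 0 by rewrite -det3R.
have e5 := plucker_signs l1 l5 l2 l4 l3 l6.
move: e1 e2 e3 e4 e5; rewrite /cross /inside.
rewrite !(negC1 d1) !(negC1 d2) !(negC1 d3) -!(negR p' o p) (negC1 d4) (negC1 d5) (negC1 d7) (negC1 d8).
rewrite -!(negR q o p) -!(negR q o p') !(negC1 d6) -!(negR q p p') !(negC1 d9) !(negC1 d10).
rewrite -!(negR q' o p) -!(negR q' o p') -!(negR q' o q)  -!(negR q' p p') -!(negR q' p q) -!(negR q' p' q).
clear.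
by case: (neg_det o p p'); case: (neg_det o p q); case: (neg_det o p q'); case: (neg_det o p' q);
case: (neg_det o p' q'); case: (neg_det o q q'); case: (neg_det p p' q); case: (neg_det p p' q');
case: (neg_det p q q'); case: (neg_det p' q q'); case: k.
Qed.

(** The segments from [o] to [p] and from [o] to [- p] form together a projective line, and
[q q'] crosses this line when [q] and [q'] are on different sides of the plane of
[o, p]. *)
Lemma cross_antipode o p q q' :
  det3 o p q != 0 -> det3 o p q' != 0 -> det3 p q q' != 0 ->
  cross true o p q q' (+) cross true o (-p) q q' = neg_det o p q (+) neg_det o p q'.
Proof.
move=> d1 d2 d3; rewrite /cross /=.
have dN a b c : det3 (-a) b c = - det3 a b c by rewrite /det3 !mxE; ring.
have E (a b c : V3) : det3 a b c != 0 -> neg_det a (- b) c = ~~ neg_det a b c.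
  move=> h; rewrite -(negC1 h) /neg_det [in RHS]det3C1 -dN.
  by congr (_ < 0); rewrite /det3 !mxE; ring.
have E' (a b c : V3) : det3 a b c != 0 -> neg_det (- a) b c = ~~ neg_det a b c.
  by move=> h; rewrite -(negC1 h) /neg_det [in RHS]det3C1 dN.
by rewrite E' // !E //; case: (neg_det o p q); case: (neg_det o p q'); case: (neg_det p q q'); case: (neg_det o q q').
Qed.
End Crossing.

(** * Crossing parities of closed curves *)
Notation "\xor_ ( i <- r ) F" := (\big[addb/false]_(i <- r) F)
  (at level 41, F at level 41, i, r at level 50).

Section Chains.
Variables (K : realFieldType) (I : eqType) (P : I -> 'rV[K]_3) (k : bool).
Hypothesis gp : forall i j l, uniq [:: i; j; l] -> det3 (P i) (P j) (P l) != 0.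

(** Vertices of the polygons are lifts of named points; the boolean selects the antipode. *)
Definition signed_point (a : bool * I) := if a.1 then - P a.2 else P a.2.

Definition opp (a : bool * I) := (~~ a.1, a.2).

Definition seg_cross (s t : (bool * I) * (bool * I)) :=
  cross k (signed_point s.1) (signed_point s.2) (signed_point t.1) (signed_point t.2).

Lemma det3N1 (p q r : 'rV[K]_3) : det3 (- p) q r = - det3 p q r.
Proof. by rewrite /det3 !mxE; ring. Qed.
Lemma det3N2 (p q r : 'rV[K]_3) : det3 p (- q) r = - det3 p q r.
Proof. by rewrite /det3 !mxE; ring. Qed.
Lemma det3N3 (p q r : 'rV[K]_3) : det3 p q (- r) = - det3 p q r.
Proof. by rewrite /det3 !mxE; ring. Qed.

Lemma generic_signed (a b c : bool * I) : uniq [:: a.2; b.2; c.2] ->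
  det3 (signed_point a) (signed_point b) (signed_point c) != 0.
Proof.
move=> /gp h; rewrite /signed_point.
by case: a.1; case: b.1; case: c.1; rewrite ?(det3N1, det3N2, det3N3) ?oppr_eq0.
Qed.

Lemma neg_signed (a b c : bool * I) : uniq [:: a.2; b.2; c.2] ->
  neg_det (signed_point a) (signed_point b) (signed_point c)
  = a.1 (+) b.1 (+) c.1 (+) neg_det (P a.2) (P b.2) (P c.2).
Proof.
move=> /gp h; rewrite /signed_point /neg_det.
have N (x : K) : x != 0 -> (- x < 0) = ~~ (x < 0).
  by move=> x0; rewrite oppr_lt0 -leNgt le_eqVlt eq_sym (negbTE x0).
by case: a.1; case: b.1; case: c.1; rewrite ?(det3N1, det3N2, det3N3) ?opprK ?N.
Qed.

Lemma crossC (p p' q q' : 'rV[K]_3) : cross k q q' p p' = cross k p p' q q'.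
Proof.
rewrite /cross (negR p' q' p) (negR p p' q') (negR p' q p) (negR p p' q).
rewrite (negR p' q q') (negR p q q').
by case: (neg_det p p' q); case: (neg_det p p' q'); case: (neg_det p q q'); case: (neg_det p' q q'); case: k.
Qed.

Lemma seg_crossC s t : seg_cross s t = seg_cross t s.
Proof. exact: crossC. Qed.

Lemma seg_cross_swap a b t : uniq [:: a.2; b.2; t.1.2; t.2.2] -> seg_cross (a, b) t = seg_cross (b, a) t.
Proof.
case: t => c d /= u; rewrite /seg_cross /cross /=.
have [u1 u2] : uniq [:: a.2; b.2; c.2] /\ uniq [:: a.2; b.2; d.2].
  by move: u; rewrite /= !inE; do 6 case: (_ =P _) => //= _.
rewrite (negC1 (generic_signed u1)) (negC1 (generic_signed u2)).
by case: (neg_det (signed_point b) (signed_point c) _); case: (neg_det (signed_point a) (signed_point c) _); case: neg_det; case: neg_det; case: (k).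
Qed.

Lemma seg_cross_opp a b t : k -> uniq [:: a.2; b.2; t.1.2; t.2.2] ->
  seg_cross (opp a, opp b) t = seg_cross (a, b) t.
Proof.
case: t => c d /= hk u; rewrite /seg_cross /cross hk /=.
have [[u1 u2] [u3 u4]] : (uniq [:: a.2; b.2; c.2] /\ uniq [:: a.2; b.2; d.2])
   /\ (uniq [:: a.2; c.2; d.2] /\ uniq [:: b.2; c.2; d.2]).
  by move: u; rewrite /= !inE; do 6 case: (_ =P _) => //= _.
rewrite !neg_signed //=.
move: (neg_det _ _ _) (neg_det _ _ _) (neg_det _ _ _) (neg_det _ _ _).
by case: a.1; case: b.1; case: c.1; case: d.1; do 4 case.
Qed.

Definition segs a l := pairmap (fun x y : bool * I => (x, y)) a l.

Variable o : I.

(** A height function for the curve [Q] seen from the base point [o]: its difference along a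
segment counts the crossings of the segment with [Q], as long as [Q] is closed. *)
Definition cone_parity (Q : seq ((bool * I) * (bool * I))) a := \xor_(t <- Q) seg_cross ((false, o), a) t.

Definition chain_cross (C Q : seq ((bool * I) * (bool * I))) := \xor_(s <- C) \xor_(t <- Q) seg_cross s t.

Lemma telescope_segs (g : bool * I -> bool) a l :
  \xor_(t <- segs a l) (g t.1 (+) g t.2) = g a (+) g (last a l).
Proof.
elim: l a => [|b l IH] a /=; first by rewrite big_nil addbb.
by rewrite big_cons IH /= -addbA addKb.
Qed.

Definition avoids (a : bool * I) (Q : seq ((bool * I) * (bool * I))) :=
  all (fun t => [&& a.2 != t.1.2, a.2 != t.2.2, o != t.1.2, o != t.2.2 & t.1.2 != t.2.2]) Q.

(** Sum the triangle identity over the segments of [Q]: the contributions of the vertices of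
[Q] being inside the triangle telescope, and those of its two ends cancel as [Q] closes
up, possibly at the antipode. *)
Lemma cone_parity_edge q l a b : let Q := segs q l in
  (last q l = q) \/ (k /\ last q l = opp q) ->
  avoids a Q -> avoids b Q -> a.2 != b.2 -> o != a.2 -> o != b.2 -> q.2 != a.2 -> q.2 != b.2 -> o != q.2 ->
  \xor_(t <- Q) seg_cross (a, b) t = cone_parity Q a (+) cone_parity Q b.
Proof.
move=> Q hl aQ bQ ab oa ob qa qb oq.
pose g (t : bool * I) := inside k (signed_point (false, o)) (signed_point a) (signed_point b) (signed_point t).
have E : \xor_(t <- Q) seg_cross (a, b) t = \xor_(t <- Q) ((seg_cross ((false, o), a) t (+) seg_cross ((false, o), b) t) (+)
   (g t.1 (+) g t.2)).
  apply: eq_big_seq => t tQ; have /and5P[h1 h2 h3 h4 h5] := allP aQ t tQ.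
  have /and5P[h6 h7 _ _ _] := allP bQ t tQ.
  by apply: cross_triangle; apply: generic_signed; rewrite /= !inE ?negb_or ?h1 ?h2 ?h3 ?h4 ?h5 ?h6 ?h7 ?ab ?oa ?ob.
rewrite E big_split [X in X (+) _ = _]big_split telescope_segs /=.
suff -> : g q (+) g (last q l) = false by rewrite addbF.
case: hl => [->|[hk ->]]; first by rewrite addbb.
have u1 : uniq [:: o; a.2; q.2] by rewrite /= !inE negb_or oa oq eq_sym qa.
have u2 : uniq [:: a.2; b.2; q.2] by rewrite /= !inE negb_or ab ![_ == q.2]eq_sym qa qb.
have u3 : uniq [:: b.2; o; q.2] by rewrite /= !inE negb_or oq eq_sym ob eq_sym qb.
rewrite /g /inside hk /= !neg_signed //=.
move: (neg_det _ _ _) (neg_det _ _ _) (neg_det _ _ _); by case: a.1; case: b.1; case: q.1; do 3 case.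
Qed.

(** Replacing a point by its antipode changes its height exactly when [Q] is one-sided, that
is when it ends at the antipode of its start. *)
Lemma cone_parity_opp q l a : let Q := segs q l in k -> (last q l).2 = q.2 ->
  avoids a Q -> o != a.2 -> q.2 != a.2 -> o != q.2 ->
  cone_parity Q (opp a) = cone_parity Q a (+) (q.1 (+) (last q l).1).
Proof.
move=> Q hk hl aQ oa qa oq.
pose g (t : bool * I) := neg_det (signed_point (false, o)) (signed_point a) (signed_point t).
have E : cone_parity Q a (+) cone_parity Q (opp a) = \xor_(t <- Q) (g t.1 (+) g t.2).
  rewrite /cone_parity -big_split /=; apply: eq_big_seq => t tQ.
  have /and5P[h1 h2 h3 h4 h5] := allP aQ t tQ.
  rewrite /seg_cross hk /=.
  have -> : signed_point (opp a) = - signed_point a by rewrite /signed_point /=; case: a.1; rewrite //= opprK.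
  apply: cross_antipode; apply: generic_signed;  by rewrite /= !inE ?negb_or ?h1 ?h2 ?h3 ?h4 ?h5 ?oa.
have u1 : uniq [:: o; a.2; q.2] by rewrite /= !inE negb_or oa oq eq_sym qa.
move: E; rewrite telescope_segs /g !neg_signed /= ?hl //=.
by case: (cone_parity Q a); case: (cone_parity Q (opp a)); case: a.1; case: q.1; case: (last q l).1; case: neg_det.
Qed.

Lemma chain_cross_path q l a m : let Q := segs q l in
  (last q l = q) \/ (k /\ last q l = opp q) ->
  path (fun x y => x.2 != y.2) q l -> path (fun x y => x.2 != y.2) a m ->
  all (fun x => x.2 \notin map snd (q :: l)) (a :: m) ->
  o \notin map snd (q :: l) -> o \notin map snd (a :: m) ->
  chain_cross (segs a m) Q = cone_parity Q a (+) cone_parity Q (last a m).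
Proof.
move=> Q hl hq ha dis hoq ho.
have avo (x : bool * I) : x.2 \notin map snd (q :: l) -> avoids x Q.
  move: hoq; rewrite /avoids /Q; elim: (l) (q) hq => [//|c r IH] d /= /andP[dc hr].
  rewrite !inE !negb_or => /and3P[od oc orr] /and3P[xd xc xr].
  rewrite xd xc od oc dc /=; apply: IH; rewrite ?inE ?negb_or ?xc ?oc ?xr ?orr //.
have oq : o != q.2 by move: hoq; rewrite inE negb_or => /andP[].
elim: m a ha dis ho => [|b m IH] a /=; first by move=> _ _ _; rewrite /chain_cross big_nil addbb.
move=> /andP[ab ha] /and3P[ha' hb hm]; rewrite !inE !negb_or => /and3P[oa ob om].
rewrite /chain_cross big_cons -/(chain_cross _ _) IH ?hb ?hm ?inE ?negb_or ?ob ?om //.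
rewrite cone_parity_edge ?avo //.
- by rewrite addbA addbK.
- by move: ha'; rewrite !inE negb_or eq_sym => /andP[].
- by move: hb; rewrite !inE negb_or eq_sym => /andP[].
- by rewrite /= hb hm.
Qed.

Lemma chain_crossC C D : chain_cross C D = chain_cross D C.
Proof.
rewrite /chain_cross exchange_big; apply: eq_bigr => s _; apply: eq_bigr => t _; exact: seg_crossC.
Qed.

Lemma chain_cross_catl C C' D : chain_cross (C ++ C') D = chain_cross C D (+) chain_cross C' D.
Proof. by rewrite /chain_cross big_cat. Qed.

Lemma chain_cross_catr C D D' : chain_cross C (D ++ D') = chain_cross C D (+) chain_cross C D'.
Proof. by rewrite chain_crossC chain_cross_catl ![chain_cross _ C]chain_crossC. Qed.

Lemma chain_cross_cons s C D : chain_cross (s :: C) D = chain_cross [:: s] D (+) chain_cross C D.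
Proof. by rewrite -cat1s chain_cross_catl. Qed.

Lemma chain_cross1 s t : chain_cross [:: s] [:: t] = seg_cross s t.
Proof. by rewrite /chain_cross !big_seq1. Qed.

(** One edge in both drawings: [wu, wv] are the positions of its ends in the reference
drawing, [fu, fv] those in the drawing to be tested, [mid] the interior vertices of the
polygon in the latter, and [cls] tells whether the lifted polygon ends at the antipode
of [fv]. *)
Record drawn := Drawn { wu : I; wv : I; fu : I; fv : I; mid : seq (bool * I); cls : bool }.

Definition line e := segs (false, fu e) (rcons (mid e) (cls e, fv e)).
(** From [wu] along a tail to [fu], along the polygon to a lift of [fv], and back to a lift
of [wu] along the other tail and the chord of the reference drawing. *)
Definition loop e :=
  (false, fu e) :: rcons (mid e) (cls e, fv e) ++ [:: (cls e, wv e); (cls e, wu e)].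
Definition loopc e := segs (false, wu e) (loop e).
Definition support e := [:: wu e, wv e, fu e, fv e & map snd (mid e)].
Definition well_drawn e := [/\ uniq (support e), o \notin support e & cls e -> k].
Definition tail w f : (bool * I) * (bool * I) := ((false, w), (false, f)).
Definition tails e := [:: tail (wu e) (fu e); tail (wv e) (fv e)].
Definition chord e := tail (wu e) (wv e).
Definition closing e := rcons (tails e) (chord e).

Lemma loopcE e : loopc e = tail (wu e) (fu e) :: line e ++
  [:: ((cls e, fv e), (cls e, wv e)); ((cls e, wv e), (cls e, wu e))].
Proof. by rewrite /loopc /loop /segs /= pairmap_cat last_rcons. Qed.

Lemma loop_closed e : well_drawn e ->
  last (false, wu e) (loop e) = (false, wu e) \/
  (k /\ last (false, wu e) (loop e) = opp (false, wu e)).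
Proof.
case=> _ _ hc; rewrite /loop /= last_cat /=.
by case: (cls e) hc => hc; [right; split => //; apply: hc | left].
Qed.

Lemma sub_loop e : {subset map snd ((false, wu e) :: loop e) <= support e}.
Proof.
move=> x; rewrite /loop /support /= map_cat map_rcons /= !(inE, mem_cat, mem_rcons).
case: (x == wu e); case: (x == wv e); case: (x == fu e); case: (x == fv e) => //=.
by rewrite ?orbF.
Qed.

Lemma uniq_path a m : uniq (map snd (a :: m)) ->
  path (fun x y : bool * I => x.2 != y.2) a m.
Proof.
elim: m a => [//|b m IH] a /=; rewrite inE negb_or -andbA => /andP[-> /andP[_ h]] /=.
exact: IH.
Qed.

Lemma loop_path e : uniq (support e) ->
  path (fun x y => x.2 != y.2) (false, wu e) (loop e).
Proof.
move=> u.
have -> : loop e = rcons ((false, fu e) :: rcons (rcons (mid e) (cls e, fv e)) (cls e, wv e)) (cls e, wu e).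
  by rewrite /loop -!cats1 /= -!catA.
rewrite rcons_path; apply/andP; split; last first.
  rewrite /= last_rcons /=; move: u; rewrite /support /= !inE !negb_or eq_sym.
  by move=> /andP[/andP[]].
apply: uniq_path; rewrite -(@perm_uniq _ (support e)) // /support /= !map_rcons.
by apply/seq.permP => a; rewrite /= -!cats1 !count_cat /=; lia.
Qed.

Lemma segsP a l t : path (fun x y : bool * I => x.2 != y.2) a l -> t \in segs a l ->
  [/\ t.1.2 \in map snd (a :: l), t.2.2 \in map snd (a :: l) & t.1.2 != t.2.2].
Proof.
elim: l a => [//|b l IH] a /= /andP[ab bl]; rewrite inE => /orP[/eqP-> /=|tl].
  by rewrite !inE !eqxx orbT.
by case: (IH b bl tl) => h1 h2 h3; split=> //; rewrite in_cons; apply/orP; right.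
Qed.

Lemma loopc_support e t : uniq (support e) -> t \in loopc e ->
  [/\ t.1.2 \in support e, t.2.2 \in support e & t.1.2 != t.2.2].
Proof.
by move=> u /(segsP (loop_path u))[/sub_loop? /sub_loop? ?].
Qed.

Lemma line_support e t : uniq (support e) -> t \in line e ->
  [/\ t.1.2 \in support e, t.2.2 \in support e & t.1.2 != t.2.2].
Proof.
move=> u tl; apply: loopc_support => //; rewrite loopcE inE mem_cat tl orbT //.
Qed.

Lemma closing_support e t : uniq (support e) -> t \in closing e ->
  [/\ t.1.2 \in support e, t.2.2 \in support e & t.1.2 != t.2.2].
Proof.
rewrite /support /= !inE !negb_or => /andP[/and4P[n1 n2 n3 _] /andP[/and3P[n4 n5 _] _]].
by move=> /or3P[] /eqP-> /=; rewrite ?eqxx ?orbT.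
Qed.

(** The part of the loop that closes it up may run through antipodes of the reference points,
which does not matter for crossings because this happens only when antipodes are
identified. *)
Lemma chain_cross_loopl e C : well_drawn e ->
  all (fun t => [&& t.1.2 \notin support e, t.2.2 \notin support e & t.1.2 != t.2.2]) C ->
  chain_cross (loopc e) C = chain_cross (line e) C (+) chain_cross (closing e) C.
Proof.
case=> u _ hc hC.
have E t : t \in C -> seg_cross ((cls e, fv e), (cls e, wv e)) t = seg_cross (tail (wv e) (fv e)) t /\
     seg_cross ((cls e, wv e), (cls e, wu e)) t = seg_cross (chord e) t.
  move=> /(allP hC)/and3P[].
  rewrite /support !inE !negb_or => /and5P[t1 t2 t3 t4 _] /and5P[t5 t6 t7 t8 _] t9.
  have [n1 n2] : wu e != wv e /\ wv e != fv e.
    move: u; rewrite /support /= !inE !negb_or => /andP[/andP[-> _] /andP[/and3P[_ -> _] _]]; by [].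
  have U (x : bool) : uniq [:: (x, wv e).2; (x, fv e).2; t.1.2; t.2.2].
    by rewrite /= !inE !negb_or n2 t9 ![_ == t.1.2]eq_sym ![_ == t.2.2]eq_sym t2 t4 t6 t8.
  have U' (x : bool) : uniq [:: (x, wu e).2; (x, wv e).2; t.1.2; t.2.2].
    by rewrite /= !inE !negb_or n1 t9 ![_ == t.1.2]eq_sym ![_ == t.2.2]eq_sym t1 t2 t5 t6.
  rewrite -(seg_cross_swap (U (cls e))) -(seg_cross_swap (U' (cls e))) /tail /chord /tail.
  case: (cls e) hc => hc //; split; rewrite -seg_cross_opp //; exact: hc.
rewrite loopcE chain_cross_cons chain_cross_catl (chain_cross_cons _ [:: ((cls e, wv e), _)]).
rewrite /closing /tails /= (chain_cross_cons _ [:: tail (wv e) _; _]) (chain_cross_cons _ [:: chord e]).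
suff [-> ->] : chain_cross [:: ((cls e, fv e), (cls e, wv e))] C = chain_cross [:: tail (wv e) (fv e)] C
   /\ chain_cross [:: ((cls e, wv e), (cls e, wu e))] C = chain_cross [:: chord e] C.
  by rewrite addbCA.
by split; rewrite /chain_cross !big_seq1; apply: eq_big_seq => t /E[].
Qed.

Lemma chain_cross_closing e f : well_drawn e -> well_drawn f -> (forall x, x \in support e -> x \notin support f) ->
  chain_cross (closing e) (loopc f) = cone_parity (loopc f) (false, fu e) (+) cone_parity (loopc f) (false, fv e).
Proof.
move=> [ue oe _] wff dis; have [uf of_ _] := wff.
have hp a b : a \in support e -> b \in support e -> a != b ->
   chain_cross [:: tail a b] (loopc f) = cone_parity (loopc f) (false, a) (+) cone_parity (loopc f) (false, b).
  move=> ae be ab; rewrite -[[:: _]]/(segs (false, a) [:: (false, b)]) chain_cross_path //=.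
  - exact: loop_closed.
  - exact: loop_path.
  - by rewrite ab.
  - by rewrite !(contra (@sub_loop _ _)) // dis.
  - by apply: contra of_ => /sub_loop.
  - rewrite !inE negb_or; apply/andP; split; apply: contraNneq oe => ->; by [].
rewrite /closing /tails /= (chain_cross_cons _ [:: tail (wv e) _; _]) (chain_cross_cons _ [:: chord e]).
move: ue; rewrite /support /= !inE !negb_or => /andP[/and4P[n1 n2 n3 _] /andP[/and3P[n4 n5 _] _]].
rewrite !hp ?inE ?eqxx ?orbT // /chord.
by case: (cone_parity _ (false, wu e)); case: (cone_parity _ (false, wv e)); case: (cone_parity _ (false, fu e)); case: (cone_parity _ (false, fv e)).
Qed.

(** The intersection form of the projective plane: closed curves meet evenly unless both are
one-sided. *)
Lemma chain_cross_loops e f : well_drawn e -> well_drawn f -> (forall x, x \in support e -> x \notin support f) ->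
  chain_cross (loopc e) (loopc f) = cls e && cls f.
Proof.
move=> wfe wff dis; have [ue oe ce] := wfe; have [uf of_ cf] := wff.
have avo (x : bool * I) : x.2 \in support e -> avoids x (loopc f).
  move=> /dis xf; apply/allP => t /(loopc_support uf)[t1 t2 t3].
  by apply/and5P; split=> //; [apply: contraNneq xf|apply: contraNneq xf|apply: contraNneq of_|apply: contraNneq of_] => ->.
rewrite /loopc chain_cross_path.
- have -> : last (false, wu e) (loop e) = (cls e, wu e) by rewrite /loop /= last_cat.
  case hc: (cls e); last by rewrite addbb.
  rewrite -[(true, wu e)]/(opp (false, wu e)) cone_parity_opp ?addKb.
  + by rewrite /loop /= last_cat.
  + exact: ce.
  + by rewrite /loop /= last_cat.
  + by rewrite avo // inE eqxx.
  + by apply: contraNneq oe => ->; rewrite inE eqxx.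
  + have := dis (wu e); rewrite inE eqxx => /(_ isT); apply: contraNneq => /= <-; by rewrite inE eqxx.
  + by apply: contraNneq of_ => ->; rewrite inE eqxx.
- exact: loop_closed.
- exact: loop_path.
- exact: loop_path.
- by apply/allP => x xl; rewrite (contra (@sub_loop _ _)) // dis // sub_loop // map_f.
- by rewrite (contra (@sub_loop _ _)).
- by rewrite (contra (@sub_loop _ _)).
Qed.

(** Each loop is a polygon followed by its closing part, so [chain_cross_loops] expands into
crossings of polygons, of a closing part with a loop, and of two closing parts.  The
second kind consists of differences of heights, and in the third kind two tails and a
chord contribute. *)
Theorem pair_identity e f : well_drawn e -> well_drawn f -> (forall x, x \in support e -> x \notin support f) ->
  chain_cross (line e) (line f) = (cls e && cls f) (+) seg_cross (chord e) (chord f)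
   (+) (cone_parity (loopc f) (false, fu e) (+) cone_parity (loopc f) (false, fv e))
   (+) (cone_parity (loopc e) (false, fu f) (+) cone_parity (loopc e) (false, fv f))
   (+) chain_cross (tails e) [:: chord f] (+) chain_cross (tails f) [:: chord e] (+) chain_cross (tails e) (tails f).
Proof.
move=> wfe wff dis.
have dis' x : x \in support f -> x \notin support e by apply: contraL => /dis.
rewrite -(chain_cross_loops wfe wff dis) -(chain_cross_closing wfe wff dis) -(chain_cross_closing wff wfe dis').
have [[ue _ _] [uf _ _]] := (wfe, wff).
have hl : chain_cross (loopc e) (loopc f) = chain_cross (line e) (loopc f) (+) chain_cross (closing e) (loopc f).
  by apply: chain_cross_loopl => //; apply/allP => t /(loopc_support uf)[t1 t2 t3]; rewrite t3 !dis'.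
have hr : chain_cross (loopc e) (closing f) = chain_cross (line e) (closing f) (+) chain_cross (closing e) (closing f).
  by apply: chain_cross_loopl => //; apply/allP => t /(closing_support uf)[t1 t2 t3]; rewrite t3 !dis'.
have hf : chain_cross (line e) (loopc f) = chain_cross (line e) (line f) (+) chain_cross (line e) (closing f).
  rewrite chain_crossC chain_cross_loopl // ?[chain_cross _ (line e)]chain_crossC //.
  by apply/allP => t /(line_support ue)[t1 t2 t3]; rewrite t3 !dis.
rewrite hl hf [chain_cross (closing f) _]chain_crossC hr /closing -!cats1 !chain_cross_catl !chain_cross_catr chain_cross1.
rewrite [chain_cross (tails f) [:: chord e]]chain_crossC.
move: (chain_cross (line e) _) (chain_cross (line e) _) (chain_cross (line e) _) (chain_cross (tails e) _) (chain_cross (tails e) _) (chain_cross (tails e) _) (chain_cross [:: _] _)  (chain_cross [:: _] _) (seg_cross _ _).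
by do 9 case.
Qed.
End Chains.

(** * Separated segments and general position *)
Section NoCrossing.
Variable K : realFieldType.
Implicit Types p q u w : 'rV[K]_3.

Definition dot3 p q := p 0 0 * q 0 0 + p 0 1 * q 0 1 + p 0 2 * q 0 2.

Lemma same_sign (x y : K) : x != 0 -> y != 0 -> (x < 0) = (y < 0) -> 0 < x * y.
Proof.
move=> x0 y0; case: (ltgtP x 0) (x0) => // hx _; case: (ltgtP y 0) (y0) => // hy _ _.
  by rewrite nmulr_rgt0.
exact: mulr_gt0.
Qed.

Lemma same_neg (x y : K) : x != 0 -> y != 0 -> (x < 0) = ~~ (y < 0) -> 0 < x * - y.
Proof.
move=> x0 y0 e; apply: same_sign; rewrite ?oppr_eq0 // e.
by rewrite oppr_lt0 -leNgt le_eqVlt eq_sym (negbTE y0).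
Qed.

(** At a crossing, positive combinations of [p, p'] and of [q, q'] are parallel, so that
[det3 w] vanishes on them; but it is positive on all four pairs. *)
Lemma no_cross_projective w p p' q q' :
  det3 p q q' != 0 -> det3 p' q q' != 0 -> det3 p p' q != 0 -> det3 p p' q' != 0 ->
  0 < det3 w p q -> 0 < det3 w p q' -> 0 < det3 w p' q -> 0 < det3 w p' q' ->
  cross true p p' q q' = false.
Proof.
move=> d1 d2 d3 d4 h1 h2 h3 h4; apply/negP; rewrite /cross /neg_det /= andbT.
move=> /andP[/eqP/(same_neg d2 d1) aa].
rewrite eq_sym => /eqP/(same_neg d3 d4) bb.
set a := det3 p' q q' in aa; set a' := - det3 p q q' in aa.
set b := det3 p p' q in bb; set b' := - det3 p p' q' in bb.
have E : (a * a) * (b * b) * det3 w p q' + (a * a) * (b * b') * det3 w p q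
   + (a * a') * (b * b) * det3 w p' q' + (a * a') * (b * b') * det3 w p' q = 0.
  by rewrite /a /a' /b /b' /det3; ring.
suff : 0 < (a * a) * (b * b) * det3 w p q' + (a * a) * (b * b') * det3 w p q
   + (a * a') * (b * b) * det3 w p' q' + (a * a') * (b * b') * det3 w p' q.
  by rewrite E ltxx.
have a2 : 0 <= a * a by rewrite -expr2 sqr_ge0.
have b2 : 0 <= b * b by rewrite -expr2 sqr_ge0.
apply: ltr_wpDl (mulr_gt0 (mulr_gt0 aa bb) h3).
apply: addr_ge0 (mulr_ge0 (mulr_ge0 (ltW aa) b2) (ltW h4)).
exact: addr_ge0 (mulr_ge0 (mulr_ge0 a2 b2) (ltW h2)) (mulr_ge0 (mulr_ge0 a2 (ltW bb)) (ltW h1)).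
Qed.

(** At a crossing, positive combinations of [p, p'] and of [q, q'] are equal, but the
functional given by [u] separates them. *)
Lemma no_cross_sphere u p p' q q' :
  det3 p q q' != 0 -> det3 p' q q' != 0 -> det3 p p' q != 0 -> det3 p p' q' != 0 ->
  0 < dot3 u p -> 0 < dot3 u p' -> dot3 u q < 0 -> dot3 u q' < 0 ->
  cross false p p' q q' = false.
Proof.
move=> d1 d2 d3 d4 h1 h2 h3 h4; apply/negP; rewrite /cross /neg_det /=.
move=> /and3P[/eqP/(same_neg d2 d1) aa /eqP e1 /eqP e2].
have := same_neg d3 d4; rewrite -e1 => /(_ erefl).
have := same_neg d2 d4; rewrite e2 => /(_ erefl).
set a := det3 p' q q' in aa *; set a' := - det3 p q q' in aa *.
set b := det3 p p' q; set b' := - det3 p p' q' => ab' bb'.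
have E : (a * a) * dot3 u p + (a * a') * dot3 u p' = (a * b') * dot3 u q + (a * b) * dot3 u q'.
  by rewrite /a /a' /b /b' /det3 /dot3; ring.
have a0 : a != 0 := d2.
have aa2 : 0 < a * a by rewrite lt_neqAle -expr2 sqr_ge0 eq_sym sqrf_eq0 a0.
have b'2 : 0 < b' * b' by rewrite lt_neqAle -expr2 sqr_ge0 eq_sym sqrf_eq0 oppr_eq0 d4.
have ab : 0 < a * b.
  have : 0 < (a * b) * (b' * b') by rewrite mulrACA; apply: mulr_gt0.
  by rewrite pmulr_lgt0.
have : 0 < (a * a) * dot3 u p + (a * a') * dot3 u p' by apply: addr_gt0; apply: mulr_gt0.
by rewrite E; apply/negP; rewrite -leNgt; rewrite -oppr_ge0 opprD addr_ge0 // oppr_ge0 pmulr_rle0 // ltW.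
Qed.
End NoCrossing.

Section GeneralPosition.
Variable K : realFieldType.
Notation V3 := 'rV[K]_3.

Definition close3 (d : K) (p q : V3) := forall j, `|p 0 j - q 0 j| < d.

Lemma nonroot_near (p : {poly K}) (d : K) : p != 0 -> 0 < d ->
  exists t, [/\ 0 < t, t < d & p.[t] != 0].
Proof.
move=> p0 d0; pose s := [seq d / (i.+2)%:R | i <- iota 0 (size p)].
have us : uniq s.
  rewrite map_inj_uniq ?iota_uniq // => i j /(mulfI (lt0r_neq0 d0))/invr_inj/eqP.
  by rewrite eqr_nat => /eqP[].
have : ~~ all (root p) s.
  apply/negP => al; have := max_poly_roots p0 al us.
  by rewrite size_map size_iota ltnn.
move=> /allPn[t /mapP[i _ ->] nr]; exists (d / i.+2%:R); split => //.
  by rewrite divr_gt0 // ltr0n.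
by rewrite ltr_pdivrMr ?ltr0n // ltr_pMr // ltr1n.
Qed.

(** A plane through the origin contains only finitely many points of this curve through [x],
because the three powers of [t] are linearly independent. *)
Definition curve (x : V3) (t : K) : V3 := \row_j (x 0 j + t ^+ j.+1).

Lemma avoid_planes (s : seq (V3 * V3)) (x : V3) (d : K) : 0 < d ->
  (forall ab, ab \in s -> exists r, det3 ab.1 ab.2 r != 0) ->
  exists2 y, close3 d y x & forall ab, ab \in s -> det3 ab.1 ab.2 y != 0.
Proof.
move=> d0 hs.
pose c0 (ab : V3 * V3) := ab.1 0 1 * ab.2 0 2 - ab.1 0 2 * ab.2 0 1.
pose c1 (ab : V3 * V3) := ab.1 0 2 * ab.2 0 0 - ab.1 0 0 * ab.2 0 2.
pose c2 (ab : V3 * V3) := ab.1 0 0 * ab.2 0 1 - ab.1 0 1 * ab.2 0 0.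
(* The determinant along the curve is a polynomial whose higher coefficients are those of
   the linear form defining the plane. *)
pose pol ab : {poly K} := Poly [:: det3 ab.1 ab.2 x; c0 ab; c1 ab; c2 ab].
have polE ab t : (pol ab).[t] = det3 ab.1 ab.2 (curve x t).
  by rewrite horner_Poly /= /det3 /c0 /c1 /c2 !mxE /=; ring.
have pol0 ab : ab \in s -> pol ab != 0.
  move=> /hs[r]; apply: contraNneq => p0.
  have e i : [:: det3 ab.1 ab.2 x; c0 ab; c1 ab; c2 ab]`_i = 0 by rewrite -coef_Poly -/(pol ab) p0 coef0.
  have -> : det3 ab.1 ab.2 r = c0 ab * r 0 0 + c1 ab * r 0 1 + c2 ab * r 0 2.
    by rewrite /det3 /c0 /c1 /c2; ring.
  by move: (e 1%N) (e 2%N) (e 3%N) => /= -> -> ->; rewrite !mul0r !addr0.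
have P0 : \prod_(ab <- s) pol ab != 0.
  by rewrite prodf_seq_neq0; apply/allP => ab /pol0.
have m0 : 0 < Num.min d 1 by rewrite lt_min d0 ltr01.
have [t [t0]] := nonroot_near P0 m0.
rewrite lt_min => /andP[td t1]; rewrite horner_prod prodf_seq_neq0 => /allP ht.
exists (curve x t); last by move=> ab /ht; rewrite polE.
move=> j; rewrite mxE addrC addKr ger0_norm ?exprn_ge0 ?ltW //.
apply: le_lt_trans td; rewrite exprS ler_piMr ?exprn_ile1 // ltW //.
Qed.

Definition generic (I : eqType) (P : I -> V3) (s : seq I) :=
  forall i j l, i \in s -> j \in s -> l \in s -> uniq [:: i; j; l] ->
  det3 (P i) (P j) (P l) != 0.

(** Points are moved one at a time, off the planes spanned by pairs of earlier points; the
points in [s0] stay where they are. *)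
Lemma generic_extend (I : eqType) (P : I -> V3) (s0 s : seq I) (d : K) : 0 < d ->
  generic P s0 -> (2 < size s0)%N -> uniq (s ++ s0) ->
  exists Q : I -> V3, [/\ {in s0, Q =1 P}, forall i, close3 d (Q i) (P i) & generic Q (s ++ s0)].
Proof.
move=> d0 g0 s02; elim: s => [|x s IH] /= us.
  by exists P; split => // i j; rewrite subrr normr0.
move: us => /andP[xs us]; have [Q [Q0 Qd Qg]] := IH us.
have us0 : uniq s0 by move: us; rewrite cat_uniq => /and3P[].
pose L := [seq (Q a, Q b) | a <- s ++ s0, b <- [seq b <- s ++ s0 | b != a]].
have hL ab : ab \in L -> exists r, det3 ab.1 ab.2 r != 0.
  move=> /allpairsPdep[a [b [ai]]]; rewrite mem_filter => /andP[ba bi] -> /=.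
  have [c [c0 ca cb]] : exists c, [/\ c \in s0, c != a & c != b].
    case: (s0) us0 s02 => [|c1 [|c2 [|c3 s1]]] //= uu _.
    have [e1|n1] := altP (c1 =P a); have [e2|n2] := altP (c1 =P b).
    - by rewrite -e1 -e2 eqxx in ba.
    - have [e3|n3] := altP (c2 =P b).
        exists c3; split; rewrite ?inE ?eqxx ?orbT //.
          by apply: contraTneq uu => ->; rewrite e1 !inE eqxx ?orbT.
        by apply: contraTneq uu => ->; rewrite e3 !inE eqxx /= ?orbT ?andbF.
      exists c2; split; rewrite ?inE ?eqxx ?orbT //.
      by apply: contraTneq uu => ->; rewrite e1 !inE eqxx ?orbT.
    - have [e3|n3] := altP (c2 =P a).
        exists c3; split; rewrite ?inE ?eqxx ?orbT //.
          by apply: contraTneq uu => ->; rewrite e3 !inE eqxx /= ?orbT ?andbF.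
        by apply: contraTneq uu => ->; rewrite e2 !inE eqxx ?orbT.
      exists c2; split; rewrite ?inE ?eqxx ?orbT //.
      by apply: contraTneq uu => ->; rewrite e2 !inE eqxx ?orbT.
    - by exists c1; split; rewrite ?inE ?eqxx.
  exists (Q c); apply: Qg => //; first by rewrite mem_cat c0 orbT.
  by rewrite /= !inE negb_or (eq_sym a b) ba (eq_sym a c) ca (eq_sym b c) cb.
have [y yd yL] := avoid_planes (P x) d0 hL.
exists (fun i => if i == x then y else Q i); split.
- move=> i i0; case: eqP => [ix|_]; last exact: Q0.
  by move: xs; rewrite -ix mem_cat i0 orbT.
- by move=> i; case: eqP => [->|].
have key a b : a \in s ++ s0 -> b \in s ++ s0 -> a != b -> det3 (Q a) (Q b) y != 0.
  move=> ai bi ab; apply: (yL (Q a, Q b)); apply/allpairsPdep; exists a, b; split => //.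
  by rewrite mem_filter eq_sym ab.
move=> i j l; rewrite !inE /= => hi hj hl; rewrite !inE negb_or andbT => /andP[/andP[ij il] jl].
move: hi hj hl.
have [ix|_] := eqVneq i x; [|have [jx|_] := eqVneq j x; [|have [lx|_] := eqVneq l x]] => /= hi hj hl.
- have nj : (j == x) = false by rewrite -ix eq_sym (negbTE ij).
  have nl : (l == x) = false by rewrite -ix eq_sym (negbTE il).
  by move: hj hl; rewrite nj nl /= => hj hl; rewrite -det3R; apply: key.
- have nl : (l == x) = false by rewrite -jx eq_sym (negbTE jl).
  by move: hl; rewrite nl /= => hl; rewrite det3C2 oppr_eq0; apply: key.
- exact: key.
- by apply: Qg => //; rewrite /= !inE negb_or ij il jl.
Qed.
End GeneralPosition.

(** * The van Kampen obstruction for polygonal drawings *)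
(** Crossing of chords in convex position, whose vertices are numbered along the convex
curve. *)
Definition interlace (e f : nat * nat) :=
  (e.1 < f.1 < e.2)%N (+) (e.1 < f.2 < e.2)%N.

Section Moment.
Variable K : realFieldType.
(** Signs of determinants of points on this curve depend only on the order of their
parameters. *)
Definition moment (i : nat) : 'rV[K]_3 := \row_j (i%:R ^+ j).

Lemma det3_moment i j l :
  det3 (moment i) (moment j) (moment l) = (j%:R - i%:R) * (l%:R - i%:R) * (l%:R - j%:R).
Proof. by rewrite /det3 !mxE /=; ring. Qed.

Lemma det3_moment_neq0 i j l : uniq [:: i; j; l] ->
  det3 (moment i) (moment j) (moment l) != 0.
Proof.
rewrite /= !inE negb_or andbT => /andP[/andP[ij il] jl].
by rewrite det3_moment !mulf_neq0 // subr_eq0 eqr_nat eq_sym.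
Qed.

Lemma neg_moment i j l : uniq [:: i; j; l] ->
  neg_det (moment i) (moment j) (moment l) = (j < i)%N (+) (l < i)%N (+) (l < j)%N.
Proof.
rewrite /= !inE negb_or andbT => /andP[/andP[ij il] jl].
have n0 a b : a != b -> (a%:R - b%:R : K) != 0 by move=> ab; rewrite subr_eq0 eqr_nat.
rewrite /neg_det det3_moment !mul_lt0P ?mulf_neq0 ?n0 // 1?eq_sym //.
by rewrite !subr_lt0 !ltr_nat.
Qed.

Lemma cross_moment k u v a b : (u < v)%N -> (a < b)%N -> uniq [:: u; v; a; b] ->
  cross k (moment u) (moment v) (moment a) (moment b) = interlace (u, v) (a, b).
Proof.
move=> uv ab; rewrite /= !inE !negb_or andbT => /and3P[/and3P[n1 n2 n3] /andP[n4 n5] n6].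
rewrite /cross !neg_moment /= ?inE ?negb_or ?n1 ?n2 ?n3 ?n4 ?n5 ?n6 // /interlace /=.
have flip (y z : nat) : y != z -> (z < y)%N = ~~ (y < z)%N.
  by move=> yz; rewrite -leqNgt [RHS]leq_eqVlt (eq_sym z) (negbTE yz).
rewrite (flip u v) // (flip a b) // (flip u a) // (flip u b) // (flip v a) // (flip v b) // uv ab.
have := @ltn_trans v u a; have := @ltn_trans v u b; have := @ltn_trans a u b; have := @ltn_trans a v b.
rewrite uv ab.
by case: (u < a)%N; case: (u < b)%N; case: (v < a)%N; case: (v < b)%N => h1 h2 h3 h4; case: k => //=;
  first [by have := h1 isT isT | by have := h2 isT isT | by have := h3 isT isT | by have := h4 isT isT].
Qed.
End Moment.

Section Obstruction.
Variables (K : realFieldType) (k : bool) (N : nat).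
Notation V3 := 'rV[K]_3.
Notation edge := ('I_N * 'I_N)%type.
Hypothesis N2 : (2 < N)%N.
Variables (E : pred edge) (n : nat) (sample : edge -> nat -> V3) (phi : 'I_N -> V3)
  (x : edge -> bool) (d : K).
Hypotheses (Elt : forall e, E e -> (e.1 < e.2)%N) (xk : forall e, E e -> x e -> k)
  (sample0 : forall e, E e -> sample e 0 = phi e.1)
  (samplen : forall e, E e -> sample e n.+1 = (if x e then - phi e.2 else phi e.2))
  (d0 : 0 < d).

Definition disjoint_edges (e f : edge) := uniq [:: e.1; e.2; f.1; f.2].

Hypothesis stable : forall e f i j p p' q q', E e -> E f -> disjoint_edges e f ->
  (i <= n)%N -> (j <= n)%N ->
  close3 d p (sample e i) -> close3 d p' (sample e i.+1) ->
  close3 d q (sample f j) -> close3 d q' (sample f j.+1) ->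
  det3 p q q' != 0 -> det3 p' q q' != 0 -> det3 p p' q != 0 -> det3 p p' q' != 0 ->
  cross k p p' q q' = false.

Let I : finType := ('I_N + 'I_N + (edge * 'I_n) + unit)%type.
Let W (v : 'I_N) : I := inl (inl (inl v)).
Let Phi (v : 'I_N) : I := inl (inl (inr v)).
Let Sample (e : edge) (i : 'I_n) : I := inl (inr (e, i)).
Let O : I := inr tt.

Let target (i : I) : V3 := match i with
  | inl (inl (inl v)) => moment K v
  | inl (inl (inr v)) => phi v
  | inl (inr (e, i)) => sample e i.+1
  | inr _ => 0
  end.

Let draw (e : edge) : drawn I :=
  Drawn (W e.1) (W e.2) (Phi e.1) (Phi e.2) [seq (false, Sample e i) | i <- enum 'I_n] (x e).

(** The polygons of disjoint edges do not cross, because crossings are excluded for all small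
perturbations of the samples.  So [pair_identity] has zero on its left, and its right is
regrouped by assigning each term to a vertex of one edge together with the other edge.
A crossing of two tails belongs to two vertices; [half] charges it to the one with the
smaller number. *)
Theorem obstruction : exists kk : 'I_N -> edge -> bool,
  forall e f, E e -> E f -> disjoint_edges e f ->
  interlace (val e.1, val e.2) (val f.1, val f.2) (+) (x e && x f)
   (+) (kk e.1 f (+) kk e.2 f) (+) (kk f.1 e (+) kk f.2 e) = false.
Proof.
pose s0 := [seq W v | v <- enum 'I_N].
pose s := [seq i <- enum I | i \notin s0].
have us0 : uniq s0 by rewrite map_inj_uniq ?enum_uniq // => u v [].
have us : uniq (s ++ s0).
  rewrite cat_uniq us0 andbT filter_uniq ?enum_uniq //=.
  by apply/hasPn => i i0; rewrite mem_filter i0.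
have in_s i : i \in s ++ s0.
  by rewrite mem_cat mem_filter mem_enum andbT orNb.
have g0 : generic target s0.
  move=> i j l /mapP[a _ ->] /mapP[b _ ->] /mapP[c _ ->] u.
  apply: det3_moment_neq0; move: u.
  rewrite -[[:: W a; W b; W c]]/(map W [:: a; b; c]) map_inj_uniq => [u|u v []//].
  by rewrite -[X in uniq X]/(map val [:: a; b; c]) (map_inj_uniq val_inj).
have [|P [PW Pd Pg]] := generic_extend d0 g0 _ us; first by rewrite size_map size_enum_ord.
have gp i j l : uniq [:: i; j; l] -> det3 (P i) (P j) (P l) != 0 by apply: Pg.
have wfd e : E e -> well_drawn k O (draw e).
  move=> Ee; split; last exact: xk.
  - have ne : e.1 != e.2 by apply/eqP => h; have := Elt Ee; rewrite h ltnn.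
    have u3 : uniq [seq i.2 | i <- mid (draw e)].
      by rewrite -map_comp map_inj_uniq ?enum_uniq // => a b [].
    have n3 (y : 'I_N + 'I_N) : inl (inl y) \notin [seq i.2 | i <- mid (draw e)].
      by apply/mapP => -[z /mapP[w _ ->]].
    rewrite /support cons_uniq [uniq (_ :: _)]cons_uniq [uniq (_ :: _)]cons_uniq cons_uniq u3 !in_cons !negb_or !n3 /=.
    by rewrite !andbT; apply/andP; split; apply: contra_neq ne => -[].
  - rewrite /support !inE /=; apply/mapP => -[z /mapP[w _ ->]]; by [].
have dis e f : disjoint_edges e f -> forall i, i \in support (draw e) -> i \notin support (draw f).
  move=> def; have own g i : i \in support (draw g) -> match i with
    | inl (inl (inl v)) | inl (inl (inr v)) => (v == g.1) || (v == g.2)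
    | inl (inr (g', _)) => g' == g | inr _ => false end.
    rewrite /support /= !inE => /or4P[/eqP->|/eqP->|/eqP->|/orP[/eqP->|/mapP[_ /mapP[w _ ->] ->]]] /=;
      by rewrite eqxx ?orbT.
  move: def; rewrite /disjoint_edges /= !inE !negb_or => /and3P[/and3P[_ n1 n2] /andP[n3 n4] _].
  move=> i /own h1; apply/negP => /own; move: h1.
  case: i => [[[v|v]|[g j]]|[]] //.
  - by move=> /orP[] /eqP->; rewrite ?(negbTE n1) ?(negbTE n2) ?(negbTE n3) ?(negbTE n4).
  - by move=> /orP[] /eqP->; rewrite ?(negbTE n1) ?(negbTE n2) ?(negbTE n3) ?(negbTE n4).
  - by move=> /eqP-> /eqP ef; rewrite ef eqxx in n1.
have line_close e t : E e -> t \in line (draw e) -> exists i, [/\ (i <= n)%N,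
    close3 d (signed_point P t.1) (sample e i) & close3 d (signed_point P t.2) (sample e i.+1)].
  move=> Ee /(nthP t)[i]; rewrite size_pairmap size_rcons size_map size_enum_ord ltnS => hi.
  have near0 : close3 d (signed_point P (false, Phi e.1)) (sample e 0) by rewrite sample0 //; apply: Pd.
  have nearS j : (j <= n)%N ->
     close3 d (signed_point P (nth (false, Phi e.1) (rcons (mid (draw e)) (x e, Phi e.2)) j)) (sample e j.+1).
    rewrite nth_rcons size_map size_enum_ord leq_eqVlt => /orP[/eqP->|jn].
      rewrite ltnn eqxx samplen // /signed_point /=; have := Pd (Phi e.2); case: (x e) => // h l.
      by have := h l; rewrite !mxE -opprD normrN.
    rewrite jn (nth_map (Ordinal jn)) ?size_enum_ord // /signed_point /=.
    have := Pd (Sample e (nth (Ordinal jn) (enum 'I_n) j)).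
    by rewrite /= nth_enum_ord.
  have sz : size (rcons (mid (draw e)) (x e, Phi e.2)) = n.+1.
    by rewrite size_rcons size_map size_enum_ord.
  rewrite (nth_pairmap (false, Phi e.1)) ?sz // => <-.
  exists i; split => //=; last exact: nearS.
  by case: i hi => [|i] hi //=; apply: nearS; apply: ltnW.
have lines0 e f : E e -> E f -> disjoint_edges e f -> chain_cross P k (line (draw e)) (line (draw f)) = false.
  move=> Ee Ef def; have [u1 _ _] := wfd _ Ee; have [u2 _ _] := wfd _ Ef.
  rewrite /chain_cross big1_seq //= => t1 t1e; rewrite big1_seq //= => t2 t2f.
  have [i [hi c1 c2]] := line_close _ _ Ee t1e; have [j [hj c3 c4]] := line_close _ _ Ef t2f.
  have [s1 s2 s3] := line_support u1 t1e; have [s4 s5 s6] := line_support u2 t2f.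
  have ds := dis _ _ def.
  have dd a b : a \in support (draw e) -> b \in support (draw f) -> a != b.
    by move=> /ds ha; apply: contraTneq => <-.
  rewrite /seg_cross (stable Ee Ef def hi hj) //; apply: (generic_signed gp);
    by rewrite /= !inE !negb_or ?s3 ?s6 !dd.
pose tau v := tail (W v) (Phi v).
pose half (v a : 'I_N) := (v < a)%N && seg_cross P k (tau v) (tau a).
pose kk v f := cone_parity P k O (loopc (draw f)) (false, Phi v) (+) seg_cross P k (tau v) (chord (draw f))
   (+) (half v f.1 (+) half v f.2).
exists kk => e f Ee Ef def.
have := pair_identity gp (wfd _ Ee) (wfd _ Ef) (dis _ _ def).
rewrite lines0 // /= => /esym.
have -> : seg_cross P k (chord (draw e)) (chord (draw f)) = interlace (val e.1, val e.2) (val f.1, val f.2).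
  have uu : uniq [:: val e.1; val e.2; val f.1; val f.2].
    by rewrite -[X in uniq X]/(map val [:: e.1; e.2; f.1; f.2]) (map_inj_uniq val_inj).
  rewrite /seg_cross /signed_point /= !PW ?map_f ?mem_enum //; exact: cross_moment (Elt Ee) (Elt Ef) uu.
have tE : chain_cross P k (tails (draw e)) (tails (draw f)) = (half e.1 f.1 (+) half e.1 f.2) (+) (half e.2 f.1 (+) half e.2 f.2)
    (+) ((half f.1 e.1 (+) half f.1 e.2) (+) (half f.2 e.1 (+) half f.2 e.2)).
  have T v a : v != a -> half v a (+) half a v = seg_cross P k (tau v) (tau a).
    rewrite /half -val_eqE [seg_cross P k (tau a) _]seg_crossC => va.
    by case: (ltngtP v a) va => //= _; rewrite ?addbF.
  move: def; rewrite /disjoint_edges /= !inE !negb_or => /and3P[/and3P[_ n1 n2] /andP[n3 n4] _].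
  rewrite /chain_cross !big_cons !big_nil !addbF /= -/(tau _) -!T //.
  rewrite -!addbA; do 8 (case: (half _ _) => //=).
have kkE v v' g : kk v g (+) kk v' g =
    (cone_parity P k O (loopc (draw g)) (false, Phi v) (+) cone_parity P k O (loopc (draw g)) (false, Phi v'))
    (+) (seg_cross P k (tau v) (chord (draw g)) (+) seg_cross P k (tau v') (chord (draw g)))
    (+) ((half v g.1 (+) half v g.2) (+) (half v' g.1 (+) half v' g.2)).
  by rewrite /kk addbACA; congr addb; rewrite addbACA.
rewrite tE /chain_cross !big_cons !big_nil !addbF !kkE /=.
move: (half _ _ (+) half _ _ (+) _) (half _ _ (+) half _ _ (+) _) => h1 h2.
move: (seg_cross _ _ _ _ (+) _) (seg_cross _ _ _ _ (+) _) (cone_parity _ _ _ _ _ (+) _) (cone_parity _ _ _ _ _ (+) _).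
by move: (interlace _ _) (x e && x f) h1 h2; do 8 case.
Qed.
End Obstruction.

(** * Uniformity on compact intervals *)
Section Clamp.
Local Open Scope classical_set_scope.
Local Open Scope quotient_scope.
Variable K : realType.

(** Turns functions that are continuous on the unit interval into continuous functions on the
line. *)
Definition clamp (t : K) : K := Num.max 0 (Num.min t 1).

Lemma in01 (t : K) : (t \in `[0, 1]) = (0 <= t <= 1).
Proof. by rewrite mem_setE in_itv. Qed.

Lemma clamp_itv t : clamp t \in `[0, 1].
Proof.
by rewrite in01 /= /clamp le_max lexx /= ge_max ler01 ge_min lexx orbT.
Qed.

Lemma clamp_id t : t \in `[0, 1] -> clamp t = t.
Proof.
by rewrite in01 => /andP[t0 t1]; rewrite /clamp (min_idPl t1) (max_idPr t0).
Qed.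

Lemma clamp_continuous : continuous clamp.
Proof.
apply: (@max_fun_continuous _ K K (cst 0) (fun t => Num.min t 1)); first exact: cst_continuous.
by apply: (@min_fun_continuous _ K K id (cst 1)); [move=> t; exact: cvg_id | exact: cst_continuous].
Qed.

Lemma clamp_comp_continuous (Y : topologicalType) (f : K -> Y) :
  {within `[0, 1], continuous f} -> continuous (f \o clamp).
Proof.
move=> /subspace_continuousP cf t.
have mem u : `[0, 1]%classic (clamp u) by apply/set_mem/clamp_itv.
apply: cvg_comp (cf _ (mem t)).
move=> U; rewrite /within /= => hU.
have h : \forall u \near t, `[0, 1]%classic (clamp u) -> U (clamp u) := clamp_continuous hU.
change (\forall u \near t, U (clamp u)).
by apply: filterS h => u; apply; exact: mem.
Qed.

(** The form of uniform continuity which holds at once for all sufficiently fine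
subdivisions, so that one subdivision can be chosen for finitely many functions. *)
Lemma unif_continuous_itv (f : K -> K) (e : K) : continuous f -> 0 < e ->
  exists m : nat, forall n, (m <= n)%N -> forall x z, x \in `[0, 1] -> `|x - z| <= n.+1%:R^-1 -> `|f x - f z| < e.
Proof.
move=> cf e0.
have /compact_near_coveringP/(_ nat \oo (fun n x => forall z, `|x - z| <= n.+1%:R^-1 -> `|f x - f z| < e)) := @segment_compact K 0 1.
case.
  move=> x _.
  have [d /= d0 hd] : \forall y \near x, `|f x - f y| < e / 2.
    by have /cvgrPdist_lt/(_ (e / 2)) := cf x; apply; rewrite divr_gt0.
  have d2 : 0 < d / 2 by rewrite divr_gt0.
  exists (ball x (d / 2), [set n | n.+1%:R^-1 < d / 2]).
    split; first exact: nbhsx_ballx.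
    exact: (near_infty_natSinv_lt (PosNum d2)).
  move=> [y n] /= [xy nd] z yz.
  have h1 : `|f x - f y| < e / 2 by apply: hd; apply: lt_trans xy _; rewrite ltr_pdivrMr // ltr_pMr // ltr1n.
  have h2 : `|f x - f z| < e / 2.
    apply: hd => /=; rewrite -(subrKA y) (le_lt_trans (ler_normD _ _)) //.
    by rewrite [ltRHS](splitr d) ltrD // (le_lt_trans yz).
  rewrite -(subrKA (f x)) (le_lt_trans (ler_normD _ _)) //.
  by rewrite [ltRHS](splitr e) ltrD // distrC.
move=> m _ hm; exists m => n mn x z x01; apply: hm mn _ _ z; exact/set_mem.
Qed.

Lemma separated_square (g : K * K -> K) : continuous g ->
  (forall t s, t \in `[0, 1] -> s \in `[0, 1] -> g (t, s) < 1) ->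
  exists2 h : K, 0 < h & forall t s, t \in `[0, 1] -> s \in `[0, 1] -> g (t, s) <= 1 - h.
Proof.
move=> cg g1.
have [||[t s] /set_mem[/= t01 s01] gm] := @compact_EVT_max _ _ g (`[0, 1] `*` `[0, 1]) _ (compact_setX (@segment_compact K 0 1) (@segment_compact K 0 1)).
- by exists (0, 0); split => /=; rewrite in_itv /= lexx ler01.
- exact: continuous_subspaceT.
exists (1 - g (t, s)); first by rewrite subr_gt0; apply: g1; exact/mem_set.
by move=> t' s' /set_mem h1 /set_mem h2; rewrite subKr; apply: gm; apply: mem_set.
Qed.
End Clamp.

Lemma fin_common_pos (K : realFieldType) (I : finType) (P : I -> K -> Prop) :
  (forall i h h', 0 < h' -> h' <= h -> P i h -> P i h') ->
  (forall i, exists2 h, 0 < h & P i h) -> exists2 h, 0 < h & forall i, P i h.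
Proof.
move=> mono ex.
suff [h h0 hP] : exists2 h, 0 < h & forall i, i \in enum I -> P i h.
  by exists h => // i; apply: hP; rewrite mem_enum.
elim: (enum I) => [|i s [h h0 IH]]; first by exists 1.
have [h' h'0 P'] := ex i.
have m0 : 0 < Num.min h h' by rewrite lt_min h0 h'0.
exists (Num.min h h') => // j; rewrite inE => /orP[/eqP->|js].
  by apply: mono P' => //; rewrite ge_min lexx orbT.
by apply: mono (IH _ js) => //; rewrite ge_min lexx.
Qed.

Lemma fin_common_nat (I : finType) (P : I -> nat -> Prop) :
  (forall i, exists m, forall n, (m <= n)%N -> P i n) -> exists n, forall i, P i n.
Proof.
move=> ex; suff [m mP] : exists m, forall i, i \in enum I -> forall n, (m <= n)%N -> P i n.
  by exists m => i; apply: mP; rewrite ?mem_enum.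
elim: (enum I) => [|i s [m IH]]; first by exists 0%N.
have [m' P'] := ex i.
exists (maxn m m') => j; rewrite inE => /orP[/eqP->|js] n; rewrite geq_max => /andP[h1 h2].
  exact: P'.
exact: IH.
Qed.

(** * Lifting points of the surface to the sphere *)
Section Lifts.
Local Open Scope classical_set_scope.
Local Open Scope quotient_scope.
Variable K : realType.
Implicit Types p q : 'rV[K]_3.

Lemma dotE p q : dot p q = dot3 p q.
Proof.
rewrite /dot /dot3 !big_ord_recl big_ord0 addr0 addrA.
by congr (_ + _ + _); congr (p 0 _ * q 0 _); apply: val_inj.
Qed.

Lemma row3P p q : p 0 0 = q 0 0 -> p 0 1 = q 0 1 -> p 0 2 = q 0 2 -> p = q.
Proof.
move=> h0 h1 h2; apply/rowP => -[[|[|[|//]]] hj].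
- by rewrite (_ : Ordinal hj = 0) //; apply: val_inj.
- by rewrite (_ : Ordinal hj = 1) //; apply: val_inj.
- by rewrite (_ : Ordinal hj = 2) //; apply: val_inj.
Qed.

Variable k : bool.
Notation X := (crosscap_sphere K k).

(** The representative chosen by the quotient; nothing is known about its continuity. *)
Definition lift_pt (x : X) : 'rV[K]_3 := val (repr (x : {eq_quot (@crosscap_equiv K k)})).

Lemma lift_unit x : dot3 (lift_pt x) (lift_pt x) = 1.
Proof. by rewrite -dotE /lift_pt; case: (repr _) => ? /= /set_mem[]. Qed.

(** Functions of a unit vector that descend to the surface and separate its points: the
coordinates for the sphere, their pairwise products for the projective plane. *)
Definition feat p (ij : 'I_3 * 'I_3) : K :=
  if k then p 0 ij.1 * p 0 ij.2 else p 0 ij.1 *+ (ij.2 == 0).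

(** The inner product of feature vectors; continuity arguments for the discontinuous lift go
through it, since it is continuous on the surface. *)
Definition gram p q := if k then dot3 p q ^+ 2 else dot3 p q.

Lemma gramE p q : gram p q = \sum_(ij : 'I_3 * 'I_3) feat p ij * feat q ij.
Proof.
rewrite -(pair_bigA _ (fun i j => feat p (i, j) * feat q (i, j))) /=.
have o0 : (ord0 : 'I_3) = 0 by apply: val_inj.
have o1 : (lift ord0 ord0 : 'I_3) = 1 by apply: val_inj.
have o2 : (lift ord0 (lift ord0 ord0) : 'I_3) = 2 by apply: val_inj.
rewrite !big_ord_recl !big_ord0 !o0 !o1 !o2 /gram /feat /dot3 /=.
by case: k; rewrite /= ?mulr0n ?mulr1n; ring.
Qed.

Lemma crosscap_feat (a b : holed_sphere k) : crosscap_eq a b -> feat (val a) =1 feat (val b).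
Proof.
move=> + ij; rewrite /feat; case=> [-> //|[i _ ->]].
case: (k) i a b => [] i a b; last by case: i.
have -> : cap_height true = 0 :> K by rewrite /cap_height /= cos_pihalf.
by rewrite mul0rn scale0r sub0r !mxE mulrNN.
Qed.

Lemma feat_continuous ij : continuous (fun x : X => feat (lift_pt x) ij).
Proof.
pose g (a : holed_sphere k) := feat (val a) ij.
have cg : continuous g.
  have cv i : continuous (fun a : holed_sphere k => val a 0 i : K).
    move=> a; apply: (@continuous_comp _ _ _ (val : holed_sphere k -> 'rV[K]_3) (fun p : 'rV[K]_3 => p 0 i)).
      exact: initial_continuous.
    exact: coord_continuous.
  have [hk|hk] : k \/ ~~ k by apply/orP; rewrite orbN.
    have -> : g = (fun a : holed_sphere k => val a 0 ij.1 * val a 0 ij.2).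
      by apply/funext => a; rewrite /g /feat ifT.
    by move=> a; exact: (continuousM (cv ij.1 a) (cv ij.2 a)).
  have -> : g = (fun a : holed_sphere k => val a 0 ij.1 *+ (ij.2 == 0)).
    by apply/funext => a; rewrite /g /feat ifF //; apply/negbTE.
  by case: (ij.2 == 0); [exact: cv | exact: cst_continuous].
apply: (@repr_comp_continuous _ _ _ g) => // a b /eqP/eqmodP/asboolP h.
by apply/eqP; apply: crosscap_feat.
Qed.

(** The case of equality in the Cauchy-Schwarz inequality; that the two unit vectors are
opposite forces both of them, being in the closed hemisphere, onto its boundary
circle. *)
Lemma gram_eq1 (x y : X) : gram (lift_pt x) (lift_pt y) = 1 -> x = y.
Proof.
move=> g1.
suff h : crosscap_eq (repr (x : {eq_quot (@crosscap_equiv K k)})) (repr (y : {eq_quot (@crosscap_equiv K k)})).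
  by rewrite -[x]reprK -[y]reprK; apply/eqmodP/asboolP.
have ux := lift_unit x; have uy := lift_unit y.
have eqd : dot3 (lift_pt x) (lift_pt y) = 1 -> lift_pt x = lift_pt y.
  move: (lift_pt x) (lift_pt y) ux uy; rewrite /dot3 => p q hp hq hpq.
  have : (p 0 0 - q 0 0) ^+ 2 + (p 0 1 - q 0 1) ^+ 2 + (p 0 2 - q 0 2) ^+ 2 = 0.
    by transitivity ((1 + 1 - 2 * 1) : K); [rewrite -{1}hp -{1}hq -{1}hpq; ring | ring].
  move/eqP; rewrite paddr_eq0 ?addr_ge0 ?sqr_ge0 // paddr_eq0 ?sqr_ge0 // !sqrf_eq0 !subr_eq0.
  by move=> /andP[/andP[/eqP ? /eqP ?] /eqP ?]; apply: row3P.
have [hk|hk] : k \/ ~~ k by apply/orP; rewrite orbN.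
  2: by move: g1; rewrite /gram ifF; [move=> /eqd/val_inj h; left | apply/negbTE].
move: g1; rewrite /gram ifT // => /eqP; rewrite sqrf_eq1 => /orP[/eqP/eqd/val_inj h|/eqP d1]; first by left.
have eqN : lift_pt y = - lift_pt x.
  move: (lift_pt x) (lift_pt y) ux uy d1; rewrite /dot3 => p q hp hq hpq.
  have : (p 0 0 + q 0 0) ^+ 2 + (p 0 1 + q 0 1) ^+ 2 + (p 0 2 + q 0 2) ^+ 2 = 0.
    by transitivity ((1 + 1 + 2 * - 1) : K); [rewrite -{1}hp -{1}hq -{1}hpq; ring | ring].
  move/eqP; rewrite paddr_eq0 ?addr_ge0 ?sqr_ge0 // paddr_eq0 ?sqr_ge0 // !sqrf_eq0 !addr_eq0.
  by move=> /andP[/andP[/eqP h0 /eqP h1] /eqP h2]; apply: row3P; rewrite mxE ?h0 ?h1 ?h2 opprK.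
have k0 : (0 < k)%N by rewrite hk.
right; exists (Ordinal k0).
  have h0 : cap_height k = 0 :> K by rewrite /cap_height hk /= cos_pihalf.
  have lx := set_mem (valP (repr (x : {eq_quot (@crosscap_equiv K k)}))).
  have ly := set_mem (valP (repr (y : {eq_quot (@crosscap_equiv K k)}))).
  have [_ /(_ (Ordinal k0))] := lx; have [_ /(_ (Ordinal k0))] := ly.
  rewrite h0 -/(lift_pt x) -/(lift_pt y) eqN -[- lift_pt x]sub0r dotBl.
  have -> : dot 0 (cap_center k (Ordinal k0)) = 0 :> K by rewrite /dot big1 // => j _; rewrite mxE mul0r.
  rewrite sub0r oppr_le0 => h1 h2; apply/eqP; rewrite eq_le h1 h2 //.
rewrite -/(lift_pt x) -/(lift_pt y) eqN.
have -> : cap_height k = 0 :> K by rewrite /cap_height hk /= cos_pihalf.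
by rewrite mul0rn scale0r sub0r.
Qed.

End Lifts.

(** * From topological embeddings to polygonal drawings *)
Section Estimates.
Local Open Scope classical_set_scope.
Variable K : realFieldType.
Implicit Types P Q p q : 'rV[K]_3.

Lemma unit_coord P j : dot3 P P = 1 -> `|P 0 j| <= 1.
Proof.
move=> h.
have sq x y z : x * x + y * y + z * z = 1 -> `|x| <= 1 :> K.
  move=> e; rewrite -(@ler_pXn2r _ 2) ?nnegrE // expr1n real_normK ?num_real //.
  by rewrite -e expr2 -addrA lerDl addr_ge0 // -expr2 sqr_ge0.
case: j => -[|[|[|//]]] hj.
- by rewrite (_ : Ordinal hj = 0); [apply: sq h | apply: val_inj].
- rewrite (_ : Ordinal hj = 1); last exact: val_inj.
  by apply: (sq _ (P 0 0) (P 0 2)); rewrite -h /dot3; ring.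
- rewrite (_ : Ordinal hj = 2); last exact: val_inj.
  by apply: (sq _ (P 0 0) (P 0 1)); rewrite -h /dot3; ring.
Qed.

Lemma dot3_small P (a : 'rV[K]_3) d : dot3 P P = 1 -> (forall j, `|a 0 j| <= d) -> `|dot3 P a| <= 3 * d.
Proof.
move=> h ha; have c := fun j => unit_coord j h.
have m x y : `|x| <= 1 -> `|y| <= d -> `|x * y| <= d.
  by move=> hx hy; rewrite normrM -[leRHS]mul1r ler_pM.
rewrite /dot3 (le_trans (ler_normD _ _)) // (_ : 3 * d = d + d + d); last by ring.
rewrite lerD ?m // (le_trans (ler_normD _ _)) // lerD ?m //.
Qed.

Lemma dot3_near P p d : dot3 P P = 1 -> close3 d p P -> forall Q, dot3 Q Q = 1 -> `|dot3 Q p - dot3 Q P| <= 3 * d.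
Proof.
move=> _ hp Q hQ.
have -> : dot3 Q p - dot3 Q P = dot3 Q (p - P) by rewrite /dot3 !mxE; ring.
by apply: dot3_small => // j; rewrite !mxE ltW // hp.
Qed.

Lemma dot3_le1 P Q : dot3 P P = 1 -> dot3 Q Q = 1 -> `|dot3 P Q| <= 1.
Proof.
move=> hP hQ; rewrite ler_norml; apply/andP; split; rewrite -subr_ge0.
  have -> : dot3 P Q - -1 = (\sum_(j <- [:: 0; 1; 2]) (P 0 j + Q 0 j) ^+ 2) / 2.
    rewrite !big_cons big_nil.
    transitivity ((dot3 P P + dot3 Q Q + 2 * dot3 P Q) / 2); first by rewrite hP hQ; field.
    by rewrite /dot3; field.
  by rewrite divr_ge0 // sumr_ge0 // => j _; rewrite sqr_ge0.
have -> : 1 - dot3 P Q = (\sum_(j <- [:: 0; 1; 2]) (P 0 j - Q 0 j) ^+ 2) / 2.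
  rewrite !big_cons big_nil.
  transitivity ((dot3 P P + dot3 Q Q - 2 * dot3 P Q) / 2); first by rewrite hP hQ; field.
  by rewrite /dot3; field.
by rewrite divr_ge0 // sumr_ge0 // => j _; rewrite sqr_ge0.
Qed.

Lemma close3_near P P' d : dot3 P P = 1 -> dot3 P' P' = 1 -> 0 < d ->
  1 - d ^+ 2 / 2 < dot3 P P' -> close3 d P' P.
Proof.
move=> hP hP' d0 h.
have sq (x y z : K) : x ^+ 2 + y ^+ 2 + z ^+ 2 < d ^+ 2 -> `|x| < d.
  move=> e; rewrite -(@ltr_pXn2r _ 2) ?nnegrE // ?(ltW d0) // real_normK ?num_real //.
  by apply: le_lt_trans e; rewrite -addrA lerDl addr_ge0 // sqr_ge0.
have S : (P' 0 0 - P 0 0) ^+ 2 + (P' 0 1 - P 0 1) ^+ 2 + (P' 0 2 - P 0 2) ^+ 2 < d ^+ 2.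
  have -> : (P' 0 0 - P 0 0) ^+ 2 + (P' 0 1 - P 0 1) ^+ 2 + (P' 0 2 - P 0 2) ^+ 2 = 2 - 2 * dot3 P P'.
    transitivity (dot3 P P + dot3 P' P' - 2 * dot3 P P'); last by rewrite hP hP'; ring.
    by rewrite /dot3; ring.
  lra.
move=> [[|[|[|//]]] hj].
- by rewrite (_ : Ordinal hj = 0); [apply: sq S | apply: val_inj].
- rewrite (_ : Ordinal hj = 1); last exact: val_inj.
  by apply: (sq _ (P' 0 0 - P 0 0) (P' 0 2 - P 0 2)); rewrite addrAC addrC addrA addrAC [X in X + _ < _]addrC addrAC; apply: le_lt_trans S; rewrite le_eqVlt; apply/orP; left; apply/eqP; ring.
- rewrite (_ : Ordinal hj = 2); last exact: val_inj.
  by apply: (sq _ (P' 0 0 - P 0 0) (P' 0 1 - P 0 1)); apply: le_lt_trans S; rewrite le_eqVlt; apply/orP; left; apply/eqP; ring.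
Qed.

Lemma close3_trans d d' p q (r : 'rV[K]_3) : close3 d p q -> close3 d' q r -> close3 (d + d') p r.
Proof.
by move=> h h' j; rewrite -(subrKA (q 0 j)) (le_lt_trans (ler_normD _ _)) // ltrD.
Qed.

Lemma close3W d d' p q : d <= d' -> close3 d p q -> close3 d' p q.
Proof. by move=> dd h j; apply: lt_le_trans (h j) dd. Qed.

(** For the vector product [w] of [P] and [Q], [det3 w P Q = 1 - dot3 P Q ^+ 2 >= h].  The
bound on the distances keeps [det3 w] positive nearby, and [no_cross_projective]
applies. *)
Lemma stable_projective P Q p p' q q' h : dot3 P P = 1 -> dot3 Q Q = 1 -> 0 < h -> h <= 1 ->
  dot3 P Q ^+ 2 <= 1 - h ->
  let d := h / 100 in
  close3 d p P -> close3 d p' P -> close3 d q Q -> close3 d q' Q ->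
  det3 p q q' != 0 -> det3 p' q q' != 0 -> det3 p p' q != 0 -> det3 p p' q' != 0 ->
  cross true p p' q q' = false.
Proof.
move=> hP hQ h0 h1 hh d c1 c2 c3 c4 d1 d2 d3 d4.
pose w : 'rV[K]_3 := \row_j [:: P 0 1 * Q 0 2 - P 0 2 * Q 0 1; P 0 2 * Q 0 0 - P 0 0 * Q 0 2; P 0 0 * Q 0 1 - P 0 1 * Q 0 0]`_j.
have W (r s : 'rV[K]_3) : det3 w r s = dot3 P r * dot3 Q s - dot3 P s * dot3 Q r.
  by rewrite /det3 /w !mxE /= /dot3; ring.
have pos r s : close3 d r P -> close3 d s Q -> 0 < det3 w r s.
  move=> cr cs; rewrite W.
  have := dot3_near hP cr hP; have := dot3_near hQ cs hQ.
  have := dot3_near hP cr hQ; have := dot3_near hQ cs hP.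
  have := dot3_le1 hP hQ; have QP : dot3 Q P = dot3 P Q by rewrite /dot3; ring.
  rewrite hP hQ QP !ler_norml.
  move: (dot3 P r) (dot3 Q s) (dot3 P s) (dot3 Q r) (dot3 P Q) hh => a b c e g hh.
  rewrite /d => /andP[g1 g2] /andP[x1 x2] /andP[x3 x4] /andP[x5 x6] /andP[x7 x8].
  have y1 : 1 - 6 * (h / 100) <= a * b by nra.
  have y2 : c * e <= g ^+ 2 + 7 * (h / 100) by nra.
  lra.
by apply: (@no_cross_projective _ w) => //; exact: pos.
Qed.

(** The vector [P - Q] separates the neighbourhoods, and [no_cross_sphere] applies. *)
Lemma stable_sphere P Q p p' q q' h : dot3 P P = 1 -> dot3 Q Q = 1 -> 0 < h -> h <= 1 ->
  dot3 P Q <= 1 - h ->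
  let d := h / 100 in
  close3 d p P -> close3 d p' P -> close3 d q Q -> close3 d q' Q ->
  det3 p q q' != 0 -> det3 p' q q' != 0 -> det3 p p' q != 0 -> det3 p p' q' != 0 ->
  cross false p p' q q' = false.
Proof.
move=> hP hQ h0 h1 hh d c1 c2 c3 c4 d1 d2 d3 d4.
have QP : dot3 Q P = dot3 P Q by rewrite /dot3; ring.
have U (r : 'rV[K]_3) : dot3 (P - Q) r = dot3 P r - dot3 Q r by rewrite /dot3 !mxE; ring.
have pos r : close3 d r P -> 0 < dot3 (P - Q) r.
  move=> cr; rewrite U; have := dot3_near hP cr hP; have := dot3_near hP cr hQ.
  rewrite hP QP !ler_norml /d => /andP[x1 x2] /andP[x3 x4]; lra.
have ngt r : close3 d r Q -> dot3 (P - Q) r < 0.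
  move=> cr; rewrite U; have := dot3_near hQ cr hP; have := dot3_near hQ cr hQ.
  rewrite hQ !ler_norml /d => /andP[x1 x2] /andP[x3 x4]; lra.
by apply: (@no_cross_sphere _ (P - Q)) => //; [exact: pos | exact: pos | exact: ngt | exact: ngt].
Qed.
End Estimates.

Section EmbeddingObstruction.
Local Open Scope classical_set_scope.
Variables (K : realType) (k : bool) (N : nat) (e : rel 'I_N).
Hypothesis N2 : (2 < N)%N.
Notation X := (crosscap_sphere K k).
Notation edge := ('I_N * 'I_N)%type.

(** Each edge is used once, directed from its smaller to its larger end. *)
Definition up_edge : pred edge := fun uv => (uv.1 < uv.2)%N && e uv.1 uv.2.

Definition ends (uv : edge) : {set 'I_N} := [set uv.1; uv.2]%SET.

Lemma up_edge_set uv : up_edge uv -> (ends uv) \in edge_set e.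
Proof. by move=> /andP[_ h]; apply/imsetP; exists uv => //; rewrite inE. Qed.

Variables (phi : 'I_N -> X) (arc : {set 'I_N} -> K -> X).
Hypothesis phi_inj : injective phi.
Hypothesis arcP : forall E, E \in edge_set e ->
          [/\ {within `[0, 1], continuous (arc E)},
              {in `[0, 1] &, injective (arc E)} &
              [set arc E 0; arc E 1] = phi @` [set` E]].
Hypothesis arc_disj : forall E F t s, E \in edge_set e -> F \in edge_set e -> E != F ->
          t \in `[0, 1] -> s \in `[0, 1] -> arc E t = arc F s ->
          exists2 v, v \in E :&: F & arc E t = phi v.

(** An arc may run against the direction of its edge and then has to be reversed. *)
Definition oriented (uv : edge) (t : K) : X :=
  if arc (ends uv) 0 == phi uv.1 then arc (ends uv) (clamp t)
  else arc (ends uv) (clamp (1 - t)).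

Lemma oriented_ends uv : up_edge uv -> oriented uv 0 = phi uv.1 /\ oriented uv 1 = phi uv.2.
Proof.
move=> uvE; have [_ inj endsE] := arcP (up_edge_set uvE).
have n12 : uv.1 != uv.2.
  by apply/eqP => h; move: uvE; rewrite /up_edge h ltnn.
have c0 : clamp (0 : K) = 0 by apply: clamp_id; rewrite in01 lexx ler01.
have c1 : clamp (1 : K) = 1 by apply: clamp_id; rewrite in01 lexx ler01.
have a01 : arc (ends uv) 0 <> arc (ends uv) 1.
  by move=> /inj; rewrite !in01 !lexx !ler01 => /(_ isT isT)/eqP; rewrite eq_sym oner_eq0.
have im v : (v == uv.1) || (v == uv.2) -> phi v = arc (ends uv) 0 \/ phi v = arc (ends uv) 1.
  move=> hv; have : (phi @` [set` (ends uv)]) (phi v).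
    by exists v => //=; rewrite /ends !inE.
  by rewrite -endsE => -[->|->]; [left|right].
rewrite /oriented; case: eqP => h0.
  rewrite c0 c1; split => //; have := im uv.2; rewrite eqxx orbT => /(_ isT) -[h|//].
  by move: n12; rewrite -(inj_eq phi_inj) -h0 h eqxx.
rewrite subr0 subrr c0 c1.
have h1 : arc (ends uv) 1 = phi uv.1.
  by have := im uv.1; rewrite eqxx => /(_ isT) -[h|//]; rewrite h in h0.
split => //; have := im uv.2; rewrite eqxx orbT => /(_ isT) -[//|h].
by move: n12; rewrite -(inj_eq phi_inj) -h1 h eqxx.
Qed.

Lemma oriented_continuous uv : up_edge uv -> continuous (oriented uv).
Proof.
move=> uvE; have [c _ _] := arcP (up_edge_set uvE).
have cc := clamp_comp_continuous c.
rewrite /oriented; case: (arc (ends uv) 0 == phi uv.1); first exact: cc.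
have cm : continuous (fun t : K => 1 - t).
  by move=> t; apply: continuousB; [exact: cst_continuous | exact: cvg_id].
move=> t; exact: (@continuous_comp K K X (fun t : K => 1 - t) (arc (ends uv) \o @clamp K) t (cm t) (cc _)).
Qed.

Lemma oriented_disjoint uv ab t s : up_edge uv -> up_edge ab ->
  disjoint_edges uv ab -> oriented uv t <> oriented ab s.
Proof.
move=> uvE abE dis.
have [t' t'01 ->] : exists2 t', t' \in `[0, 1] & oriented uv t = arc (ends uv) t'.
  by rewrite /oriented; case: ifP => _; eexists; try reflexivity; exact: clamp_itv.
have [s' s'01 ->] : exists2 s', s' \in `[0, 1] & oriented ab s = arc (ends ab) s'.
  by rewrite /oriented; case: ifP => _; eexists; try reflexivity; exact: clamp_itv.
move: dis; rewrite /disjoint_edges /= !inE !negb_or => /and3P[/and3P[_ n1 n2] /andP[n3 n4] _].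
have nE : (ends uv) != (ends ab).
  apply/eqP => /setP/(_ uv.1); rewrite /ends !inE eqxx (negbTE n1) (negbTE n2) //.
move=> /(arc_disj (up_edge_set uvE) (up_edge_set abE) nE t'01 s'01)[v].
by rewrite /ends !inE => /andP[/orP[]/eqP-> /orP[]/eqP h]; move: n1 n2 n3 n4; rewrite h ?eqxx.
Qed.

Definition lifted uv t := lift_pt (oriented uv t).

Lemma gram_continuous uv ab : up_edge uv -> up_edge ab ->
  continuous (fun ts : K * K => gram k (lifted uv ts.1) (lifted ab ts.2)).
Proof.
move=> uvE abE.
have -> : (fun ts : K * K => gram k (lifted uv ts.1) (lifted ab ts.2)) =
  (fun ts => \sum_(ij : 'I_3 * 'I_3) feat k (lifted uv ts.1) ij * feat k (lifted ab ts.2) ij).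
  by apply/funext => ts; rewrite gramE.
have cf ed ij : up_edge ed -> continuous (fun t => feat k (lifted ed t) ij).
  move=> edE t; apply: (@continuous_comp _ _ _ (oriented ed) (fun x => feat k (lift_pt x) ij)).
    exact: oriented_continuous.
  exact: feat_continuous.
apply: continuous_big => [x0|ij _]; first exact: add_continuous.
move=> ts; apply: (@continuousM _ _ (fun ts : K * K => feat k (lifted uv ts.1) ij)
  (fun ts : K * K => feat k (lifted ab ts.2) ij)).
  exact: (@continuous_comp _ _ _ fst (fun t => feat k (lifted uv t) ij) ts cvg_fst (cf _ _ uvE _)).
exact: (@continuous_comp _ _ _ snd (fun t => feat k (lifted ab t) ij) ts cvg_snd (cf _ _ abE _)).
Qed.

Lemma lifted_unit uv t : dot3 (lifted uv t) (lifted uv t) = 1.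
Proof. exact: lift_unit. Qed.

(** Two arcs without common end are disjoint compact sets, and there are finitely many
pairs of them. *)
Lemma arcs_separated : exists2 h, 0 < h <= 1 & forall uv ab, up_edge uv -> up_edge ab ->
  disjoint_edges uv ab -> forall t s, t \in `[0, 1] -> s \in `[0, 1] ->
  gram k (lifted uv t) (lifted ab s) <= 1 - h.
Proof.
pose P (i : edge * edge) h := up_edge i.1 -> up_edge i.2 -> disjoint_edges i.1 i.2 ->
  forall t s, t \in `[0, 1] -> s \in `[0, 1] -> gram k (lifted i.1 t) (lifted i.2 s) <= 1 - h.
have [h h0 hP] : exists2 h, 0 < h & forall i, P i h.
  apply: fin_common_pos => [i h h' h'0 hh Ph u1 u2 dd t s ht hs|[uv ab]].
    by apply: le_trans (Ph u1 u2 dd t s ht hs) _; rewrite lerB.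
  have [/and3P[u1 u2 dd]|no] := boolP [&& up_edge uv, up_edge ab & disjoint_edges uv ab]; last first.
    by exists 1 => // u1 u2 dd; move: no; rewrite u1 u2 dd.
  have [|h h0 hP] := separated_square (gram_continuous u1 u2); last by exists h => // _ _ _ t s; apply: hP.
  move=> t s _ _ /=; rewrite lt_neqAle; apply/andP; split.
    apply/eqP => /gram_eq1; exact: oriented_disjoint.
  have := dot3_le1 (lifted_unit uv t) (lifted_unit ab s); rewrite /gram.
  case: (k) => h; last by apply: le_trans h; exact: ler_norm.
  by rewrite -real_normK ?num_real // expr_le1.
exists (Num.min h 1); first by rewrite lt_min h0 ltr01 ge_min lexx orbT.
move=> uv ab u1 u2 dd t s ht hs; apply: le_trans (hP (uv, ab) u1 u2 dd t s ht hs) _.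
by rewrite lerB // ge_min lexx.
Qed.

Lemma feat_le1 p ij : dot3 p p = 1 -> `|feat k p ij| <= 1 :> K.
Proof.
move=> hp; have c := fun j => unit_coord j hp.
rewrite /feat; case: (k); first by rewrite normrM mulr_ile1.
by case: (_ == _); rewrite ?mulr1n ?mulr0n ?normr0.
Qed.

(** The feature vectors are uniformly continuous along each arc, although the lift is not
continuous. *)
Lemma lifted_steps d : 0 < d -> exists n : nat, forall uv, up_edge uv ->
  forall t s, t \in `[0, 1] -> `|t - s| <= n.+1%:R^-1 -> 1 - d < gram k (lifted uv t) (lifted uv s).
Proof.
move=> d0.
pose P (i : edge * ('I_3 * 'I_3)) (n : nat) := up_edge i.1 ->
  forall t s, t \in `[0, 1] -> `|t - s| <= n.+1%:R^-1 ->
  `|feat k (lifted i.1 t) i.2 - feat k (lifted i.1 s) i.2| < d / 9.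
have [n hn] : exists n, forall i, P i n.
  apply: fin_common_nat => -[uv ij].
  have [uvE|no] := boolP (up_edge uv); last by exists 0%N => n _ u; rewrite u in no.
  have cf : continuous (fun t => feat k (lifted uv t) ij).
    move=> t; apply: (@continuous_comp _ _ _ (oriented uv) (fun x => feat k (lift_pt x) ij)).
      exact: oriented_continuous.
    exact: feat_continuous.
  have d9 : 0 < d / 9 by rewrite divr_gt0.
  have [m hm] := unif_continuous_itv cf d9.
  by exists m => n mn _ t s ht; apply: hm.
exists n => uv uvE t s ht hts.
have g1 : gram k (lifted uv t) (lifted uv t) = 1 by rewrite /gram lifted_unit expr1n; case: (k).
rewrite ltrBlDr -ltrBlDl -{1}g1 !gramE -sumrB.
rewrite (@le_lt_trans _ _ (\sum_(ij : 'I_3 * 'I_3) `|feat k (lifted uv t) ij - feat k (lifted uv s) ij|)) //.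
  apply: ler_sum => ij _; rewrite -mulrBr (le_trans (ler_norm _)) // normrM.
  by rewrite -[leRHS]mul1r ler_wpM2r ?feat_le1 ?lifted_unit.
apply: lt_le_trans (_ : \sum_(ij : 'I_3 * 'I_3) (d / 9) <= _).
  apply: ltr_sum; last by move=> ij _; apply: (hn (uv, ij)).
  by apply/hasP; exists (0, 0); rewrite ?mem_index_enum.
rewrite sumr_const card_prod !card_ord -[(3 * 3)%N]/9%N. lra.
Qed.

Section Sampling.
Variables (n : nat) (d : K).
Hypothesis d0 : 0 < d.
Hypothesis step : forall uv, up_edge uv -> forall t s, t \in `[0, 1] -> `|t - s| <= n.+1%:R^-1 ->
  1 - d ^+ 2 / 2 < gram k (lifted uv t) (lifted uv s).

Definition time (i : nat) : K := i%:R / n.+1%:R.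

(** The sign of each lifted point is chosen so that it is close to the previous one and not to
the antipode of it. *)
Fixpoint sample (uv : edge) (i : nat) : 'rV[K]_3 :=
  if i is j.+1 then
    let q := lifted uv (time i) in if k && (dot3 (sample uv j) q < 0) then - q else q
  else lifted uv (time 0).

Lemma time_itv i : (i <= n.+1)%N -> time i \in `[0, 1].
Proof.
move=> hi; rewrite in01 /time divr_ge0 //= ler_pdivrMr ?ltr0n // mul1r ler_nat //.
Qed.

Lemma sample_sign uv i : exists2 b : bool, b ==> k & sample uv i = (-1) ^+ b *: lifted uv (time i).
Proof.
case: i => [|i] /=; first by exists false => //; rewrite expr0 scale1r.
case: ifP => [/andP[hk _]|_]; first by exists true => //; rewrite expr1 scaleN1r.
by exists false => //; rewrite expr0 scale1r.
Qed.

Lemma dot3Z a b (p q : 'rV[K]_3) : dot3 (a *: p) (b *: q) = a * b * dot3 p q.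
Proof. by rewrite /dot3 !mxE; ring. Qed.

Lemma sample_gram uv ab i j : gram k (sample uv i) (sample ab j) = gram k (lifted uv (time i)) (lifted ab (time j)).
Proof.
have [b hb ->] := sample_sign uv i; have [c hc ->] := sample_sign ab j.
rewrite /gram !dot3Z; case: (k) hb hc => hb hc; first by rewrite exprMn -signr_addb sqrr_sign mul1r.
by move: hb hc; case: b => //; case: c => // _ _; rewrite expr0 !mul1r.
Qed.

Lemma sample_unit uv i : dot3 (sample uv i) (sample uv i) = 1.
Proof.
by have [b hb ->] := sample_sign uv i; rewrite dot3Z -signr_addb addbb mul1r lifted_unit.
Qed.

Lemma sample_close uv i : up_edge uv -> (i <= n)%N -> close3 d (sample uv i.+1) (sample uv i).
Proof.
move=> uvE hi; apply: close3_near (sample_unit _ _) (sample_unit _ _) d0 _.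
have h : 1 - d ^+ 2 / 2 < gram k (sample uv i) (sample uv i.+1).
  rewrite sample_gram; apply: step => //; first by apply: time_itv; apply: ltnW.
  rewrite /time -mulrBl (_ : i%:R - i.+1%:R = -1 :> K); last by rewrite -natr1; ring.
  by rewrite mulN1r normrN ger0_norm ?invr_ge0.
apply: lt_le_trans h _.
have := dot3_le1 (sample_unit uv i) (sample_unit uv i.+1); rewrite ler_norml => /andP[_ le1].
have [hk|hk] : k \/ ~~ k by apply/orP; rewrite orbN.
  2: by rewrite /gram ifF //; apply/negbTE.
rewrite /gram ifT // expr2 ler_piMl //.
rewrite /= hk /=; case: ltP => //; set q := lifted _ _ => qlt.
have -> : dot3 (sample uv i) (- q) = - dot3 (sample uv i) q by rewrite /dot3 !mxE; ring.
by rewrite oppr_ge0 ltW.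
Qed.
End Sampling.

End EmbeddingObstruction.

(** The class [x uv] records whether the lift of the arc, started at the lift of its first
end, arrives at the antipode of the lift of its second end. *)
Theorem embeds_obstruction (K : realType) (k : bool) (N : nat) (e : rel 'I_N) :
  (2 < N)%N -> embeds K e (crosscap_sphere K k) ->
  exists (x : 'I_N * 'I_N -> bool) (kk : 'I_N -> 'I_N * 'I_N -> bool),
  (forall uv, x uv -> k) /\
  forall uv ab, up_edge e uv -> up_edge e ab -> disjoint_edges uv ab ->
  interlace (val uv.1, val uv.2) (val ab.1, val ab.2) (+) (x uv && x ab)
   (+) (kk uv.1 ab (+) kk uv.2 ab) (+) (kk ab.1 uv (+) kk ab.2 uv) = false.
Proof.
move=> N2 [phi [arc [phi_inj arcP _ arc_disj]]].
have [h /andP[h0 h1] sep] := arcs_separated arcP arc_disj.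
pose d := h / 200.
have d0 : 0 < d by rewrite /d; apply: divr_gt0 h0 _; rewrite ltr0n.
have dd0 : 0 < d ^+ 2 / 2 by rewrite divr_gt0 // exprn_gt0.
have [n step] := lifted_steps arcP dd0.
pose s := sample phi arc n.
pose x uv := k && (dot3 (s uv n) (lifted phi arc uv 1) < 0).
have xk uv : x uv -> k by move=> /andP[].
have t1 : time K n n.+1 = 1 by rewrite /time divff // pnatr_eq0.
have t0 : time K n 0 = 0 by rewrite /time mul0r.
have [||||kk hkk] := @obstruction K k N N2 (up_edge e) n s (fun v => lift_pt (phi v)) x d _ (fun uv _ => xk uv) _ _ d0.
- by move=> uv /andP[].
- by move=> uv uvE; rewrite /s /= t0 /lifted (oriented_ends phi_inj arcP uvE).1.
- move=> uv uvE; rewrite /s /= t1 -/(s uv n) -/(x uv).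
  by rewrite /lifted (oriented_ends phi_inj arcP uvE).2.
- move=> uv ab i j p p' q q' uvE abE dis hi hj c1 c2 c3 c4 g1 g2 g3 g4.
  (* One half of the allowed distance is used by the perturbation, the other half by the
     step from one sample to the next. *)
  have dh : d + d = h / 100 by rewrite /d; field.
  have near uw l r : up_edge e uw -> (l <= n)%N -> close3 d r (s uw l.+1) -> close3 (h / 100) r (s uw l).
    by move=> uwE hl cr; rewrite -dh; apply: close3_trans cr _; exact: (sample_close d0 step).
  have w r r' : close3 d r r' -> close3 (h / 100) r r' by apply: close3W; rewrite -dh lerDl ltW.
  have gr : gram k (s uv i) (s ab j) <= 1 - h.
    by rewrite sample_gram; apply: sep => //; apply: time_itv; exact: leqW.
  have [hk|hk] : k \/ k = false by case: (k); [left|right].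
    move: gr; rewrite /gram ifT // => gr; rewrite [k]hk.
    by apply: (stable_projective (sample_unit _ _ _ _ _) (sample_unit _ _ _ _ _) h0 h1 gr) => //;
      [exact: w | exact: near | exact: w | exact: near].
  move: gr; rewrite /gram ifF // => gr; rewrite [X in cross X]hk.
  by apply: (stable_sphere (sample_unit _ _ _ _ _) (sample_unit _ _ _ _ _) h0 h1 gr) => //;
      [exact: w | exact: near | exact: w | exact: near].
by exists x, kk.
Qed.

(** * Certificates of non-embeddability *)
Section Systems.
Variable L : seq (nat * nat).

Definition apart (e f : nat * nat) := uniq [:: e.1; e.2; f.1; f.2].

(** The conclusion of [embeds_obstruction] for the edge list [L]. *)
Definition solution (x : nat * nat -> bool) (kk : nat -> nat * nat -> bool) :=
  forall e f, e \in L -> f \in L -> apart e f ->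
  interlace e f (+) (x e && x f) (+) (kk e.1 f (+) kk e.2 f) (+) (kk f.1 e (+) kk f.2 e) = false.

(** Pulling a vertex through the crosscap changes the class of all edges at the vertex.  The
correction of [kk] compensates the change of the quadratic term. *)
Lemma solution_switch x kk (y : nat -> bool) : solution x kk ->
  exists kk', solution (fun e => x e (+) (y e.1 (+) y e.2)) kk'.
Proof.
move=> sol.
(* A term that belongs to two vertices is charged to the one with the smaller number. *)
pose half v a := [&& (v < a)%N, y v & y a].
exists (fun v f => kk v f (+) ((y v && x f) (+) (half v f.1 (+) half v f.2))) => e f eL fL ef.
have halfC v a : v != a -> half v a (+) half a v = y v && y a.
  by rewrite /half; case: (ltngtP v a) => //= _ _; rewrite ?addbF // andbC.
rewrite -(sol e f eL fL ef).
move: ef; rewrite /apart /= !inE !negb_or => /and3P[/and3P[_ n1 n2] /andP[n3 n4] _].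
have := halfC _ _ n1; have := halfC _ _ n2; have := halfC _ _ n3; have := halfC _ _ n4.
move: (half e.1 f.1) (half e.1 f.2) (half e.2 f.1) (half e.2 f.2) => a1 a2 a3 a4.
move: (half f.1 e.1) (half f.1 e.2) (half f.2 e.1) (half f.2 e.2) => b1 b2 b3 b4.
move=> h4 h3 h2 h1.
have -> : b1 = a1 (+) (y e.1 && y f.1) by rewrite -h1 addKb.
have -> : b2 = a3 (+) (y e.2 && y f.1) by rewrite -h3 addKb.
have -> : b3 = a2 (+) (y e.1 && y f.2) by rewrite -h2 addKb.
have -> : b4 = a4 (+) (y e.2 && y f.2) by rewrite -h4 addKb.
clear; rewrite (addbACA (kk e.1 f)) (addbACA (kk f.1 e)).
set p := _ (+) (y e.2 && x f (+) _); set q := _ (+) (y f.2 && x e (+) _).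
have -> : (x e (+) (y e.1 (+) y e.2)) && (x f (+) (y f.1 (+) y f.2)) = (x e && x f) (+) (p (+) q).
  rewrite {}/p {}/q.
  by case: (x e); case: (x f); case: (y e.1); case: (y e.2); case: (y f.1); case: (y f.2); case: a1; case: a2; case: a3; case: a4.
move: (kk e.1 f (+) kk e.2 f) (kk f.1 e (+) kk f.2 e) (interlace e f) (x e && x f) p q.
by do 6 case.
Qed.

Lemma xor_even (T : eqType) (s : seq T) (g : T -> bool) :
  all (fun t => ~~ odd (count_mem t s)) s -> \xor_(t <- s) g t = false.
Proof.
move=> /allP ev; rewrite -big_undup_iterop_count big1_seq // => t /andP[_].
rewrite mem_undup => /ev /negbTE even_t; rewrite Monoid.iteropE.
suff -> n b : iter n (addb b) false = odd n && b by rewrite even_t.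
by elim: n => //= n ->; case: b; rewrite ?andbT ?andbF //; case: (odd n).
Qed.

(** The unknowns [kk v f] in the identities of the listed pairs. *)
Definition tokens (z : seq ((nat * nat) * (nat * nat))) :=
  flatten [seq [:: (ef.1.1, ef.2); (ef.1.2, ef.2); (ef.2.1, ef.1); (ef.2.2, ef.1)] | ef <- z].

Definition cocycle z :=
  all (fun ef => [&& ef.1 \in L, ef.2 \in L & apart ef.1 ef.2]) z &&
  (let s := tokens z in all (fun t => ~~ odd (count_mem t s)) s).

(** Every unknown [kk v f] occurs evenly often in the sum of the identities over [z], and so
disappears. *)
Lemma cocycle_sum x kk z : solution x kk -> cocycle z ->
  \xor_(ef <- z) (x ef.1 && x ef.2) = \xor_(ef <- z) interlace ef.1 ef.2.
Proof.
move=> sol /andP[/allP zL ev].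
have E : \xor_(ef <- z) ((x ef.1 && x ef.2) (+) interlace ef.1 ef.2) = \xor_(t <- tokens z) kk t.1 t.2.
  rewrite /tokens big_flatten big_map; apply: eq_big_seq => ef /zL/and3P[eL fL ap].
  rewrite !big_cons big_nil /=; move: (sol _ _ eL fL ap).
  by case: (x _ && _); case: interlace; case: (kk ef.1.1 _); case: (kk ef.1.2 _); case: (kk ef.2.1 _); case: (kk ef.2.2 _).
rewrite (xor_even _ ev) big_split /= in E; move: E.
by case: (\xor_(_ <- _) _); case: (\xor_(_ <- _) _).
Qed.

(** The spanning tree in which each vertex hangs on its first smaller neighbour; if there is
none the value is [v] itself. *)
Definition parent (v : nat) := find (fun u => (u, v) \in L) (iota 0 v).

(** The sum of [x] along the tree path from the root, with fuel [n]. *)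
Fixpoint potential (x : nat * nat -> bool) (n v : nat) : bool :=
  if n isn't m.+1 then false
  else if v is 0 then false else potential x m (parent v) (+) x (parent v, v).

Definition rooted N := all (fun v => (parent v < v)%N) (iota 1 N.-1).

Lemma potential_fuel N x n v : rooted N -> (v < n)%N -> (v < N)%N -> potential x n v = potential x v.+1 v.
Proof.
move=> /allP tr; elim/ltn_ind: v n => v IH [//|n] vn vN /=.
case: v IH vn vN => [//|v] IH vn vN.
have pv : (parent v.+1 < v.+1)%N by apply: tr; rewrite mem_iota; case: (N) vN.
have pN := ltn_trans pv vN; congr (_ (+) _).
by rewrite (IH _ pv v.+1 pv pN); apply: (IH _ pv) => //; exact: leq_trans pv _.
Qed.

Definition tree e := e.1 == parent e.2.

Definition free_edges := [seq e <- L | ~~ tree e].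

(** Switching by the potential makes [x] vanish on the spanning tree.  This removes the
gauge freedom from the search for a solution. *)
Lemma solution_normalize N x kk : rooted N -> all (fun e => e.1 < e.2 < N)%N L ->
  solution x kk -> exists x' kk', solution x' kk' /\ {in L, forall e, tree e -> x' e = false}.
Proof.
move=> tr LN sol; pose y v := potential x v.+1 v.
have [kk' sol'] := solution_switch y sol.
exists (fun e => x e (+) (y e.1 (+) y e.2)), kk'; split => // -[u v] /(allP LN)/= /andP[uv vN] /eqP /= eu.
rewrite eu in uv *.
rewrite {2}/y /=; case: v uv vN eu => [//|v] uv vN eu.
rewrite (potential_fuel x tr) //; last exact: ltn_trans uv vN.
by rewrite addKb addbb.
Qed.

(** Iterated operators are opaque, whereas the certificates are checked by computation. *)
Definition xsum (T : Type) (f : T -> bool) (s : seq T) := foldr (fun t b => f t (+) b) false s.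

Lemma xsumE (T : Type) (f : T -> bool) s : xsum f s = \xor_(t <- s) f t.
Proof. by elim: s => [|t s IH]; rewrite ?big_nil // big_cons /= IH. Qed.

(** A backtracking search over the values of the unknowns in the order of their numbers,
where a branch is closed as soon as an equation without undetermined unknowns is
violated. *)
Fixpoint refute (n : nat) (cs : seq (seq (nat * nat) * bool)) (env : seq bool) : bool :=
  has (fun c => all (fun ij => (ij.1 < size env) && (ij.2 < size env))%N c.1 &&
     (xsum (fun ij => nth false env ij.1 && nth false env ij.2) c.1 != c.2)) cs
  || (if n is m.+1 then refute m cs (rcons env false) && refute m cs (rcons env true) else false).

Lemma refuteP (a : nat -> bool) n cs k :
  (forall c, c \in cs -> \xor_(ij <- c.1) (a ij.1 && a ij.2) = c.2) ->
  refute n cs (mkseq a k) = false.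
Proof.
move=> sat; elim: n k => [|n IH] k /=; apply/negbTE; rewrite negb_or.
  rewrite andbT; apply/hasPn => c cs_c; rewrite negb_and negbK size_mkseq.
  have [al|] /= := boolP (all _ _); last by [].
  rewrite -(sat c cs_c) xsumE; apply/eqP; apply: eq_big_seq => ij /(allP al)/andP[h1 h2].
  by rewrite !nth_mkseq.
apply/andP; split.
  apply/hasPn => c cs_c; rewrite negb_and negbK size_mkseq.
  have [al|] /= := boolP (all _ _); last by [].
  rewrite -(sat c cs_c) xsumE; apply/eqP; apply: eq_big_seq => ij /(allP al)/andP[h1 h2].
  by rewrite !nth_mkseq.
have mk : rcons (mkseq a k) (a k) = mkseq a k.+1 by rewrite /mkseq -addn1 iotaD map_cat /= add0n cats1.
have step b : a k = b -> refute n cs (rcons (mkseq a k) b) = false by move=> <-; rewrite mk IH.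
by rewrite negb_and; case: (a k) step => step; rewrite (step _ erefl) ?orbT.
Qed.

(** The equation for [x] which [cocycle_sum] gives, in terms of the edges outside the
spanning tree. *)
Definition quadric z : seq (nat * nat) * bool :=
  ([seq (index ef.1 free_edges, index ef.2 free_edges) | ef <- z & ~~ tree ef.1 && ~~ tree ef.2],
   xsum (fun ef => interlace ef.1 ef.2) z).

Definition certificate N (zs : seq (seq ((nat * nat) * (nat * nat)))) :=
  [&& (2 < N)%N, all (fun e => e.1 < e.2 < N)%N L, rooted N, all cocycle zs
    & refute (size free_edges) (map quadric zs) [::]].

Lemma certificate_unsolvable N zs x kk : certificate N zs -> ~ solution x kk.
Proof.
move=> /and5P[_ LN tr /allP zc ref] /(solution_normalize tr LN)[x' [kk' [sol x'0]]].
move: ref; rewrite (_ : [::] = mkseq (fun i => x' (nth (0, 0)%N free_edges i)) 0) // refuteP //.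
move=> c /mapP[z zz ->].
have zL : all (fun ef => (ef.1 \in L) && (ef.2 \in L)) z.
  by have /andP[+ _] := zc z zz; apply: sub_all => ef /and3P[-> ->].
rewrite /= xsumE big_map big_filter -(cocycle_sum sol (zc z zz)).
rewrite [RHS](bigID (fun ef => ~~ tree ef.1 && ~~ tree ef.2)) /=.
rewrite [X in _ = _ (+) X]big1_seq ?addbF.
  rewrite [LHS]big_seq_cond [RHS]big_seq_cond; apply: eq_bigr => ef /and3P[/(allP zL)/andP[eL fL] t1 t2].
  by rewrite !nth_index // mem_filter ?t1 ?t2.
move=> ef /andP[+ /(allP zL)/andP[eL fL]]; rewrite negb_and !negbK.
by move=> /orP[] /x'0 -> //; rewrite andbF.
Qed.

Definition hops (p : seq nat) : seq (nat * nat) :=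
  if p is u :: r then pairmap (fun u v => if (u < v)%N then (u, v) else (v, u)) u r else [::].

(** The argument lists the branch paths of a subdivision of a Kuratowski graph.  In such a
graph the paths which avoid a given path together with the ends of this path form a closed
curve; therefore the pairs of edges on disjoint branch paths contain each token evenly
often. *)
Fixpoint deleted_square (ps : seq (seq nat)) :=
  if ps is p :: r then
    flatten [seq [seq (e, f) | e <- hops p, f <- hops q]
      | q <- r & [&& head 0 p != head 0 q, head 0 p != last 0 q, last 0 p != head 0 q & last 0 p != last 0 q]%N]
    ++ deleted_square r
  else [::].
End Systems.

(** Graphs given by lists of edges between numbers, suited for computation. *)
Definition pattern (L : seq (nat * nat)) N : rel 'I_N := fun u v => ((val u, val v) \in L) || ((val v, val u) \in L).

Section Patterns.
Variables (K : realType) (L : seq (nat * nat)).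

Lemma pattern_solution (k : bool) N : (2 < N)%N -> all (fun e => e.1 < e.2 < N)%N L ->
  embeds K (@pattern L N) (crosscap_sphere K k) -> exists (x : nat * nat -> bool) kk, (forall e, x e -> k) /\ solution L x kk.
Proof.
case: N => [//|M] N2 LN /(embeds_obstruction N2)[x [kk [xk sol]]].
pose o (u : nat) : 'I_M.+1 := inord u; pose oo (e : nat * nat) := (o e.1, o e.2).
exists (x \o oo), (fun v e => kk (o v) (oo e)); split => [e /xk //|e f eL fL ap].
have vo g : g \in L -> (val (oo g).1 = g.1) /\ (val (oo g).2 = g.2).
  move=> gL; have /andP[g12 gN] := allP LN g gL.
  by split; apply: inordK => //; apply: ltn_trans g12 gN.
have up g : g \in L -> up_edge (@pattern L M.+1) (oo g).
  move=> gL; have /andP[g12 gN] := allP LN g gL; have [g1 g2] := vo g gL.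
  change ((val (oo g).1 < val (oo g).2)%N && (((val (oo g).1, val (oo g).2) \in L)
    || ((val (oo g).2, val (oo g).1) \in L))).
  by rewrite g1 g2 -surjective_pairing gL g12.
have [e1 e2] := vo e eL; have [f1 f2] := vo f fL.
have dis : disjoint_edges (oo e) (oo f).
  rewrite /disjoint_edges -(map_inj_uniq val_inj) /= -/(val _) e1.
  by rewrite -/(val _) e2 -/(val _) f1  -/(val _) f2.
have := sol _ _ (up e eL) (up f fL) dis.
by rewrite e1 e2 f1 f2 -!surjective_pairing.
Qed.

Theorem not_projective N zs : certificate L N zs -> ~ embeds K (@pattern L N) (crosscap_sphere K 1).
Proof.
move=> cert emb; have /and5P[N2 LN _ _ _] := cert.
by have [x [kk [_ /(certificate_unsolvable cert)]]] := pattern_solution N2 LN (k := true) emb.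
Qed.

Theorem not_planar N z : (2 < N)%N -> all (fun e => e.1 < e.2 < N)%N L -> cocycle L z ->
  xsum (fun ef => interlace ef.1 ef.2) z -> ~ embeds K (@pattern L N) (crosscap_sphere K 0).
Proof.
move=> N2 LN zc; rewrite xsumE => nu emb.
have [x [kk [x0 sol]]] := pattern_solution N2 LN (k := false) emb.
move: nu; rewrite -(cocycle_sum sol zc) big1 // => ef _.
by case: (x ef.1) (x0 ef.1) => // /(_ isT).
Qed.
End Patterns.

Lemma embeds_sub (K : realType) (V W : finType) (e : rel V) (f : rel W) (X : topologicalType) (g : V -> W) :
  injective g -> (forall x y, e x y -> f (g x) (g y)) -> embeds K f X -> embeds K e X.
Proof.
move=> gi gh [phi [arc [phi_inj arcP avoid disj]]].
have gE E : E \in edge_set e -> g @: E \in edge_set f.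
  move=> /imsetP[[x y]]; rewrite inE /= => exy ->; apply/imsetP; exists (g x, g y); rewrite ?inE /= ?gh //.
  by rewrite imsetU1 imset_set1.
exists (phi \o g), (fun E : {set V} => arc (g @: E)); split.
- exact: inj_comp.
- move=> E /gE/arcP[h1 h2 h3]; split => //; rewrite h3.
  apply/seteqP; split => x /=.
    by move=> [w /imsetP[v vE ->] <-]; exists v.
  by move=> [v vE <-]; exists (g v) => //; apply/imsetP; exists v.
- by move=> E v t /gE EE t01 /(avoid _ _ _ EE t01); rewrite (mem_imset _ _ gi).
- move=> E F t s /gE EE /gE FF EF t01 s01 h.
  have EF' : g @: E != g @: F by rewrite (inj_eq (imset_inj gi)).
  have [w + ww] := disj _ _ t s EE FF EF' t01 s01 h.
  rewrite -imsetI; last by move=> ? ? _ _; exact: gi.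
  by move=> /imsetP[v vEF wv]; exists v => //; rewrite ww wv.
Qed.

(** * Graphs that do not embed *)
Definition K35 : seq (nat * nat) := [:: (0, 1); (0, 2); (0, 3); (0, 4); (0, 5); (1, 6); (1, 7);
  (2, 6); (2, 7); (3, 6); (3, 7); (4, 6); (4, 7); (5, 6); (5, 7)]%N.
Definition K35_kuratowski : seq (seq (seq nat)) := [:: [:: [:: 0; 1]; [:: 0; 2]; [:: 0; 3]; [::
  6; 1]; [:: 6; 2]; [:: 6; 3]; [:: 7; 1]; [:: 7; 2]; [:: 7; 3]]; [:: [:: 0; 1]; [:: 0; 4]; [::
  0; 5]; [:: 6; 1]; [:: 6; 4]; [:: 6; 5]; [:: 7; 1]; [:: 7; 4]; [:: 7; 5]]; [:: [:: 0; 2]; [::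
  0; 3]; [:: 0; 4]; [:: 6; 2]; [:: 6; 3]; [:: 6; 4]; [:: 7; 2]; [:: 7; 3]; [:: 7; 4]]; [:: [::
  0; 2]; [:: 0; 3]; [:: 0; 5]; [:: 6; 2]; [:: 6; 3]; [:: 6; 5]; [:: 7; 2]; [:: 7; 3]; [:: 7;
  5]]]%N.
Lemma K35_certificate : certificate K35 8 (map deleted_square K35_kuratowski).
Proof. by vm_compute. Qed.
(** The complete bipartite graph on 4 + 4 vertices without one edge. *)
Definition K44e : seq (nat * nat) := [:: (0, 1); (0, 2); (0, 3); (1, 4); (1, 5); (1, 6);
  (2, 4); (2, 5); (2, 6); (3, 4); (3, 5); (3, 6); (4, 7); (5, 7); (6, 7)]%N.
(** Branch paths of subdivisions of Kuratowski graphs, found by a computer search. *)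
Definition K44e_kuratowski : seq (seq (seq nat)) := [:: [:: [:: 0; 2; 5; 7]; [:: 0; 1]; [:: 0;
  3]; [:: 4; 1]; [:: 4; 3]; [:: 4; 7]; [:: 6; 1]; [:: 6; 3]; [:: 6; 7]]; [:: [:: 0; 3; 6; 7];
  [:: 0; 1]; [:: 0; 2]; [:: 4; 1]; [:: 4; 2]; [:: 4; 7]; [:: 5; 1]; [:: 5; 2]; [:: 5; 7]]; [::
  [:: 0; 3; 4; 7]; [:: 0; 1]; [:: 0; 2]; [:: 5; 1]; [:: 5; 2]; [:: 5; 7]; [:: 6; 1]; [:: 6; 2];
  [:: 6; 7]]; [:: [:: 0; 2; 6; 7]; [:: 0; 1]; [:: 0; 3]; [:: 4; 1]; [:: 4; 3]; [:: 4; 7]; [::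
  5; 1]; [:: 5; 3]; [:: 5; 7]]]%N.
Lemma K44e_certificate : certificate K44e 8 (map deleted_square K44e_kuratowski).
Proof. by vm_compute. Qed.
(** The complete multipartite graph with parts of sizes 1, 2, 2, 2; the single vertex is 0. *)
Definition K1222 : seq (nat * nat) := [:: (0, 1); (0, 2); (0, 3); (0, 4); (0, 5); (0, 6);
  (1, 3); (1, 4); (1, 5); (1, 6); (2, 3); (2, 4); (2, 5); (2, 6); (3, 5); (3, 6); (4, 5);
  (4, 6)]%N.
Definition K1222_kuratowski : seq (seq (seq nat)) := [:: [:: [:: 3; 5; 4]; [:: 0; 1]; [:: 0;
  2]; [:: 0; 4]; [:: 3; 1]; [:: 3; 2]; [:: 6; 1]; [:: 6; 2]; [:: 6; 4]]; [:: [:: 5; 3; 6]; [::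
  0; 1]; [:: 0; 2]; [:: 0; 6]; [:: 4; 1]; [:: 4; 2]; [:: 4; 6]; [:: 5; 1]; [:: 5; 2]]; [:: [::
  3; 2; 4]; [:: 0; 4]; [:: 0; 5]; [:: 0; 6]; [:: 1; 4]; [:: 1; 5]; [:: 1; 6]; [:: 3; 5]; [:: 3;
  6]]; [:: [:: 2; 5; 1]; [:: 0; 1]; [:: 0; 3]; [:: 0; 4]; [:: 2; 3]; [:: 2; 4]; [:: 6; 1]; [::
  6; 3]; [:: 6; 4]]; [:: [:: 3; 0; 4]; [:: 5; 2; 6]; [:: 1; 3]; [:: 1; 4]; [:: 1; 5]; [:: 1;
  6]; [:: 3; 5]; [:: 3; 6]; [:: 4; 5]; [:: 4; 6]]; [:: [:: 2; 4; 1]; [:: 0; 1]; [:: 0; 5]; [::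
  0; 6]; [:: 2; 5]; [:: 2; 6]; [:: 3; 1]; [:: 3; 5]; [:: 3; 6]]; [:: [:: 5; 1; 6]; [:: 0; 3];
  [:: 0; 4]; [:: 0; 6]; [:: 2; 3]; [:: 2; 4]; [:: 2; 6]; [:: 5; 3]; [:: 5; 4]]]%N.
Lemma K1222_certificate : certificate K1222 7 (map deleted_square K1222_kuratowski).
Proof. by vm_compute. Qed.
(** The complete bipartite graph on 4 + 5 vertices without a matching of four edges. *)
Definition K45m : seq (nat * nat) := [:: (0, 1); (0, 2); (0, 3); (0, 4); (1, 5); (1, 6);
  (2, 6); (2, 7); (3, 5); (3, 7); (4, 5); (4, 6); (4, 7); (5, 8); (6, 8); (7, 8)]%N.
Definition K45m_kuratowski : seq (seq (seq nat)) := [:: [:: [:: 7; 2; 6; 1]; [:: 0; 1]; [:: 0;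
  3]; [:: 0; 4]; [:: 5; 1]; [:: 5; 3]; [:: 5; 4]; [:: 7; 3]; [:: 7; 4]]; [:: [:: 7; 3; 5; 1];
  [:: 0; 1]; [:: 0; 2]; [:: 0; 4]; [:: 6; 1]; [:: 6; 2]; [:: 6; 4]; [:: 7; 2]; [:: 7; 4]]; [::
  [:: 1; 0; 3; 7]; [:: 1; 5]; [:: 1; 6]; [:: 4; 5]; [:: 4; 6]; [:: 4; 7]; [:: 8; 5]; [:: 8; 6];
  [:: 8; 7]]; [:: [:: 2; 0; 3; 5]; [:: 2; 6]; [:: 2; 7]; [:: 4; 5]; [:: 4; 6]; [:: 4; 7]; [::
  8; 5]; [:: 8; 6]; [:: 8; 7]]]%N.
Lemma K45m_certificate : certificate K45m 9 (map deleted_square K45m_kuratowski).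
Proof. by vm_compute. Qed.
(** A subgraph of the unit graph of the square of the field with three elements, for
[S = {(1, 1), (1, -1)}]. *)
Definition B8 : seq (nat * nat) := [:: (0, 1); (0, 2); (0, 3); (1, 4); (1, 5); (2, 4); (2, 5);
  (3, 4); (3, 5); (3, 6); (3, 7); (4, 6); (4, 7); (5, 6); (5, 7); (6, 7)]%N.
Definition B8_kuratowski : seq (seq (seq nat)) := [:: [:: [:: 0; 2; 4]; [:: 0; 1; 5]; [:: 0;
  3]; [:: 6; 3]; [:: 6; 4]; [:: 6; 5]; [:: 7; 3]; [:: 7; 4]; [:: 7; 5]]; [:: [:: 0; 3; 7; 6];
  [:: 0; 1]; [:: 0; 2]; [:: 4; 1]; [:: 4; 2]; [:: 4; 6]; [:: 5; 1]; [:: 5; 2]; [:: 5; 6]]; [::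
  [:: 0; 3; 6; 7]; [:: 0; 1]; [:: 0; 2]; [:: 4; 1]; [:: 4; 2]; [:: 4; 7]; [:: 5; 1]; [:: 5; 2];
  [:: 5; 7]]; [:: [:: 4; 2; 5]; [:: 3; 4]; [:: 3; 5]; [:: 3; 6]; [:: 3; 7]; [:: 4; 6]; [:: 4;
  7]; [:: 5; 6]; [:: 5; 7]; [:: 6; 7]]; [:: [:: 0; 1]; [:: 0; 2]; [:: 0; 3]; [:: 4; 1]; [:: 4;
  2]; [:: 4; 3]; [:: 5; 1]; [:: 5; 2]; [:: 5; 3]]]%N.
Lemma B8_certificate : certificate B8 8 (map deleted_square B8_kuratowski).
Proof. by vm_compute. Qed.
(** A subgraph, with fifteen edges, of the hexagon whose vertices are doubled. *)
Definition C6b : seq (nat * nat) := [:: (0, 1); (0, 2); (0, 3); (1, 4); (1, 5); (2, 6); (2, 7);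
  (3, 6); (3, 7); (4, 8); (4, 9); (5, 8); (5, 9); (6, 9); (7, 8)]%N.
Definition C6b_kuratowski : seq (seq (seq nat)) := [:: [:: [:: 6; 9; 5; 1]; [:: 7; 8; 4; 1];
  [:: 0; 1]; [:: 0; 2]; [:: 0; 3]; [:: 6; 2]; [:: 6; 3]; [:: 7; 2]; [:: 7; 3]]; [:: [:: 1; 0;
  3; 6]; [:: 8; 7; 2; 6]; [:: 1; 4]; [:: 1; 5]; [:: 8; 4]; [:: 8; 5]; [:: 9; 4]; [:: 9; 5]; [::
  9; 6]]; [:: [:: 6; 9; 4; 1]; [:: 7; 8; 5; 1]; [:: 0; 1]; [:: 0; 2]; [:: 0; 3]; [:: 6; 2]; [::
  6; 3]; [:: 7; 2]; [:: 7; 3]]; [:: [:: 0; 2; 7; 3; 0]; [:: 1; 4; 8; 5; 1]]]%N.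
Lemma C6b_certificate : certificate C6b 10 (map deleted_square C6b_kuratowski).
Proof. by vm_compute. Qed.
(** A subgraph of the bipartite graph on two copies of a 3 by 3 grid, in which vertices are
adjacent when they differ in both coordinates. *)
Definition BZ3 : seq (nat * nat) := [:: (0, 1); (0, 2); (0, 3); (1, 4); (1, 5); (2, 4); (2, 6);
  (3, 7); (3, 8); (4, 9); (5, 10); (5, 11); (6, 10); (6, 11); (7, 9); (8, 11); (8, 12);
  (10, 13); (12, 13)]%N.
Definition BZ3_kuratowski : seq (seq (seq nat)) := [:: [:: [:: 4; 9; 7; 3]; [:: 11; 5; 1]; [::
  11; 6; 2]; [:: 11; 8; 3]; [:: 0; 1]; [:: 0; 2]; [:: 0; 3]; [:: 4; 1]; [:: 4; 2]]; [:: [:: 0;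
  1; 5]; [:: 0; 2; 6]; [:: 0; 3; 8]; [:: 10; 13; 12; 8]; [:: 10; 5]; [:: 10; 6]; [:: 11; 5];
  [:: 11; 6]; [:: 11; 8]]; [:: [:: 0; 1; 4; 2; 0]; [:: 5; 10; 6; 11; 5]]; [:: [:: 0; 1; 4; 9;
  7; 3; 0]; [:: 5; 10; 13; 12; 8; 11; 5]]; [:: [:: 0; 2; 4; 9; 7; 3; 0]; [:: 6; 10; 13; 12; 8;
  11; 6]]]%N.
Lemma BZ3_certificate : certificate BZ3 14 (map deleted_square BZ3_kuratowski).
Proof. by vm_compute. Qed.
Definition K5 : seq (nat * nat) := [:: (0,1);(0,2);(0,3);(0,4);(1,2);(1,3);(1,4);(2,3);(2,4);(3,4)]%N.
Lemma K5_cocycle : (let z := deleted_square [seq [:: uv.1; uv.2] | uv <- K5] in cocycle K5 z && xsum (fun ef => interlace ef.1 ef.2) z).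
Proof. by vm_compute. Qed.
(** The unit graph of the square of the field with three elements, for [S = {(-1, -1)}];
vertices are numbered by their two digits to the base 3. *)
Definition K3xK3 : seq (nat * nat) := [:: (0, 4); (0, 5); (0, 7); (0, 8); (1, 3); (1, 5);
  (1, 6); (1, 8); (2, 3); (2, 4); (2, 6); (2, 7); (3, 7); (3, 8); (4, 6); (4, 8); (5, 6);
  (5, 7)]%N.
Lemma K3xK3_cocycle : (let z := deleted_square [:: [:: 0; 7; 3]; [:: 1; 8; 4]; [:: 2; 6; 5]; [:: 0; 4]; [:: 0; 5]; [:: 1; 3]; [:: 1; 5]; [:: 2; 3]; [:: 2; 4]]%N in cocycle K3xK3 z && xsum (fun ef => interlace ef.1 ef.2) z).
Proof. by vm_compute. Qed.

(** * Radial projection onto the surface *)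
Section Normalize.
Local Open Scope classical_set_scope.
Local Open Scope quotient_scope.
Variables (K : realType) (k : bool).
Notation X := (crosscap_sphere K k).
Implicit Types p q : 'rV[K]_3.

Definition unit_of p := (Num.sqrt (dot3 p p))^-1 *: p.

(** The unit vector on the line of [p] that is in the surface.  With a crosscap the surface is
the hemisphere of vectors whose first coordinate is not positive, so a sign may be
needed. *)
Definition rep p := if k && (0 < p 0 0) then - unit_of p else unit_of p.

Lemma dot3_ge0 p : 0 <= dot3 p p.
Proof. by rewrite -dotE dot_ge0. Qed.

Lemma dot3_eq0 p : (dot3 p p == 0) = (p == 0).
Proof.
apply/idP/eqP => [|->]; last by rewrite /dot3 !mxE !mulr0 !addr0.
rewrite /dot3 -!expr2 paddr_eq0 ?addr_ge0 ?sqr_ge0 // paddr_eq0 ?sqr_ge0 // !sqrf_eq0.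
by move=> /andP[/andP[/eqP h0 /eqP h1] /eqP h2]; apply: row3P; rewrite mxE.
Qed.

Lemma norm_gt0 p : p != 0 -> 0 < Num.sqrt (dot3 p p).
Proof. by move=> p0; rewrite sqrtr_gt0 lt_neqAle eq_sym dot3_eq0 p0 dot3_ge0. Qed.

Lemma unit_of_unit p : p != 0 -> dot3 (unit_of p) (unit_of p) = 1.
Proof.
move=> p0; rewrite /unit_of dot3Z -invfM -expr2 sqr_sqrtr ?dot3_ge0 // mulVf //.
by rewrite dot3_eq0.
Qed.

Lemma cap_centerE (i : 'I_k) p : dot p (cap_center k i) = p 0 0.
Proof.
case: (k) i => [] i; last by case: i.
rewrite dotE /dot3 !mxE /= (_ : nat_of_ord i = 0)%N; last by case: i => -[].
by rewrite mulr0n mulr0 mul0r cos0 sin0; ring.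
Qed.

Lemma cap_height_k : k -> cap_height k = 0 :> K.
Proof. by move=> hk; rewrite /cap_height hk /= cos_pihalf. Qed.

Lemma rep_holed p : p != 0 -> holed_sphere k (rep p).
Proof.
move=> p0; have n0 := norm_gt0 p0; split.
  rewrite dotE /rep; case: ifP => _; last exact: unit_of_unit.
  by rewrite -scaleN1r dot3Z mulrNN mul1r mul1r unit_of_unit.
move=> i; have hk : k by case: (k) i => // -[].
rewrite cap_centerE cap_height_k // /rep hk /=.
case: ltP => h; rewrite !mxE ?oppr_le0 ?pmulr_rle0 ?pmulr_rge0 ?invr_gt0 //.
exact: ltW.
Qed.

Let e0 : 'rV[K]_3 := delta_mx 0 0.

Lemma e0_neq0 : e0 != 0.
Proof. by apply/eqP => /rowP/(_ 0); rewrite !mxE !eqxx => /eqP; rewrite oner_eq0. Qed.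

Definition surface_pt (p : 'rV[K]_3) : holed_sphere (K := K) k :=
  insubd (exist _ (rep e0) (mem_set (rep_holed e0_neq0)) : holed_sphere (K := K) k) p.

Lemma surface_ptK p : holed_sphere k p -> val (surface_pt p) = p.
Proof. by move=> hp; rewrite /surface_pt val_insubd mem_set. Qed.

Definition quo (p : 'rV[K]_3) : X := \pi_({eq_quot (@crosscap_equiv K k)}) (surface_pt p).

Definition rho p : X := quo (rep p).

Lemma quo_eq p q : holed_sphere k p -> holed_sphere k q ->
  (quo p = quo q) <-> (p = q \/ (k /\ p 0 0 = 0 /\ q = - p)).
Proof.
move=> hp hq; rewrite /quo; split.
  move=> /eqmodP/asboolP[h|[i]].
    by left; rewrite -(surface_ptK hp) -(surface_ptK hq) h.
  have hk : k by case: (k) i => // -[].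
  rewrite !surface_ptK // cap_centerE cap_height_k // mul0rn scale0r sub0r => h0 ->.
  by right.
case=> [->//|[hk [h0 qE]]]; apply/eqmodP/asboolP; right.
have k0 : (0 < k)%N by rewrite hk.
exists (Ordinal k0); rewrite !surface_ptK // ?cap_centerE cap_height_k //.
by rewrite mul0rn scale0r sub0r.
Qed.

Lemma unit_ofZ c p : c != 0 -> p != 0 -> unit_of (c *: p) = (c / `|c|) *: unit_of p.
Proof.
move=> c0 p0; rewrite /unit_of dot3Z -expr2 sqrtrM ?sqr_ge0 // sqrtr_sqr invfM scalerA scalerA.
by congr (_ *: _); rewrite mulrC mulrA.
Qed.

Lemma rhoZ c p : p != 0 -> 0 < c \/ (k /\ c != 0) -> rho (c *: p) = rho p.
Proof.
move=> p0; wlog c0 : c p p0 / 0 < c => [hw|_].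
  case=> [c0|[hk c0]]; first by apply: hw => //; left.
  have [c1|c1|c1] := ltgtP c 0; last by rewrite c1 eqxx in c0.
    rewrite -[c]opprK scaleNr -scalerN.
    rewrite hw ?oppr_eq0 ?oppr_gt0 //; last by left.
    have pN : - p != 0 by rewrite oppr_eq0.
    apply/(quo_eq (rep_holed pN) (rep_holed p0)).
    have uN : unit_of (- p) = - unit_of p by rewrite -scaleN1r unit_ofZ ?oppr_eq0 ?oner_eq0 // normrN normr1 divr1 scaleN1r.
    rewrite /rep hk /= uN !mxE oppr_gt0.
    have [h|h|h] := ltgtP (p 0 0) 0; [by left; rewrite opprK | by left |].
    right; split => //; split; last by rewrite opprK.
    by rewrite !mxE h mulr0 oppr0.
  by apply: hw => //; left.
have u : unit_of (c *: p) = unit_of p by rewrite unit_ofZ ?gt_eqF // gtr0_norm // divff ?gt_eqF // scale1r.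
by rewrite /rho /rep u !mxE pmulr_rgt0.
Qed.

Definition parallel p q := exists2 c : K, (0 < c \/ (k /\ c != 0)) & p = c *: q.

Lemma unit_of_parallel p : p != 0 -> exists2 c : K, 0 < c & unit_of p = c *: p.
Proof. by move=> p0; exists (Num.sqrt (dot3 p p))^-1; rewrite ?invr_gt0 ?norm_gt0. Qed.

Lemma rho_parallel p q : p != 0 -> q != 0 -> rho p = rho q -> parallel p q.
Proof.
move=> p0 q0; rewrite /rho => /quo_eq h.
have [c c0 cE] := unit_of_parallel p0; have [d d0 dE] := unit_of_parallel q0.
have repE r a : 0 < a -> unit_of r = a *: r -> exists2 b : K, 0 < b \/ (k /\ b != 0) & rep r = b *: r.
  move=> a0 aE; rewrite /rep; case: ifP => [/andP[hk _]|_]; last by exists a; [left|].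
  by exists (- a); [right; rewrite oppr_eq0 gt_eqF | rewrite aE scaleNr].
have [c' hc rc] := repE _ _ c0 cE; have [d' hd rd] := repE _ _ d0 dE.
have {h} := h (rep_holed p0) (rep_holed q0); rewrite rc rd.
have c'0 : c' != 0 by case: hc => [|[]//] /gt_eqF->.
have d'0 : d' != 0 by case: hd => [|[]//] /gt_eqF->.
have pE r : c' *: p = r -> p = c'^-1 *: r by move=> <-; rewrite scalerA mulVf // scale1r.
case=> [/pE->|[hk [_ /eqP]]].
  exists (c'^-1 * d'); last by rewrite scalerA.
  case: hc => [c1|[hk _]]; last by right; rewrite mulf_neq0 // invr_eq0.
  case: hd => [d1|[hk _]]; last by right; rewrite mulf_neq0 // invr_eq0.
  by left; rewrite mulr_gt0 // invr_gt0.
rewrite eq_sym eqr_oppLR -scaleNr => /eqP/pE->.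
exists (c'^-1 * - d'); last by rewrite scalerA.
by right; rewrite mulf_neq0 ?invr_eq0 ?oppr_eq0.
Qed.

Lemma quo_within (A : set K) (f : K -> 'rV[K]_3) :
  {within A, continuous f} -> (forall t, A t -> holed_sphere k (f t)) ->
  {within A, continuous (fun t => quo (f t))}.
Proof.
move=> cf hf.
have cS : {within A, continuous (fun t => surface_pt (f t))}.
  apply: (@continuous_comp_initial _ (subspace A) _ (set_val : holed_sphere (K := K) k -> 'rV[K]_3)).
  apply: subspace_eq_continuous cf => t /set_mem At.
  by rewrite /= -[LHS](surface_ptK (hf t At)).
have pc : continuous (fun a : holed_sphere (K := K) k => \pi_({eq_quot (@crosscap_equiv K k)}) a : X).
  exact: pi_continuous.
move=> t; exact: (@continuous_comp (subspace A) (holed_sphere (K := K) k) X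
  (fun t => surface_pt (f t)) (fun a => \pi_({eq_quot (@crosscap_equiv K k)}) a : X) t (cS t) (pc _)).
Qed.

Definition comb p q (t : K) : 'rV[K]_3 := (1 - t) *: p + t *: q.

Lemma comb_continuous p q : continuous (comb p q).
Proof.
move=> t; apply: cvgD; apply: cvgZ; [|exact: cvg_cst| |exact: cvg_cst].
  by apply: cvgB; [exact: cvg_cst | exact: cvg_id].
exact: cvg_id.
Qed.

Lemma comb_coord p q t j : comb p q t 0 j = (1 - t) * p 0 j + t * q 0 j.
Proof. by rewrite !mxE. Qed.

Lemma coord_comb_continuous p q j : continuous (fun t => comb p q t 0 j).
Proof.
move=> t; apply: (@continuous_comp _ _ _ (comb p q) (fun v : 'rV[K]_3 => v 0 j)).
  exact: comb_continuous.
exact: coord_continuous.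
Qed.

Lemma unit_comb_continuous p q t : comb p q t != 0 ->
  {for t, continuous (fun s => unit_of (comb p q s))}.
Proof.
move=> n0; apply: cvgZ; last exact: comb_continuous.
apply: cvgV; first by rewrite gt_eqF // norm_gt0.
apply: (@continuous_comp _ _ _ (fun s => dot3 (comb p q s) (comb p q s)) Num.sqrt); last exact: sqrt_continuous.
have c := @coord_comb_continuous p q.
by apply: cvgD; [apply: cvgD|]; apply: cvgM; exact: c.
Qed.

(** On the sphere this is clear.  With a crosscap, the representative jumps where the first
coordinate changes its sign, but at these places the two choices are identified; the
interval is therefore covered by the two closed sets on which the first coordinate has
a constant sign. *)
Lemma rho_segment p q : (forall t, 0 <= t <= 1 -> comb p q t != 0) ->
  {within `[0, 1], continuous (fun t => rho (comb p q t))}.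
Proof.
move=> n0.
pose A1 := [set t : K | 0 <= t <= 1 /\ comb p q t 0 0 <= 0].
pose A2 := [set t : K | 0 <= t <= 1 /\ 0 <= comb p q t 0 0].
have itvE : `[0, 1] = [set t : K | 0 <= t <= 1].
  by apply/seteqP; split => t /=; rewrite in_itv.
have c01 : topology_structure.closed [set t : K | 0 <= t <= 1] by rewrite -itvE; exact: itv_closed.
have /continuous_closedP cc : continuous (fun t => comb p q t 0 0) by exact: coord_comb_continuous.
have cA1 : topology_structure.closed A1 := closedI c01 (cc _ (@closed_le _ 0)).
have cA2 : topology_structure.closed A2 := closedI c01 (cc _ (@closed_ge _ 0)).
have wc (A : set K) : A `<=` [set t : K | 0 <= t <= 1] -> {within A, continuous (fun s => unit_of (comb p q s))}.
  by move=> A01; apply: continuous_in_subspaceT => t /set_mem/A01 h; apply: unit_comb_continuous; exact: n0.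
have wcN (A : set K) : A `<=` [set t : K | 0 <= t <= 1] -> {within A, continuous (fun s => - unit_of (comb p q s))}.
  move=> A01; apply: continuous_in_subspaceT => t /set_mem/A01 h.
  by apply: cvgN; apply: unit_comb_continuous; exact: n0.
have [hk|hk] : k \/ ~~ k by apply/orP; rewrite orbN.
  have -> : `[0, 1] = A1 `|` A2.
    rewrite itvE; apply/seteqP; split => t /=; last by case=> -[].
    by move=> t01; case: (leP (comb p q t 0 0) 0) => h; [left | right; split => //; exact: ltW].
  apply: withinU_continuous => //.
    have -> : (fun t => rho (comb p q t)) = (fun t => rho (comb p q t)) by [].
    apply: subspace_eq_continuous (quo_within (wc A1 _) _) => [t /set_mem[t01 le0]||].
    - by change (quo (unit_of (comb p q t)) = rho (comb p q t)); rewrite /rho /rep ltNge le0 andbF.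
    - by move=> t [].
    - move=> t [t01 le0]; have := rep_holed (n0 t t01); by rewrite /rep ltNge le0 andbF.
  have hN t : A2 t -> holed_sphere k (- unit_of (comb p q t)).
    move=> [t01 ge0]; have [u1 _] := rep_holed (n0 t t01); split.
      by rewrite dotE -scaleN1r dot3Z mulrNN !mul1r unit_of_unit ?n0.
    by move=> i; rewrite cap_centerE cap_height_k // /unit_of !mxE oppr_le0 -comb_coord mulr_ge0 ?invr_ge0 ?sqrtr_ge0.
  apply: subspace_eq_continuous (quo_within (wcN A2 _) hN) => [t /set_mem At|]; last by move=> t [].
  change (quo (- unit_of (comb p q t)) = rho (comb p q t)).
  have [t01 ge0] := At.
  have rE : rep (comb p q t) = if 0 < comb p q t 0 0 then - unit_of (comb p q t) else unit_of (comb p q t).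
    by rewrite /rep hk.
  rewrite /rho rE; case: ltP => // le0.
  apply/quo_eq; [exact: hN | by have := rep_holed (n0 t t01); rewrite /rep ltNge le0 andbF |].
  right; split => //; have e0' : comb p q t 0 0 = 0 by apply/eqP; rewrite eq_le le0.
  by split; rewrite ?opprK // /unit_of !mxE -!comb_coord e0' mulr0 oppr0.
apply: quo_within.
  rewrite itvE; apply: subspace_eq_continuous (wc _ (@subset_refl _ _)) => t _.
  change (unit_of (comb p q t) = rep (comb p q t)); by rewrite /rep (negbTE hk).
by move=> t; rewrite itvE => /n0/rep_holed.
Qed.
End Normalize.

(** * Drawings by geodesic segments *)
Section Geodesic.
Local Open Scope classical_set_scope.
Variables (K : realType) (k : bool) (V : finType) (e : rel V) (w : V -> 'rV[K]_3)
  (sg : V -> V -> bool).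
Notation X := (crosscap_sphere K k).

(** An edge with [sg x y] passes through the crosscap: it runs to the antipode of [w y]. *)
Definition far x y : 'rV[K]_3 := if sg x y then - w y else w y.

Definition point_on x y t := comb (w x) (far x y) t.

(** Everything is required in [K^3] up to [parallel], that is before projecting to the
surface. *)
Record geodesic_drawing : Prop := GeodesicDrawing {
  gd_sign : forall x y, sg x y -> k;
  gd_irr : forall x, ~~ e x x;
  gd_free : forall x y a b, e x y -> a *: w x + b *: w y = 0 -> a = 0 /\ b = 0;
  gd_neq0 : forall x, w x != 0;
  gd_vertices : forall x y, x != y -> ~ parallel k (w x) (w y);
  gd_vertex_edge : forall x y v t, e x y -> v != x -> v != y -> 0 <= t <= 1 ->
    ~ parallel k (w v) (point_on x y t);
  gd_edges : forall x y x' y' t s, e x y -> e x' y' -> [set x; y]%SET != [set x'; y']%SET ->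
    0 <= t <= 1 -> 0 <= s <= 1 -> parallel k (point_on x y t) (point_on x' y' s) ->
    exists2 v, v \in ([set x; y] :&: [set x'; y'])%SET & parallel k (point_on x y t) (w v)
}.

Hypothesis gd : geodesic_drawing.

Lemma farE x y : far x y = (-1) ^+ sg x y *: w y.
Proof. by rewrite /far; case: (sg x y); rewrite ?expr1 ?scaleN1r // expr0 scale1r. Qed.

Lemma rho_far x y : rho k (far x y) = rho k (w y).
Proof.
rewrite /far; case: (sg x y) (@gd_sign gd x y) => // /(_ isT) hk.
by rewrite -scaleN1r rhoZ ?(gd_neq0 gd) //; right; rewrite oppr_eq0 oner_eq0.
Qed.

Lemma point_on_neq0 x y t : e x y -> point_on x y t != 0.
Proof.
move=> exy; apply/eqP; rewrite /point_on /comb farE scalerA => /(gd_free gd exy)[/eqP].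
rewrite subr_eq0 => /eqP <- /eqP; rewrite mul1r signr_eq0 //.
Qed.

Lemma point_on_inj x y t s : e x y -> parallel k (point_on x y t) (point_on x y s) ->
  0 <= t <= 1 -> 0 <= s <= 1 -> t = s.
Proof.
move=> exy [c _ h] /andP[t0 t1] /andP[s0 s1].
have : ((1 - t) - c * (1 - s)) *: w x + ((t - c * s) * (-1) ^+ sg x y) *: w y = 0.
  apply/rowP => j; move/rowP: h => /(_ j); rewrite /point_on /comb farE !mxE.
  move: ((-1) ^+ sg x y) (w x 0 j) (w y 0 j) => u a b h.
  by transitivity ((1 - t) * a + t * (u * b) - c * ((1 - s) * a + s * (u * b))); [ring | rewrite h subrr].
move=> /(gd_free gd exy)[/eqP]; rewrite subr_eq0 => /eqP h1 /eqP.
rewrite mulf_eq0 signr_eq0 orbF subr_eq0 => /eqP h2.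
have c1 : c = 1 by rewrite -[c]mulr1 -{1}(subrK s 1) mulrDr -h1 -h2 subrK.
by rewrite h2 c1 mul1r.
Qed.

Definition drawn_pair (E : {set V}) : option (V * V) :=
  [pick xy : V * V | e xy.1 xy.2 && (E == [set xy.1; xy.2]%SET)].

Definition geo_arc (E : {set V}) (t : K) : X :=
  if drawn_pair E is Some xy then rho k (point_on xy.1 xy.2 t) else rho k 0.

Lemma drawn_pairP E : E \in edge_set e ->
  exists x y, [/\ e x y, E = [set x; y]%SET & forall t, geo_arc E t = rho k (point_on x y t)].
Proof.
move=> /imsetP[[x y]]; rewrite inE /= => exy EE.
rewrite /geo_arc /drawn_pair; case: pickP => [[x' y'] /= /andP[h /eqP ->]|/(_ (x, y))].
  by exists x', y'.
by rewrite /= exy EE eqxx.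
Qed.

Theorem geodesic_embeds : embeds K e X.
Proof.
exists (fun v => rho k (w v)), geo_arc; split.
- move=> x y /(rho_parallel (gd_neq0 gd x) (gd_neq0 gd y)) h.
  by apply/eqP/negP => /negP xy; case: (gd_vertices gd xy).
- move=> E /drawn_pairP[x [y [exy -> aE]]].
  have -> : geo_arc [set x; y]%SET = (fun t => rho k (point_on x y t)) by apply/funext.
  split.
  + by apply: rho_segment => t _; exact: point_on_neq0.
  + move=> t s; rewrite !in01 => t01 s01 /(rho_parallel (point_on_neq0 _ exy) (point_on_neq0 _ exy)) h.
    exact: (point_on_inj exy h).
  + have -> : point_on x y 0 = w x by rewrite /point_on /comb subr0 scale1r scale0r addr0.
    have -> : point_on x y 1 = far x y by rewrite /point_on /comb subrr scale1r scale0r add0r.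
    rewrite rho_far; apply/seteqP; split => z /=.
      by move=> [->|->]; [exists x | exists y] => //=; rewrite !inE eqxx ?orbT.
    by move=> [v + <-] /=; rewrite !inE => /orP[]/eqP->; [left|right].
- move=> E v t /drawn_pairP[x [y [exy -> aE]]]; rewrite in01 aE => t01 h.
  rewrite !inE; apply/negPn/negP; rewrite negb_or => /andP[vx vy].
  apply: (gd_vertex_edge gd exy vx vy t01); apply: rho_parallel (esym h) => //.
    exact: (gd_neq0 gd).
  exact: point_on_neq0.
- move=> E F t s /drawn_pairP[x [y [exy -> aE]]] /drawn_pairP[x' [y' [exy' -> aF]]] EF.
  rewrite !in01 aE aF => t01 s01 /(rho_parallel (point_on_neq0 _ exy) (point_on_neq0 _ exy')) h.
  have [v vv [c c0 hc]] := gd_edges gd exy exy' EF t01 s01 h.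
  exists v => //; rewrite hc; apply: rhoZ c0; exact: (gd_neq0 gd).
Qed.
End Geodesic.

Section Criterion.
Local Open Scope classical_set_scope.
Variables (K : realType) (k : bool) (N : nat) (L : seq (nat * nat)) (w : nat -> 'rV[K]_3) (sg : nat -> nat -> bool).

(** The ends of one of the segments, after the twist by [sg], are on the same side of the
plane of the other one. *)
Definition same_side (x y a b : nat) : Prop :=
  0 < (-1) ^+ sg x y * det3 (w x) (w a) (w b) * det3 (w y) (w a) (w b) \/
  0 < (-1) ^+ sg a b * det3 (w x) (w y) (w a) * det3 (w x) (w y) (w b).

Hypothesis sgk : forall x y, sg x y -> k.
Hypothesis sgC : forall x y, sg x y = sg y x.
Hypothesis LN : all (fun uv => uv.1 < uv.2 < N)%N L.
Hypothesis gen : forall a b c, (a < b < c)%N -> (c < N)%N -> det3 (w a) (w b) (w c) != 0.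
Hypothesis N2 : (2 < N)%N.
Hypothesis sep : forall uv ab, uv \in L -> ab \in L -> uniq [:: uv.1; uv.2; ab.1; ab.2] ->
  same_side uv.1 uv.2 ab.1 ab.2.

Lemma gen3 a b c : (a < N)%N -> (b < N)%N -> (c < N)%N -> uniq [:: a; b; c] -> det3 (w a) (w b) (w c) != 0.
Proof.
move=> aN bN cN; rewrite /= !inE negb_or andbT => /andP[/andP[ab ac] bc].
have [ab'|ab'|ab'] := ltngtP a b; last by rewrite ab' eqxx in ab.
  have [bc'|bc'|bc'] := ltngtP b c; last by rewrite bc' eqxx in bc.
    by apply: gen => //; rewrite ab' bc'.
  have [ac'|ac'|ac'] := ltngtP a c; last by rewrite ac' eqxx in ac.
    by rewrite -oppr_eq0 -det3C2 gen // ac' bc'.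
  by rewrite -det3R -det3R gen // ac' ab'.
have [bc'|bc'|bc'] := ltngtP b c; last by rewrite bc' eqxx in bc.
  have [ac'|ac'|ac'] := ltngtP a c; last by rewrite ac' eqxx in ac.
    by rewrite -oppr_eq0 -det3C1 gen // ac' ab'.
  by rewrite -det3R gen // ac' bc'.
by rewrite -oppr_eq0 -det3C1 -det3R -det3R gen // bc' ab'.
Qed.

Lemma same_sideC x y a b : same_side x y a b -> same_side y x a b.
Proof.
rewrite /same_side (sgC y x) (det3C1 (w x) (w y) (w a)) (det3C1 (w x) (w y) (w b)).
by rewrite !mulrN mulNr opprK; case=> h; [left; rewrite mulrAC | right].
Qed.

Lemma same_sideS x y a b : same_side x y a b -> same_side a b x y.
Proof.
rewrite /same_side (det3R (w a) (w x) (w y)) (det3R (w b) (w x) (w y)).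
by rewrite (det3R (w x) (w a) (w b)) (det3R (w y) (w a) (w b)); case; [right|left].
Qed.

Lemma convex_neq0 (s t D1 D2 : K) : 0 < s * D1 * D2 -> 0 <= t <= 1 -> (1 - t) * D1 + t * (s * D2) != 0.
Proof.
move=> h /andP[t0 t1]; apply/eqP => e0.
have D10 : D1 != 0 by apply: contraTneq h => ->; rewrite mulr0 mul0r ltxx.
have D1sq : 0 < D1 * D1 by rewrite -expr2 lt_neqAle eq_sym sqrf_eq0 D10 sqr_ge0.
have : (1 - t) * (D1 * D1) + t * (s * D1 * D2) = 0.
  by rewrite -(mulr0 D1) -e0; ring.
apply/eqP; rewrite gt_eqF //.
have [t0'|t0'] := ltP 0 t; last first.
  have -> : t = 0 by apply/eqP; rewrite eq_le t0 t0'.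
  by rewrite subr0 mul1r mul0r addr0.
by apply: ltr_wpDl; [apply: mulr_ge0; [rewrite subr_ge0 | exact: ltW] | exact: mulr_gt0].
Qed.

Let W (v : 'I_N) := w v.
Let S (x y : 'I_N) := sg x y.

Lemma pattern_up (x y : 'I_N) : pattern L x y -> exists2 uv, uv \in L &
  (uv.1 = x /\ uv.2 = y) \/ (uv.1 = y /\ uv.2 = x).
Proof. by move=> /orP[h|h]; [exists (val x, val y) | exists (val y, val x)] => //; [left|right]. Qed.

Lemma pattern_neq (x y : 'I_N) : pattern L x y -> x != y.
Proof.
move=> /pattern_up[uv uvL h]; apply/eqP => xy; have /andP[+ _] := allP LN uv uvL.
by case: h => -[-> ->]; rewrite xy ltnn.
Qed.

Lemma gen_ord (a b c : 'I_N) : uniq [:: a; b; c] -> det3 (W a) (W b) (W c) != 0.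
Proof.
move=> u; apply: gen3 => //; by rewrite -[X in uniq X]/(map val [:: a; b; c]) (map_inj_uniq val_inj).
Qed.

Lemma sep_ord (x y a b : 'I_N) : pattern L x y -> pattern L a b -> uniq [:: x; y; a; b] ->
  same_side x y a b.
Proof.
move=> /pattern_up[uv uvL h] /pattern_up[ab abL h'] u.
have u' : uniq [:: val x; val y; val a; val b].
  by rewrite -[X in uniq X]/(map val [:: x; y; a; b]) (map_inj_uniq val_inj).
have := sep uvL abL.
have pe : perm_eq [:: val x; val y; val a; val b] [:: uv.1; uv.2; ab.1; ab.2].
  case: h h' => -[-> ->] [] [-> ->] //; rewrite /=.
  - by apply/seq.permP => f /=; rewrite (addnCA (f (val a))).
  - by apply/seq.permP => f /=; rewrite (addnCA (f (val x))).
  - by apply/seq.permP => f /=; rewrite (addnCA (f (val a))) (addnCA (f (val x))).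
rewrite -(perm_uniq pe) => /(_ u'); case: h h' => -[-> ->] [] [-> ->] // h.
- by apply: same_sideS; apply: same_sideC; apply: same_sideS.
- exact: same_sideC.
- by apply: same_sideC; apply: same_sideS; apply: same_sideC; apply: same_sideS.
Qed.

Lemma third_vertex (x y : 'I_N) : exists z : 'I_N, z != x /\ z != y.
Proof.
have [z _ zP] : exists2 z, z \in 'I_N & z \notin [set x; y]%SET.
  apply/subsetPn; apply/negP => /subset_leq_card; rewrite card_ord => /leq_trans/(_ (_ : _ <= 2)%N).
  by rewrite cards2; case: (x != y) => /(_ isT); rewrite leqNgt N2.
by exists z; move: zP; rewrite !inE negb_or => /andP[].
Qed.

Lemma det_lin1 p q r u (a b : K) : det3 (a *: p + b *: q) r u = a * det3 p r u + b * det3 q r u.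
Proof. by rewrite /det3 !mxE; ring. Qed.
Lemma det_lin2 p q r u (a b : K) : det3 r (a *: p + b *: q) u = a * det3 r p u + b * det3 r q u.
Proof. by rewrite /det3 !mxE; ring. Qed.
Lemma det_lin3 p q r u (a b : K) : det3 r u (a *: p + b *: q) = a * det3 r u p + b * det3 r u q.
Proof. by rewrite /det3 !mxE; ring. Qed.
Lemma det_Z1 p r u (a : K) : det3 (a *: p) r u = a * det3 p r u.
Proof. by rewrite /det3 !mxE; ring. Qed.
Lemma det_Z3 p r u (a : K) : det3 r u (a *: p) = a * det3 r u p.
Proof. by rewrite /det3 !mxE; ring. Qed.
Lemma det_eq12 (p r : 'rV[K]_3) : det3 p p r = 0.
Proof. by rewrite /det3; ring. Qed.
Lemma det_eq13 (p r : 'rV[K]_3) : det3 p r p = 0.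
Proof. by rewrite /det3; ring. Qed.
Lemma det_eq23 (p r : 'rV[K]_3) : det3 r p p = 0.
Proof. by rewrite /det3; ring. Qed.

Lemma point_onE x y t : point_on W S x y t = (1 - t) *: W x + (t * (-1) ^+ S x y) *: W y.
Proof. by rewrite /point_on /comb farE scalerA. Qed.

Lemma free_pair (x y : 'I_N) a b : x != y -> a *: W x + b *: W y = 0 -> a = 0 /\ b = 0.
Proof.
move=> xy h; have [z [zx zy]] := third_vertex x y.
have u : det3 (W x) (W y) (W z) != 0.
  by apply: gen_ord; rewrite /= !inE negb_or xy ![_ == z]eq_sym zx zy.
have d0 r s : det3 (0 : 'rV[K]_3) r s = 0 by rewrite /det3 !mxE; ring.
split; apply/eqP.
  have := congr1 (fun v => det3 v (W y) (W z)) h; rewrite det_lin1 det_eq12 mulr0 addr0 d0.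
  by move=> /eqP; rewrite mulf_eq0 (negbTE u) orbF.
have := congr1 (fun v => det3 v (W x) (W z)) h; rewrite det_lin1 det_eq12 mulr0 add0r d0 det3C1 mulrN.
by move=> /eqP; rewrite oppr_eq0 mulf_eq0 (negbTE u) orbF.
Qed.

(** Edges [u v] and [u v'] only meet on the line of [u], as [u, v, v'] are independent. *)
Lemma common_end (u v v' : 'I_N) a b c d : uniq [:: u; v; v'] ->
  a *: W u + b *: W v = c *: W u + d *: W v' -> b = 0.
Proof.
move=> /gen_ord g h; have := congr1 (fun z => det3 (W u) z (W v')) h.
rewrite !det_lin2 !det_eq12 det_eq23 !mulr0 add0r addr0 => /eqP.
by rewrite mulf_eq0 (negbTE g) orbF => /eqP.
Qed.

(** In general position, vertices and edges with a common end cannot interfere.  For disjoint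
edges, one edge is on one side of the plane of the other. *)
Theorem generic_drawing :
  @geodesic_drawing K k _ (@pattern L N) W S.
Proof.
have sgn0 x y : (-1) ^+ S x y != 0 :> K by rewrite signr_eq0.
split.
- by move=> x y; apply: sgk.
- by move=> x; apply/negP => /pattern_neq; rewrite eqxx.
- by move=> x y a b /pattern_neq; exact: free_pair.
- move=> x; have [y [yx _]] := third_vertex x x; apply/eqP => h.
  have xy : x != y by rewrite eq_sym.
  have [|/eqP] := @free_pair x y 1 0 xy; first by rewrite scale1r scale0r addr0; exact: h.
  by rewrite oner_eq0.
- move=> x y xy [c _ h]; have [|/eqP] := @free_pair x y 1 (- c) xy.
    by rewrite scale1r scaleNr; apply/eqP; rewrite subr_eq0; apply/eqP; exact: h.
  by rewrite oner_eq0.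
- move=> x y v t /pattern_neq xy vx vy t01 [c hc h].
  have c0 : c != 0 by case: hc => [|[]//] /gt_eqF->.
  have g : det3 (W v) (W x) (W y) != 0 by apply: gen_ord; rewrite /= !inE negb_or vx vy xy.
  have {}h : W v = c *: point_on W S x y t by exact: h.
  move: g; rewrite h point_onE det_Z1 det_lin1 det_eq12 det_eq13 !mulr0 addr0 mulr0 eqxx //.
move=> x y x' y' t s exy exy' EF t01 s01 [c hc h].
have c0 : c != 0 by case: hc => [|[]//] /gt_eqF->.
have nxy := pattern_neq exy; have nxy' := pattern_neq exy'.
have atx : t = 0 -> parallel k (point_on W S x y t) (W x).
  by move=> ->; exists 1; [left | rewrite point_onE subr0 mul0r scale0r addr0].
have aty : t = 1 -> parallel k (point_on W S x y t) (W y).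
  move=> ->; exists ((-1) ^+ S x y); last by rewrite point_onE subrr scale0r mul1r add0r.
  have := @sgk x y; rewrite -/(S x y); case: (S x y) => hk; last by left; rewrite expr0.
  by right; split; [exact: hk | rewrite signr_eq0].
rewrite !point_onE scalerDr !scalerA in h.
have [xx'|xx'] := eqVneq x x'.
  have yy' : y != y' by apply: contra_neq EF => yy'; rewrite xx' yy'.
  subst x'; have /common_end/(_ h) : uniq [:: x; y; y'] by rewrite /= !inE negb_or nxy nxy' yy'.
  move/eqP; rewrite mulf_eq0 (negbTE (sgn0 _ _)) orbF => /eqP/atx pa.
  by exists x; [rewrite !inE eqxx ?orbT | exact: pa].
have [xy'|xy'] := eqVneq x y'.
  subst y'; have yx' : y != x' by apply: contra_neq EF => ->; rewrite setUC.
  rewrite [RHS]addrC in h; have /common_end/(_ h) : uniq [:: x; y; x'] by rewrite /= !inE negb_or nxy xx' yx'.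
  move/eqP; rewrite mulf_eq0 (negbTE (sgn0 _ _)) orbF => /eqP/atx pa.
  by exists x; [rewrite !inE eqxx ?orbT | exact: pa].
have [yx'|yx'] := eqVneq y x'.
  subst x'; rewrite addrC in h; have /common_end/(_ h) : uniq [:: y; x; y'] by rewrite /= !inE negb_or eq_sym nxy nxy' xy'.
  move/eqP; rewrite subr_eq0 => /eqP/esym/aty pa.
  by exists y; [rewrite !inE eqxx ?orbT | exact: pa].
have [yy'|yy'] := eqVneq y y'.
  subst y'; rewrite addrC [RHS]addrC in h; have /common_end/(_ h) : uniq [:: y; x; x'] by rewrite /= !inE negb_or eq_sym nxy yx' xx'.
  move/eqP; rewrite subr_eq0 => /eqP/esym/aty pa.
  by exists y; [rewrite !inE eqxx ?orbT | exact: pa].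
have u : uniq [:: x; y; x'; y'] by rewrite /= !inE !negb_or nxy xx' xy' yx' yy' nxy'.
exfalso; case: (sep_ord exy exy' u) => hs.
  have := convex_neq0 hs t01; rewrite mulrA -(det_lin1 (W x) (W y)) h.
  by rewrite det_lin1 det_eq12 det_eq13 !mulr0 addr0 eqxx.
have := convex_neq0 hs s01; rewrite mulrA -(det_lin3 (W x') (W y')) => hd.
have : c * det3 (W x) (W y) ((1 - s) *: W x' + (s * (-1) ^+ sg x' y') *: W y') != 0 by rewrite mulf_neq0.
rewrite -det_Z3 scalerDr !scalerA -h det_lin3 det_eq13 det_eq23 !mulr0 addr0 eqxx //.
Qed.
End Criterion.

(** * Drawings given by integer points, and disjoint copies *)
Section Tables.
Variables (N : nat) (L : seq (nat * nat)) (pos : seq (int * int * int)) (neg : seq (nat * nat)).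

Definition coord (v : nat) := nth (0, 0, 0) pos v.

Definition idet (a b c : nat) : int :=
  let: (p0, p1, p2) := coord a in let: (q0, q1, q2) := coord b in let: (r0, r1, r2) := coord c in
  p0 * (q1 * r2 - q2 * r1) - p1 * (q0 * r2 - q2 * r0) + p2 * (q0 * r1 - q1 * r0).

Definition flip (x y : nat) := ((x, y) \in neg) || ((y, x) \in neg).

(** The conditions of [generic_drawing] for integer points, in a form that can be
evaluated. *)
Definition straight_check :=
  [&& (2 < N)%N, all (fun uv => uv.1 < uv.2 < N)%N L,
   all (fun c => all (fun b => all (fun a => idet a b c != 0) (iota 0 b)) (iota 0 c)) (iota 0 N)
   & all (fun uv => all (fun ab => uniq [:: uv.1; uv.2; ab.1; ab.2] ==>
       let: (u, v, a, b) := (uv.1, uv.2, ab.1, ab.2) in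
       [|| [&& idet u a b != 0, idet v a b != 0 & flip u v == ((idet u a b < 0) (+) (idet v a b < 0))]
         | [&& idet u v a != 0, idet u v b != 0 & flip a b == ((idet u v a < 0) (+) (idet u v b < 0))]]) L) L].

Variable K : realType.

Definition place (v : nat) : 'rV[K]_3 :=
  let: (p0, p1, p2) := coord v in \row_j [:: p0%:~R; p1%:~R; p2%:~R]`_j.

Lemma det3_place a b c : det3 (place a) (place b) (place c) = (idet a b c)%:~R.
Proof.
rewrite /place /idet; case: (coord a) => -[p0 p1] p2; case: (coord b) => -[q0 q1] q2.
case: (coord c) => -[r0 r1] r2; rewrite /det3 !mxE /=.
by rewrite !(rmorphD, rmorphN, rmorphM).
Qed.

Lemma flipC x y : flip x y = flip y x.
Proof. by rewrite /flip orbC. Qed.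

Theorem table_drawing (k : bool) : straight_check -> (neg != [::] -> k) ->
  @geodesic_drawing K k _ (@pattern L N) (fun v => place v) (fun x y => flip x y).
Proof.
move=> /and4P[N2 LN gen sep] hk; apply: generic_drawing => //.
- move=> x y; rewrite /flip => h; apply: hk; apply: contraTneq h => ->.
  by rewrite !in_nil.
- exact: flipC.
- move=> a b c /andP[ab bc] cN; rewrite det3_place intr_eq0.
  have := allP gen c; rewrite mem_iota cN => /(_ isT)/allP/(_ b).
  by rewrite mem_iota bc => /(_ isT)/allP/(_ a); rewrite mem_iota ab; apply.
- move=> uv ab uvL abL u; have := allP (allP sep uv uvL) ab abL; rewrite u /=.
  have pos2 (s : bool) (D1 D2 : int) : D1 != 0 -> D2 != 0 -> s == ((D1 < 0) (+) (D2 < 0)) ->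
     0 < (-1) ^+ s * D1%:~R * D2%:~R :> K.
    move=> d1 d2 /eqP sE; rewrite -mulrA -intrM.
    have D0 : D1 * D2 != 0 by rewrite mulf_neq0.
    have sE' : s = (D1 * D2 < 0).
      rewrite sE; case: (ltgtP D1 0) d1 => // h1 _; case: (ltgtP D2 0) d2 => // h2 _ /=; apply/esym.
      - by apply/negbTE; rewrite -leNgt ltW // nmulr_rgt0.
      - by rewrite nmulr_rlt0.
      - by rewrite pmulr_rlt0.
      - by apply/negbTE; rewrite -leNgt ltW // mulr_gt0.
    rewrite sE'; case: (ltgtP (D1 * D2) 0) D0 => // h _.
      by rewrite expr1 mulN1r oppr_gt0 ltrz0.
    by rewrite expr0 mul1r ltr0z.
  rewrite /same_side !det3_place => /orP[] /and3P[h1 h2 h3]; [left | right]; exact: pos2.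
Qed.
End Tables.

Section Copies.
Variables (K : realType) (N : nat) (L : seq (nat * nat)) (pos : seq (int * int * int)) (M : nat).
Hypothesis check : straight_check N L pos [::].
Hypothesis box : all (fun p : int * int * int => [&& p.1.1 == 1, 0 <= p.1.2 & p.1.2 < M%:Z]) pos.
Hypothesis size_pos : size pos = N.
Variables (V : finType) (e : rel V) (copy : V -> nat) (h : V -> 'I_N).
Hypothesis inj : forall x y, copy x = copy y -> h x = h y -> x = y.
Hypothesis hom : forall x y, e x y -> copy x = copy y /\ pattern L (h x) (h y).

Let gd := table_drawing K (k := false) check (fun h => match negP h isT with end).

Definition shear (i : nat) (p : 'rV[K]_3) : 'rV[K]_3 :=
  \row_j (p 0 j + (j == 1)%:R * (M * i)%:R * p 0 0).

Definition spot (v : V) := shear (copy v) (place pos K (h v)).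

Definition strip (i : nat) (p : 'rV[K]_3) :=
  p 0 0 = 1 /\ (M * i)%:R <= p 0 1 < (M * i + M)%:R.

Lemma place_strip (v : 'I_N) : strip 0 (place pos K v).
Proof.
have vs : (v < size pos)%N by rewrite size_pos.
have /and3P[] := allP box _ (mem_nth (0, 0, 0) vs).
rewrite /strip /place /coord; case: (nth _ _ _) => -[p0 p1] p2 /= /eqP -> h0 h1.
rewrite !mxE /= muln0 add0n; split => //.
by rewrite ler0z h0 -[M%:R]/(M%:Z%:~R) ltr_int.
Qed.

Lemma shear_strip i p : strip 0 p -> strip i (shear i p).
Proof.
rewrite /strip /shear !mxE /= muln0 add0n => -[-> /andP[p0 p1]].
rewrite !mul0r addr0 !mul1r mulr1; split => //; rewrite natrD.
by apply/andP; split; lra.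
Qed.

Lemma spot_strip v : strip (copy v) (spot v).
Proof. exact/shear_strip/place_strip. Qed.

Lemma comb_strip i p q t : strip i p -> strip i q -> 0 <= t <= 1 -> strip i (comb p q t).
Proof.
move=> [p0 /andP[p1 p1']] [q0 /andP[q1 q1']] /andP[t0 t1].
split; rewrite comb_coord ?p0 ?q0; first by ring.
move: (p 0 1) (q 0 1) (M * i)%:R (M * i + M)%:R p1 p1' q1 q1' => a b c d p1 p1' q1 q1'.
apply/andP; split.
  have : 0 <= (1 - t) * (a - c) by rewrite mulr_ge0 ?subr_ge0.
  have : 0 <= t * (b - c) by rewrite mulr_ge0 ?subr_ge0.
  lra.
have h1 : 0 <= (1 - t) * (d - a) by rewrite mulr_ge0 ?subr_ge0 // ltW.
have [t0'|t0'] := ltP 0 t.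
  have h2 : 0 < t * (d - b) by rewrite mulr_gt0 ?subr_gt0.
  lra.
have -> : t = 0 by apply/eqP; rewrite eq_le t0 t0'.
by rewrite subr0 mul1r mul0r addr0.
Qed.

Lemma strip_parallel i j p q : strip i p -> strip j q -> parallel false p q -> i = j.
Proof.
move=> [p0 /andP[p1 p1']] [q0 /andP[q1 q1']] [c [c0|[]//] pE].
have c1 : c = 1 by move: p0; rewrite pE mxE q0 mulr1.
have pq : p 0 1 = q 0 1 by rewrite pE c1 scale1r.
rewrite pq in p1 p1'.
have h1 := le_lt_trans p1 q1'; have h2 := le_lt_trans q1 p1'.
by move: h1 h2; rewrite !ltr_nat; nia.
Qed.

Lemma shear_comb i p q t : comb (shear i p) (shear i q) t = shear i (comb p q t).
Proof. by apply/rowP => j; rewrite !mxE; ring. Qed.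

Lemma shearZ i c p : shear i (c *: p) = c *: shear i p.
Proof. by apply/rowP => j; rewrite !mxE; ring. Qed.

Lemma shear_inj i : injective (shear i).
Proof.
move=> p q /rowP pq; have e0 : p 0 0 = q 0 0.
  by have := pq 0; rewrite !mxE /= !mul0r !addr0.
by apply/rowP => j; have := pq j; rewrite !mxE e0 => /addIr.
Qed.

Lemma shear_parallel i p q : parallel false (shear i p) (shear i q) -> parallel false p q.
Proof. by move=> [c hc]; rewrite -shearZ => /shear_inj; exists c. Qed.

Lemma e_neq x y : e x y -> h x != h y.
Proof. by move=> /hom[_ p]; apply/eqP => hh; have := gd_irr gd (h x); rewrite {2}hh p. Qed.

(** All points are in the plane where the first coordinate is 1, and the copies are in
disjoint parallel strips of this plane, obtained from the first one by shears.  Central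
projection is injective on this plane. *)
Theorem copies_drawing : @geodesic_drawing K false V e spot (fun _ _ => false).
Proof.
have pt x y t : e x y -> point_on spot (fun _ _ => false) x y t =
    shear (copy x) (point_on (fun v : 'I_N => place pos K v) (fun _ _ => false) (h x) (h y) t).
  by move=> /hom[cxy _]; rewrite /point_on /far /spot -cxy shear_comb.
have ps x y t : e x y -> 0 <= t <= 1 -> strip (copy x) (point_on spot (fun _ _ => false) x y t).
  move=> exy t01; rewrite pt //; apply: shear_strip; apply: comb_strip => //; exact: place_strip.
split => //.
- by move=> x; apply/negP => /e_neq; rewrite eqxx.
- move=> x y a b /hom[cxy p] hab; apply: (gd_free gd p); apply: (@shear_inj (copy x)).
  have -> : shear (copy x) 0 = 0 by apply/rowP => j; rewrite !mxE; ring.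
  rewrite -hab /spot -cxy -!shearZ; apply/rowP => j; rewrite !mxE; ring.
- move=> x; apply/eqP => h0; have [+ _] := spot_strip x; rewrite h0 mxE => /eqP.
  by rewrite eq_sym oner_eq0.
- move=> x y xy par; have cxy := strip_parallel (spot_strip x) (spot_strip y) par.
  have hxy : h x != h y by apply: contra_neq xy; exact: inj.
  by apply: (gd_vertices gd hxy); apply: (@shear_parallel (copy x)); rewrite {2}cxy.
- move=> x y v t exy vx vy t01 par.
  have cvx := strip_parallel (spot_strip v) (ps _ _ _ exy t01) par.
  have [cxy p] := hom exy.
  have hvx : h v != h x by apply: contra_neq vx; exact: inj.
  have hvy : h v != h y by apply: contra_neq vy; apply: inj; rewrite cvx.
  apply: (gd_vertex_edge gd p hvx hvy t01); apply: (@shear_parallel (copy x)).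
  by rewrite -pt // -{1}cvx.
move=> x y x' y' t s exy exy' EF t01 s01 par.
have cxx := strip_parallel (ps _ _ _ exy t01) (ps _ _ _ exy' s01) par.
have [cxy p] := hom exy; have [cxy' p'] := hom exy'.
have hs a b : copy a = copy x -> copy b = copy x -> (h a == h b) = (a == b).
  by move=> ca cb; apply/eqP/eqP => [|-> //]; apply: inj; rewrite ca cb.
have EF' : [set h x; h y]%SET != [set h x'; h y']%SET.
  apply: contra_neq EF => /setP EE; apply/setP => v; rewrite !inE.
  have tr (a b c d : V) : copy a = copy x -> copy b = copy x -> copy c = copy x -> copy d = copy x ->
     (forall w, (w \in [set h a; h b]%SET) = (w \in [set h c; h d]%SET)) -> (v == a) || (v == b) -> (v == c) || (v == d).
    move=> ca cb cc cd EE' /orP[]/eqP->; [have := EE' (h a) | have := EE' (h b)];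
      by rewrite !inE !hs // eqxx ?orbT => /esym.
  have cx' : copy x' = copy x by rewrite cxx.
  have cy : copy y = copy x by rewrite cxy.
  have cy' : copy y' = copy x by rewrite -cxy' cxx.
  by apply/idP/idP; apply: tr.
have cx' : copy x' = copy x by rewrite cxx.
have cy : copy y = copy x by rewrite cxy.
have cy' : copy y' = copy x by rewrite -cxy' cxx.
have [|v + par'] := gd_edges gd p p' EF' t01 s01.
  by apply: (@shear_parallel (copy x)); rewrite -pt // cxx -pt.
have par_shear i p1 q1 : parallel false p1 q1 -> parallel false (shear i p1) (shear i q1).
  by move=> [c c0 ->]; exists c; rewrite ?shearZ.
move: par' => /(par_shear (copy x)); rewrite -pt // !inE.
move=> /[swap] /andP[/orP[]/eqP-> hv] par'.
  exists x; last exact: par'.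
  by rewrite !inE eqxx /=; rewrite !hs // in hv.
exists y; last by rewrite /spot -cxy.
by rewrite !inE eqxx orbT /=; rewrite !hs // in hv.
Qed.

(** The graph is a disjoint union of subgraphs of one drawn graph: [copy] numbers the
components, and [h] gives the position of a vertex in its component. *)
Theorem copies_embed : embeds K e (crosscap_sphere K 0).
Proof. exact: (@geodesic_embeds K false V e spot _ copies_drawing). Qed.
End Copies.

(** * Graphs that embed *)
(** The unit graph of the square of the field with three elements, for
[S = {(1, -1), (-1, -1)}]; vertices are numbered by their two digits to the base 3. *)
Definition K333m : seq (nat * nat) := [:: (0, 4); (0, 5); (0, 7); (0, 8); (1, 3); (1, 5);
  (1, 6); (1, 8); (2, 3); (2, 4); (2, 6); (2, 7); (3, 4); (3, 5); (3, 7); (3, 8); (4, 5);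
  (4, 6); (4, 8); (5, 6); (5, 7); (6, 7); (6, 8); (7, 8)]%N.
(** Found by a computer search; the edges in [K333m_neg] pass through the crosscap. *)
Definition K333m_pos : seq (int * int * int) := [:: (3, 5, 0); ((- 2), 1, 5); (5, (- 3), 2);
  (1, (- 1), 6); ((- 2), 6, (- 1)); ((- 4), (- 4), 3); ((- 5), 3, 2); (5, 2, 3);
  ((- 1), 4, 4)].
Definition K333m_neg := [:: (0, 5); (2, 4); (2, 6); (3, 4); (4, 5); (5, 7); (6, 7)]%N.
Definition K5_pos : seq (int * int * int) := [:: ((- 3), 1, 2); ((- 1), 0, (- 3));
  ((- 3), 2, 3); ((- 2), (- 2), (- 3)); (3, (- 3), 2)].
Definition K5_neg := [:: (1, 4); (2, 3)]%N.

Lemma K333m_projective (K : realType) : embeds K (@pattern K333m 9) (crosscap_sphere K 1).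
Proof.
apply: (@geodesic_embeds K true _ _ _ _ (table_drawing K (pos := K333m_pos) (neg := K333m_neg) _ _)) => //.
Qed.

Lemma K5_projective (K : realType) : embeds K (@pattern K5 5) (crosscap_sphere K 1).
Proof.
apply: (@geodesic_embeds K true _ _ _ _ (table_drawing K (pos := K5_pos) (neg := K5_neg) _ _)) => //.
Qed.

Definition K4 : seq (nat * nat) := [:: (0, 1); (0, 2); (0, 3); (1, 2); (1, 3); (2, 3)]%N.
Definition K4_pos : seq (int * int * int) := [:: (1, 3, 0); (1, 0, 2); (1, 1, 1); (1, 0, 0)].
Lemma K4_planar (K : realType) (V : finType) (e : rel V) (copy : V -> nat) (h : V -> 'I_4) :
  (forall x y, copy x = copy y -> h x = h y -> x = y) ->
  (forall x y, e x y -> copy x = copy y /\ pattern K4 (h x) (h y)) ->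
  embeds K e (crosscap_sphere K 0).
Proof. by apply: (@copies_embed K _ _ K4_pos 4); vm_compute. Qed.

(** The complete bipartite graph on 3 + 3 vertices without the edge from 0 to 3. *)
Definition K33e : seq (nat * nat) := [:: (0, 4); (0, 5); (1, 3); (1, 4); (1, 5); (2, 3);
  (2, 4); (2, 5)]%N.
Definition K33e_pos : seq (int * int * int) := [:: (1, 1, 1); (1, 0, 3); (1, 3, 1); (1, 2, 3);
  (1, 2, 2); (1, 1, 0)].
Lemma K33e_planar (K : realType) (V : finType) (e : rel V) (copy : V -> nat) (h : V -> 'I_6) :
  (forall x y, copy x = copy y -> h x = h y -> x = y) ->
  (forall x y, e x y -> copy x = copy y /\ pattern K33e (h x) (h y)) ->
  embeds K e (crosscap_sphere K 0).
Proof. by apply: (@copies_embed K _ _ K33e_pos 4); vm_compute. Qed.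

(** The cube, as complete bipartite graph on 4 + 4 vertices without a perfect matching. *)
Definition Q3 : seq (nat * nat) := [:: (0, 5); (0, 6); (0, 7); (1, 4); (1, 6); (1, 7); (2, 4);
  (2, 5); (2, 7); (3, 4); (3, 5); (3, 6)]%N.
Definition Q3_pos : seq (int * int * int) := [:: (1, 0, 2); (1, 3, 1); (1, 4, 2); (1, 1, 3);
  (1, 2, 3); (1, 1, 4); (1, 2, 1); (1, 3, 0)].
Lemma Q3_planar (K : realType) (V : finType) (e : rel V) (copy : V -> nat) (h : V -> 'I_8) :
  (forall x y, copy x = copy y -> h x = h y -> x = y) ->
  (forall x y, e x y -> copy x = copy y /\ pattern Q3 (h x) (h y)) ->
  embeds K e (crosscap_sphere K 0).
Proof. by apply: (@copies_embed K _ _ Q3_pos 5); vm_compute. Qed.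

(** The unit graph of the field with five elements, for [S = {1}]. *)
Definition K5m : seq (nat * nat) := [:: (0, 1); (0, 2); (0, 3); (0, 4); (1, 2); (1, 3); (2, 4);
  (3, 4)]%N.
Definition K5m_pos : seq (int * int * int) := [:: (1, 1, 1); (1, 0, 3); (1, 2, 2); (1, 1, 0); (1, 2, 1)].
Lemma K5m_planar (K : realType) (V : finType) (e : rel V) (copy : V -> nat) (h : V -> 'I_5) :
  (forall x y, copy x = copy y -> h x = h y -> x = y) ->
  (forall x y, e x y -> copy x = copy y /\ pattern K5m (h x) (h y)) ->
  embeds K e (crosscap_sphere K 0).
Proof. by apply: (@copies_embed K _ _ K5m_pos 4); vm_compute. Qed.

(** The unit graph of the square of the field with three elements, for [S = {(1, 1)}]. *)
Definition Z33pp : seq (nat * nat) := [:: (0, 4); (0, 5); (0, 7); (0, 8); (1, 3); (1, 4);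
  (1, 6); (1, 7); (2, 3); (2, 5); (2, 6); (2, 8); (3, 4); (3, 5); (6, 7); (6, 8)]%N.
Definition Z33pp_pos : seq (int * int * int) := [:: (1, 1, 2); (1, 0, 6); (1, 4, 0); (1, 0, 1);
  (1, 2, 5); (1, 1, 1); (1, 6, 5); (1, 5, 4); (1, 4, 2)].
Lemma Z33pp_planar (K : realType) (V : finType) (e : rel V) (copy : V -> nat) (h : V -> 'I_9) :
  (forall x y, copy x = copy y -> h x = h y -> x = y) ->
  (forall x y, e x y -> copy x = copy y /\ pattern Z33pp (h x) (h y)) ->
  embeds K e (crosscap_sphere K 0).
Proof. by apply: (@copies_embed K _ _ Z33pp_pos 7); vm_compute. Qed.

(** The unit graph of the square of the field with three elements, for [S = {(1, -1)}]. *)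
Definition Z33pm : seq (nat * nat) := [:: (0, 4); (0, 5); (0, 7); (0, 8); (1, 3); (1, 5);
  (1, 6); (1, 8); (2, 3); (2, 4); (2, 6); (2, 7); (3, 4); (3, 5); (4, 5); (6, 7); (6, 8);
  (7, 8)]%N.
Definition Z33pm_pos : seq (int * int * int) := [:: (1, 6, 6); (1, 4, 3); (1, 0, 1); (1, 4, 4);
  (1, 1, 6); (1, 5, 4); (1, 3, 1); (1, 6, 0); (1, 5, 3)].
Lemma Z33pm_planar (K : realType) (V : finType) (e : rel V) (copy : V -> nat) (h : V -> 'I_9) :
  (forall x y, copy x = copy y -> h x = h y -> x = y) ->
  (forall x y, e x y -> copy x = copy y /\ pattern Z33pm (h x) (h y)) ->
  embeds K e (crosscap_sphere K 0).
Proof. by apply: (@copies_embed K _ _ Z33pm_pos 7); vm_compute. Qed.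

Section Graphs.
Variables (K : realType) (V : finType) (e : rel V).
Hypothesis e_sym : forall x y, e x y -> e y x.

Lemma pattern_hom N L (g : 'I_N -> V) (g' : nat -> V) : (forall i : 'I_N, g i = g' i) ->
  all (fun uv => e (g' uv.1) (g' uv.2)) L -> forall x y : 'I_N, pattern L x y -> e (g x) (g y).
Proof.
move=> gg /allP al x y; rewrite !gg => /orP[] /al //= h.
exact: e_sym.
Qed.

Lemma not_projective_sub N L zs (g : nat -> V) : certificate L N zs ->
  {in gtn N &, injective g} -> all (fun uv => e (g uv.1) (g uv.2)) L ->
  ~ embeds K e (crosscap_sphere K 1).
Proof.
move=> cert gi gL emb; apply: (not_projective (K := K) cert).
apply: (embeds_sub (g := fun i : 'I_N => g i)) emb.
  by move=> i j /gi ij; apply: val_inj; apply: ij; rewrite inE.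
exact: pattern_hom.
Qed.
End Graphs.

(** * Radical, idempotents and atoms of a finite ring *)
Section FiniteRing.
Variable R : finComUnitRingType.
Implicit Types x y z e d u j r : R.

(** The Jacobson radical. *)
Definition jac := [set x : R | [forall r : R, 1 + r * x \is a GRing.unit]].

Lemma jacP x : reflect (forall r, 1 + r * x \is a GRing.unit) (x \in jac).
Proof. by rewrite inE; apply: forallP. Qed.

Lemma jac0 : 0 \in jac.
Proof. by apply/jacP => r; rewrite mulr0 addr0 unitr1. Qed.

Lemma jacM r x : x \in jac -> r * x \in jac.
Proof. by move=> /jacP h; apply/jacP => t; rewrite mulrA. Qed.

Lemma jacN x : x \in jac -> - x \in jac.
Proof. by rewrite -mulN1r; exact: jacM. Qed.

Lemma jacD x y : x \in jac -> y \in jac -> x + y \in jac.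
Proof.
move=> /jacP hx /jacP hy; apply/jacP => r.
have -> : 1 + r * (x + y) = (1 + r * x) * (1 + ((1 + r * x)^-1 * r) * y).
  by rewrite [RHS]mulrDr mulr1 -[_ * r * y]mulrA mulVKr //; ring.
by rewrite unitrM hx hy.
Qed.

Lemma unitr_jac u j : u \is a GRing.unit -> j \in jac -> u + j \is a GRing.unit.
Proof.
move=> uu /jacP hj; have -> : u + j = u * (1 + u^-1 * j) by rewrite mulrDr mulr1 mulVKr.
by rewrite unitrM uu hj.
Qed.

Lemma jac_nonunit x : x \in jac -> x \isn't a GRing.unit.
Proof.
move=> /jacP/(_ (- x^-1)); apply: contraL => ux.
by rewrite mulNr mulVr // subrr unitr0.
Qed.

Lemma nilp_jac x n : x ^+ n = 0 -> x \in jac.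
Proof.
move=> xn; apply/jacP => r; apply/unitrP; exists (\sum_(i < n) (- (r * x)) ^+ i).
have E : (\sum_(i < n) (- (r * x)) ^+ i) * (1 + r * x) = 1.
  have := subrX1 (- (r * x)) n; rewrite exprNn exprMn xn !mulr0 sub0r => h.
  apply: oppr_inj; rewrite h; ring.
by split=> //; rewrite mulrC.
Qed.

(** The powers of [x] are eventually periodic, and an exponent which is a multiple of the
period and beyond the start of the periodic part gives an idempotent. *)
Lemma idem_power x : exists2 n, (0 < n)%N & x ^+ n * x ^+ n = x ^+ n.
Proof.
have [/injectiveP inj|] := boolP (injectiveb (fun i : 'I_#|R|.+1 => x ^+ i)).
  by have := leq_card _ inj; rewrite card_ord ltnn.
case/injectivePn => i0 [j0 ij0 xij0].
wlog ij : i0 j0 ij0 xij0 / (i0 < j0)%N => [hw|].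
  have [lt|lt|eq] := ltngtP i0 j0; first exact: hw lt.
    by apply: (hw j0 i0) => //; rewrite eq_sym.
  by move/eqP: ij0; case; apply: val_inj.
pose p := (j0 - i0)%N; pose i := nat_of_ord i0.
have p0 : (0 < p)%N by rewrite subn_gt0.
have step k : (i <= k)%N -> x ^+ (k + p) = x ^+ k.
  move=> ik; rewrite -(subnK ik) -addnA !exprD; congr (_ * _).
  by rewrite -exprD /p subnKC ?(ltnW ij) // -xij0.
have steps k m : (i <= k)%N -> x ^+ (k + m * p) = x ^+ k.
  move=> ik; elim: m => [|m IH]; first by rewrite mul0n addn0.
  by rewrite mulSn addnCA addnC step // (leq_trans ik) // leq_addr.
exists (i.+1 * p)%N; first by rewrite muln_gt0.
by rewrite -exprD steps // (leq_trans (leqnSn i)) // leq_pmulr.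
Qed.

(** The image of [d] in the factor of the ring that belongs to the idempotent [e] is
invertible. *)
Definition inv_in e d := exists d', e * d * d' = e.

Lemma inv_in_unit e d : d \is a GRing.unit -> inv_in e d.
Proof. by move=> u; exists d^-1; rewrite mulrK. Qed.

Lemma unit_split e d : e * e = e -> inv_in e d -> inv_in (1 - e) d -> d \is a GRing.unit.
Proof.
move=> ee [a ha] [b hb]; apply/unitrP; exists (e * a + (1 - e) * b).
have E : d * (e * a + (1 - e) * b) = 1.
  have -> : d * (e * a + (1 - e) * b) = e * d * a + (1 - e) * d * b by ring.
  by rewrite ha hb; ring.
by split=> //; rewrite mulrC.
Qed.

Lemma inv_inN e d : inv_in e d -> inv_in e (- d).
Proof. by move=> [a ha]; exists (- a); rewrite (mulrN e) mulrNN. Qed.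

Lemma inv_in_cancel e d x : inv_in e d -> e * (d * x) = 0 -> e * x = 0.
Proof.
move=> [a ha] h; rewrite -ha.
have -> : e * d * a * x = a * (e * (d * x)) by ring.
by rewrite h mulr0.
Qed.

(** Lagrange's theorem for the additive subgroup [A]. *)
Lemma mulrn_card (A : {set R}) x : 0 \in A -> {in A &, forall y z, y + z \in A} ->
  x \in A -> x *+ #|A| = 0.
Proof.
move=> A0 AD xA.
have gA : group_set A by apply/group_setP; split.
exact: (@expg_cardG _ (Group gA)).
Qed.

Section Reduced.
Hypothesis jac_triv : forall x, x \in jac -> x = 0.

(** A power of [x] is an idempotent [e], and [(1 - e) * x] is nilpotent, hence zero. *)
Lemma support_idem x : exists e, [/\ e * e = e, e * x = x, inv_in e x & x != 0 -> e != 0].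
Proof.
have [n n0 hn] := idem_power x; pose e := x ^+ n.
have ee : e * e = e by [].
have ex : e * x = x.
  have h : ((1 - e) * x) ^+ n = 0.
    have fk m : (0 < m)%N -> (1 - e) ^+ m = 1 - e.
      case: m => // m _; elim: m => [|m IH]; first by rewrite expr1.
      by rewrite exprS IH mulrBl mul1r mulrBr mulr1 ee subrr subr0.
    by rewrite exprMn fk // -/e mulrBl mul1r ee subrr.
  have := jac_triv (nilp_jac h); rewrite mulrBl mul1r => /eqP.
  by rewrite subr_eq0 eq_sym => /eqP.
exists e; split => //.
  exists (x ^+ n.-1 * e); rewrite mulrA -[e * x * _]mulrA -exprS prednK // -/e ee ee //.
by apply: contra_neq => e0; rewrite -ex e0 mul0r.
Qed.

(** A primitive idempotent whose corner [e R] is a field. *)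
Definition atom e := [/\ e * e = e, e != 0 & forall x, e * x != 0 -> inv_in e x].

Definition corner e := [set x : R | e * x == x].

Lemma cornerP e x : reflect (e * x = x) (x \in corner e).
Proof. by rewrite inE; apply: eqP. Qed.

Lemma corner_mul e x : e * e = e -> e * x \in corner e.
Proof. by move=> ee; apply/cornerP; rewrite mulrA ee. Qed.

(** If the corner of [d] is not a field, the support of a nonzero nonunit of the corner is an
idempotent with a smaller corner. *)
Lemma atom_below d : d * d = d -> d != 0 -> exists2 e, atom e & d * e = e.
Proof.
move: {2}#|corner d|.+1 (ltnSn #|corner d|) => m; elim: m d => [//|m IH] d hm dd d0.
have [/forallP hd|] := boolP [forall x, (d * x != 0) ==> [exists a, d * x * a == d]].
  exists d => //; split => // x dx; have /implyP/(_ dx)/existsP[a /eqP ha] := hd x.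
  by exists a.
rewrite negb_forall => /existsP[x]; rewrite negb_imply => /andP[dx nx].
have [e [ee ex [a ha] e0]] := support_idem (d * x).
have de : d * e = e.
  rewrite -{1}ha (_ : d * (e * (d * x) * a) = e * ((d * d) * x) * a); first by rewrite dd ha.
  by ring.
have ne : e != d.
  apply: contraNneq nx => ed; apply/existsP; exists a.
  by rewrite -ed -{2}ha ed mulrA dd.
have sub : corner e \proper corner d.
  apply/properP; split.
    by apply/subsetP => y /cornerP ey; apply/cornerP; rewrite -ey mulrA de.
  exists d; first by apply/cornerP.
  by apply/cornerP; rewrite mulrC de => /eqP; apply/negP.
have lt : (#|corner e| < m)%N by rewrite -ltnS (leq_trans _ hm) // ltnS proper_card.
have [e' at' ee'] := IH e lt ee (e0 dx).
by exists e' => //; rewrite -ee' mulrA de.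
Qed.

Lemma atom_unit e x : atom e -> x \is a GRing.unit -> e * x != 0.
Proof.
move=> [_ e0 _] ux; apply: contra_neq e0 => h.
by rewrite -[e](mulrK ux) h mul0r.
Qed.

Lemma atoms_orthogonal e e' : atom e -> atom e' -> e != e' -> e * e' = 0.
Proof.
move=> [ee e0 he] [ee' e0' he'] ne; apply/eqP; apply: contraNT ne => n0.
have [a ha] := he _ n0; have [b hb] : inv_in e' e by apply: he'; rewrite mulrC.
have e1 : e' * e = e.
  rewrite -{1}ha (_ : e' * (e * e' * a) = e * (e' * e') * a); first by rewrite ee' ha.
  by ring.
rewrite -e1 -{1}hb (_ : e' * e * b * e = e' * (e * e) * b); first by rewrite ee hb.
by ring.
Qed.

(** The product of the corners of all atoms is the whole ring. *)
Lemma no_atoms_zero x : (forall e, atom e -> e * x = 0) -> x = 0.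
Proof.
move=> h; apply/eqP/negPn/negP => x0.
have [d [dd dx [a ha] d0]] := support_idem x.
have [e at_e de] := atom_below dd (d0 x0).
have [_ e0 _] := at_e; move/eqP: e0; apply.
rewrite -de -ha; have := h e at_e => ex.
have -> : d * x * a * e = d * a * (e * x) by ring.
by rewrite ex mulr0.
Qed.

Lemma atom_cancel e x y : atom e -> e * x != 0 -> e * (x * y) = 0 -> e * y = 0.
Proof. by move=> [_ _ h] /h/inv_in_cancel; apply. Qed.

End Reduced.
End FiniteRing.

(** * Bipartite obstructions in a unit graph *)
Section Cayley.
Variables (K : realType) (R : finComUnitRingType) (S : {set R}).
Hypothesis S_unit : {in S, forall s, s \is a GRing.unit}.
Hypothesis S_inv : {in S, forall s, s^-1 \in S}.
Local Notation embeds_in k := (embeds K (Gamma S) (crosscap_sphere K k)).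
Implicit Types (x y s e : R).

Lemma Gamma_adj x y s : s \in S -> x != y -> x + s * y \is a GRing.unit -> Gamma S x y.
Proof. by move=> sS xy u; rewrite /Gamma xy; apply/existsP; exists s; rewrite sS. Qed.

Lemma GammaP x y : Gamma S x y -> x != y /\ exists2 s, s \in S & x + s * y \is a GRing.unit.
Proof. by move=> /andP[-> /existsP[s /andP[sS u]]]; split => //; exists s. Qed.

Lemma Gamma_sym x y : Gamma S x y -> Gamma S y x.
Proof.
move=> /GammaP[xy [s sS u]]; apply: (Gamma_adj (S_inv sS)); first by rewrite eq_sym.
have us := S_unit sS; have -> : y + s^-1 * x = s^-1 * (x + s * y) by rewrite mulrDr mulKr // addrC.
by rewrite unitrM unitrV us u.
Qed.

(** To find a bipartite pattern it is enough to give two families of ring elements, a table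
with the side and the index of each vertex, and adjacency between the sides. *)
Lemma bipartite_not_projective L N zs (tab : seq (bool * nat)) (rel : nat -> nat -> bool) (X Y : nat -> R) :
  certificate L N zs ->
  [&& size tab == N, uniq tab & all (fun uv : nat * nat =>
    let p := nth (false, 0%N) tab uv.1 in let q := nth (false, 0%N) tab uv.2 in
    if p.1 then ~~ q.1 && rel q.2 p.2 else q.1 && rel p.2 q.2) L] ->
  (forall i k, (false, i) \in tab -> (false, k) \in tab -> X i = X k -> i = k) ->
  (forall i k, (true, i) \in tab -> (true, k) \in tab -> Y i = Y k -> i = k) ->
  (forall i k, (false, i) \in tab -> (true, k) \in tab -> X i != Y k) ->
  (forall i k, (false, i) \in tab -> (true, k) \in tab -> rel i k ->
    exists2 s, s \in S & X i + s * Y k \is a GRing.unit) ->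
  ~ embeds_in 1.
Proof.
move=> cert /and3P[/eqP sz ut al] Xi Yi XY adj.
pose g v := let p := nth (false, 0%N) tab v in if p.1 then Y p.2 else X p.2.
have LN : all (fun uv => uv.1 < uv.2 < N)%N L by case/and5P: cert.
have gadj i k : (false, i) \in tab -> (true, k) \in tab -> rel i k -> Gamma S (X i) (Y k).
  by move=> hi hk /(adj _ _ hi hk)[s sS u]; apply: (Gamma_adj sS) => //; exact: XY.
apply: (not_projective_sub Gamma_sym (g := g) cert).
- move=> u v; rewrite !inE => uN vN; rewrite -sz in uN vN.
  have := mem_nth (false, 0%N) uN; have := mem_nth (false, 0%N) vN.
  rewrite /g => hv hu h; apply/eqP; rewrite -(nth_uniq (false, 0%N) uN vN ut).
  move: hv hu h; case: (nth _ tab u) => [[] i]; case: (nth _ tab v) => [[] k] /= hk hi.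
  + by move=> /(Yi _ _ hi hk)->.
  + by move=> h; have := XY _ _ hk hi; rewrite h eqxx.
  + by move=> h; have := XY _ _ hi hk; rewrite h eqxx.
  + by move=> /(Xi _ _ hi hk)->.
- apply/allP => uv uvL; have /andP[uv1 uvN] := allP LN uv uvL; have := allP al uv uvL.
  have u1 : (uv.1 < size tab)%N by rewrite sz (ltn_trans uv1).
  have u2 : (uv.2 < size tab)%N by rewrite sz.
  have := mem_nth (false, 0%N) u1; have := mem_nth (false, 0%N) u2; rewrite /g.
  case: (nth _ tab uv.1) => [[] i]; case: (nth _ tab uv.2) => [[] k] //= hk hi h.
    by apply: Gamma_sym; exact: gadj.
  exact: gadj.
Qed.

(** In these tables, the entry of a vertex of the pattern consists of its side and its index on
this side. *)
Definition tabK44e : seq (bool * nat) :=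
  [:: (false, 0); (true, 0); (true, 1); (true, 2); (false, 1); (false, 2); (false, 3); (true, 3)]%N.
Definition tabK35 : seq (bool * nat) :=
  [:: (false, 0); (true, 0); (true, 1); (true, 2); (true, 3); (true, 4); (false, 1); (false, 2)]%N.
Definition tabK45m : seq (bool * nat) :=
  [:: (false, 0); (true, 3); (true, 1); (true, 2); (true, 4); (false, 1); (false, 2); (false, 3); (true, 0)]%N.
Definition tabC6b : seq (bool * nat) :=
  [:: (false, 0); (true, 2); (true, 4); (true, 5); (false, 4); (false, 5); (false, 2); (false, 3); (true, 0); (true, 1)]%N.
Definition tabBZ3 : seq (bool * nat) :=
  [:: (false, 0); (true, 4); (true, 7); (true, 8); (false, 2); (false, 8); (false, 5); (false, 1); (false, 3); (true, 6);
     (true, 0); (true, 1); (true, 2); (false, 4)]%N.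

Lemma K44e_not_projective (X Y : nat -> R) : {in gtn 4 &, injective X} -> {in gtn 4 &, injective Y} ->
  (forall i k, (i < 4)%N -> (k < 4)%N -> X i != Y k) ->
  (forall i k, (i < 4)%N -> (k < 4)%N -> (i, k) != (0, 3)%N -> exists2 s, s \in S & X i + s * Y k \is a GRing.unit) ->
  ~ embeds_in 1.
Proof.
have b c i : (c, i) \in tabK44e -> (i < 4)%N.
  exact: (allP (isT : all (fun p : bool * nat => p.2 < 4)%N tabK44e)).
move=> Xi Yi XY adj; apply: (bipartite_not_projective (tab := tabK44e) (rel := fun i k => (i, k) != (0, 3)%N) K44e_certificate) => //.
- by move=> i k /b hi /b hk; apply: Xi.
- by move=> i k /b hi /b hk; apply: Yi.
- by move=> i k /b hi /b hk; apply: XY.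
- by move=> i k /b hi /b hk; apply: adj.
Qed.

Lemma K35_not_projective (X Y : nat -> R) : {in gtn 3 &, injective X} -> {in gtn 5 &, injective Y} ->
  (forall i k, (i < 3)%N -> (k < 5)%N -> X i != Y k) ->
  (forall i k, (i < 3)%N -> (k < 5)%N -> exists2 s, s \in S & X i + s * Y k \is a GRing.unit) ->
  ~ embeds_in 1.
Proof.
have b i : (false, i) \in tabK35 -> (i < 3)%N.
  exact: (allP (isT : all (fun p : bool * nat => p.1 || (p.2 < 3))%N tabK35)).
have b' i : (true, i) \in tabK35 -> (i < 5)%N.
  exact: (allP (isT : all (fun p : bool * nat => p.2 < 5)%N tabK35)).
move=> Xi Yi XY adj; apply: (bipartite_not_projective (tab := tabK35) (rel := fun i k => true) K35_certificate) => //.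
- by move=> i k /b hi /b hk; apply: Xi.
- by move=> i k /b' hi /b' hk; apply: Yi.
- by move=> i k /b hi /b' hk; apply: XY.
- by move=> i k /b hi /b' hk _; apply: adj.
Qed.

Lemma K45m_not_projective (X Y : nat -> R) : {in gtn 5 &, injective X} -> {in gtn 5 &, injective Y} ->
  (forall i k, (i < 5)%N -> (k < 5)%N -> X i != Y k) ->
  (forall i k, (i < 5)%N -> (k < 5)%N -> i != k -> exists2 s, s \in S & X i + s * Y k \is a GRing.unit) ->
  ~ embeds_in 1.
Proof.
have b c i : (c, i) \in tabK45m -> (i < 5)%N.
  exact: (allP (isT : all (fun p : bool * nat => p.2 < 5)%N tabK45m)).
move=> Xi Yi XY adj; apply: (bipartite_not_projective (tab := tabK45m) (rel := fun i k => i != k) K45m_certificate) => //.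
- by move=> i k /b hi /b hk; apply: Xi.
- by move=> i k /b hi /b hk; apply: Yi.
- by move=> i k /b hi /b hk; apply: XY.
- by move=> i k /b hi /b hk; apply: adj.
Qed.

Lemma C6b_not_projective (X Y : nat -> nat -> R) :
  (forall i k a b, (i < 3)%N -> (k < 3)%N -> (a < 2)%N -> (b < 2)%N -> X i a = X k b -> i = k /\ a = b) ->
  (forall i k a b, (i < 3)%N -> (k < 3)%N -> (a < 2)%N -> (b < 2)%N -> Y i a = Y k b -> i = k /\ a = b) ->
  (forall i k a b, (i < 3)%N -> (k < 3)%N -> (a < 2)%N -> (b < 2)%N -> X i a != Y k b) ->
  (forall i k a b, (i < 3)%N -> (k < 3)%N -> (a < 2)%N -> (b < 2)%N -> i != k ->
     exists2 s, s \in S & X i a + s * Y k b \is a GRing.unit) ->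
  ~ embeds_in 1.
Proof.
have b c i : (c, i) \in tabC6b -> (i %/ 2 < 3)%N /\ (i %% 2 < 2)%N.
  by move=> /(allP (isT : all (fun p : bool * nat => p.2 < 6)%N tabC6b)) /=; lia.
have dd i k : (i %/ 2 = k %/ 2 -> i %% 2 = k %% 2 -> i = k)%N by lia.
move=> Xi Yi XY adj; apply: (@bipartite_not_projective _ _ _ tabC6b (fun i k => i %/ 2 != k %/ 2)%N
  (fun i => X (i %/ 2)%N (i %% 2)%N) (fun i => Y (i %/ 2)%N (i %% 2)%N) C6b_certificate) => //.
- by move=> i k /b[hi hi'] /b[hk hk'] /Xi[] // h1 h2; exact: dd.
- by move=> i k /b[hi hi'] /b[hk hk'] /Yi[] // h1 h2; exact: dd.
- by move=> i k /b[hi hi'] /b[hk hk']; apply: XY.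
- by move=> i k /b[hi hi'] /b[hk hk']; apply: adj.
Qed.

Lemma BZ3_not_projective (X Y : nat -> nat -> R) :
  (forall i k a b, (i < 3)%N -> (k < 3)%N -> (a < 3)%N -> (b < 3)%N -> X i a = X k b -> i = k /\ a = b) ->
  (forall i k a b, (i < 3)%N -> (k < 3)%N -> (a < 3)%N -> (b < 3)%N -> Y i a = Y k b -> i = k /\ a = b) ->
  (forall i k a b, (i < 3)%N -> (k < 3)%N -> (a < 3)%N -> (b < 3)%N -> X i a != Y k b) ->
  (forall i k a b, (i < 3)%N -> (k < 3)%N -> (a < 3)%N -> (b < 3)%N -> i != k -> a != b ->
     exists2 s, s \in S & X i a + s * Y k b \is a GRing.unit) ->
  ~ embeds_in 1.
Proof.
have b c i : (c, i) \in tabBZ3 -> (i %/ 3 < 3)%N /\ (i %% 3 < 3)%N.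
  by move=> /(allP (isT : all (fun p : bool * nat => p.2 < 9)%N tabBZ3)) /=; lia.
have dd i k : (i %/ 3 = k %/ 3 -> i %% 3 = k %% 3 -> i = k)%N by lia.
move=> Xi Yi XY adj; apply: (@bipartite_not_projective _ _ _ tabBZ3 (fun i k => (i %/ 3 != k %/ 3) && (i %% 3 != k %% 3))%N
  (fun i => X (i %/ 3)%N (i %% 3)%N) (fun i => Y (i %/ 3)%N (i %% 3)%N) BZ3_certificate) => //.
- by move=> i k /b[hi hi'] /b[hk hk'] /Xi[] // h1 h2; exact: dd.
- by move=> i k /b[hi hi'] /b[hk hk'] /Yi[] // h1 h2; exact: dd.
- by move=> i k /b[hi hi'] /b[hk hk']; apply: XY.
- by move=> i k /b[hi hi'] /b[hk hk'] /andP[]; apply: adj.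
Qed.
End Cayley.

(** * Large radicals and direct factors *)
Section Cayley.
Variables (K : realType) (R : finComUnitRingType) (S : {set R}).
Hypothesis S_unit : {in S, forall s, s \is a GRing.unit}.
Hypothesis S_inv : {in S, forall s, s^-1 \in S}.
Variables (s : R).
Hypothesis sS : s \in S.
Local Notation embeds_in k := (embeds K (Gamma S) (crosscap_sphere K k)).
Implicit Types (x y e g a b : R).

Let us : s \is a GRing.unit := S_unit sS.

Lemma inv_in_eq e x y : e * x = e * y -> inv_in e x -> inv_in e y.
Proof. by move=> h [d hd]; exists d; rewrite -h. Qed.

Lemma enum_nth_inj (A : {set R}) n : (n <= #|A|)%N -> {in gtn n &, injective (nth 0 (enum A))}.
Proof.
move=> nA i k; rewrite !inE => hi hk h; apply/eqP.
by rewrite -(nth_uniq 0 _ _ (enum_uniq A)) -?cardE ?(leq_trans hi) ?(leq_trans hk) // h.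
Qed.

Lemma enum_nth_mem (A : {set R}) n i : (n <= #|A|)%N -> (i < n)%N -> nth 0 (enum A) i \in A.
Proof. by move=> nA hi; rewrite -mem_enum mem_nth // -cardE (leq_trans hi). Qed.

(** The classes [J] and [1 + J] are joined completely. *)
Lemma jac4_not_projective : (3 < #|jac R|)%N -> ~ embeds_in 1.
Proof.
move=> j4; pose j := nth 0 (enum (jac R)).
have jJ i : (i < 4)%N -> j i \in jac R by apply: enum_nth_mem.
have ji := enum_nth_inj j4.
apply: (K44e_not_projective S_unit S_inv (X := j) (Y := fun i => 1 + j i)) => //.
- by move=> i k hi hk /addrI/ji; apply.
- move=> i k hi hk; apply/eqP => h; have := jac_nonunit (jJ i hi).
  by rewrite h unitr_jac ?unitr1 ?jJ.
- move=> i k hi hk _; exists s => //.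
  have -> : j i + s * (1 + j k) = s + (j i + s * j k) by ring.
  by rewrite unitr_jac ?jacD ?jacM ?jJ.
Qed.

(** Elements of the radical are adjacent to all units, and there are at least six of these,
[1 + J] and [- 1 + J]: [2] is not in the radical, as otherwise [3] would be a unit that
kills the additive group of order three. *)
Lemma jac3_not_projective : #|jac R| = 3%N -> ~ embeds_in 1.
Proof.
move=> j3; have jle : (3 <= #|jac R|)%N by rewrite j3.
pose j := nth 0 (enum (jac R)).
have jJ i : (i < 3)%N -> j i \in jac R by apply: enum_nth_mem.
have ji := enum_nth_inj jle.
have [a aJ a0] : exists2 a, a \in jac R & a != 0.
  have [h|h] := eqVneq (j 0%N) 0; last by exists (j 0%N); rewrite ?jJ.
  exists (j 1%N); first by rewrite jJ.
  by apply/eqP => h1; have := ji 0%N 1%N isT isT; rewrite -/(j 0%N) -/(j 1%N) h h1 => /(_ erefl).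
have two : (2 : R) \notin jac R.
  apply/negP => J2.
  have u3 : (3 : R) \is a GRing.unit.
    by rewrite (_ : 3 = 1 + 2 :> R); [rewrite unitr_jac ?unitr1 | ring].
  have : a *+ #|jac R| = 0 by apply: mulrn_card => //; [exact: jac0 | exact: jacD].
  rewrite j3 -mulr_natr => h; move/eqP: a0; apply.
  by rewrite -[a](mulrK u3) h mul0r.
(* Five units: all of the first class and two of the second. *)
pose Y k := if (k < 3)%N then 1 + j k else -1 + j (k - 3)%N.
have YU k : (k < 5)%N -> Y k \is a GRing.unit.
  move=> hk; rewrite /Y; case: ifP => h; first by rewrite unitr_jac ?unitr1 ?jJ.
  by rewrite unitr_jac ?unitrN ?unitr1 ?jJ //; lia.
have cross_sign i k : (i < 3)%N -> (k < 3)%N -> 1 + j i != -1 + j k.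
  move=> hi hk; apply: contraNneq two => h.
  have -> : 2 = j k + - j i :> R by rewrite -[j k](addrK (-1)) addrAC (addrC _ (-1)) -h; ring.
  by rewrite jacD ?jacN ?jJ.
apply: (K35_not_projective S_unit S_inv (X := j) (Y := Y)) => //.
- move=> i k; rewrite !inE /Y => hi hk.
  case: ifP => h1; case: ifP => h2.
  + by move=> /addrI/ji; apply.
  + by move=> /eqP; rewrite (negbTE (cross_sign _ _ _ _)) //; lia.
  + by move=> /esym/eqP; rewrite (negbTE (cross_sign _ _ _ _)) //; lia.
  + by move=> /addrI/ji; rewrite !inE => h; have := h _ _; lia.
- by move=> i k hi hk; apply: contraTneq (YU k hk) => <-; rewrite jac_nonunit // jJ.
- move=> i k hi hk; exists s => //; rewrite addrC unitr_jac ?jJ //.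
  by rewrite unitrM us YU.
Qed.

Section Idempotent.
Variable e : R.
Hypothesis ee : e * e = e.
Let f := 1 - e.
Let ff : f * f = f. Proof. by rewrite /f; have := ee => h; rewrite mulrBl mul1r mulrBr mulr1 h subrr subr0. Qed.
Let ef : e * f = 0. Proof. by rewrite /f mulrBr mulr1 ee subrr. Qed.

Lemma eZf a b : e * (e * a + f * b) = e * a.
Proof. by rewrite mulrDr !mulrA ee ef mul0r addr0. Qed.
Lemma fZf a b : f * (e * a + f * b) = f * b.
Proof. by rewrite mulrDr !mulrA ff [f * e]mulrC ef mul0r add0r. Qed.

Lemma mix_unit a b : inv_in e a -> inv_in f b -> e * a + f * b \is a GRing.unit.
Proof.
move=> ha hb; apply: (unit_split ee).
  by apply: inv_in_eq ha; rewrite eZf.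
by apply: inv_in_eq hb; rewrite -/f fZf.
Qed.

Lemma inv_in_neq0 g a : g != 0 -> inv_in g a -> g * a != 0.
Proof. by move=> g0 [d hd]; apply: contra_neq g0 => h; rewrite -hd h mul0r. Qed.

Lemma inv_in_subC g a b : inv_in g (a - b) -> inv_in g (b - a).
Proof. by move=> /inv_inN; rewrite opprB. Qed.

(** The factor [- s^-1] turns the sums [x + s * y] of the adjacency relation into differences
in the corner of [e] ([mix_add_mixY]), while the other corner is left alone. *)
Definition mixY b b' := - s^-1 * (e * b) + f * b'.

Lemma mixY_e b b' : e * mixY b b' = - s^-1 * (e * b).
Proof.
rewrite /mixY mulrDr (mulrA e f) ef mul0r addr0.
have -> : e * (- s^-1 * (e * b)) = - s^-1 * ((e * e) * b) by ring.
by rewrite ee.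
Qed.
Lemma mixY_f b b' : f * mixY b b' = f * b'.
Proof.
rewrite /mixY mulrDr (mulrA f f) ff.
have -> : f * (- s^-1 * (e * b)) = - s^-1 * b * (e * f) by ring.
by rewrite ef mulr0 add0r.
Qed.

Lemma mix_add_mixY a a' b b' : (e * a + f * a') + s * mixY b b' = e * (a - b) + f * (a' + s * b').
Proof.
rewrite /mixY; have h : s * s^-1 = 1 by rewrite mulrV.
have -> : s * (- s^-1 * (e * b) + f * b') = - (s * s^-1) * (e * b) + s * (f * b') by ring.
by rewrite h; ring.
Qed.

Lemma mixY_inj b b' c c' : mixY b b' = mixY c c' -> e * b = e * c /\ f * b' = f * c'.
Proof.
move=> h; split; last by have := congr1 (fun z => f * z) h; rewrite !mixY_f.
have := congr1 (fun z => e * z) h; rewrite !mixY_e => /mulrI; apply.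
by rewrite unitrN unitrV.
Qed.

Lemma mix_inj b b' c c' : e * b + f * b' = e * c + f * c' -> e * b = e * c /\ f * b' = f * c'.
Proof.
move=> h; split; first by have := congr1 (fun z => e * z) h; rewrite !eZf.
by have := congr1 (fun z => f * z) h; rewrite !fZf.
Qed.

Lemma inv_in_inj (c : nat -> R) (m : nat) : e != 0 ->
  (forall i k, (i < m)%N -> (k < m)%N -> i != k -> inv_in e (c i - c k)) ->
  forall i k, (i < m)%N -> (k < m)%N -> e * c i = e * c k -> i = k.
Proof.
move=> e0 hc i k hi hk h; apply/eqP/negPn/negP => ik.
by have := inv_in_neq0 e0 (hc i k hi hk ik); rewrite mulrBr h subrr eqxx.
Qed.

(** Three residues [c] with invertible differences make a hexagon, the bipartite graph in
which [c i] on one side is joined to [c k] on the other for [i] different from [k]; in the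
other factor there are two choices on each side, and all sums are invertible there. *)
Lemma hexagon_not_projective (c a b : nat -> R) : e != 0 ->
  (forall i k, (i < 3)%N -> (k < 3)%N -> i != k -> inv_in e (c i - c k)) ->
  (forall i k, (i < 2)%N -> (k < 2)%N -> inv_in f (a i + s * b k)) ->
  f * a 0%N != f * a 1%N -> f * b 0%N != f * b 1%N ->
  (forall i k, (i < 2)%N -> (k < 2)%N -> f * a i != f * b k) -> ~ embeds_in 1.
Proof.
move=> e0 hc hab a01 b01 ab.
have ai (g : nat -> R) i k : f * g 0%N != f * g 1%N -> (i < 2)%N -> (k < 2)%N -> f * g i = f * g k -> i = k.
  by case: i => [|[|//]]; case: k => [|[|//]] // /eqP h _ _ h'; [case: h | case: h; rewrite h'].
apply: (C6b_not_projective S_unit S_inv (X := fun i t => e * c i + f * a t) (Y := fun i t => mixY (c i) (b t))).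
- move=> i k t u hi hk ht hu /mix_inj[/(inv_in_inj e0 hc hi hk)-> h2]; split => //.
  exact: ai h2.
- move=> i k t u hi hk ht hu /mixY_inj[/(inv_in_inj e0 hc hi hk)-> h2]; split => //.
  exact: ai h2.
- move=> i k t u hi hk ht hu; apply: contra_neq (ab t u ht hu) => h.
  by have := congr1 (fun z => f * z) h; rewrite fZf mixY_f.
- move=> i k t u hi hk ht hu ik; exists s => //; rewrite mix_add_mixY.
  by apply: mix_unit; [exact: hc | exact: hab].
Qed.

(** Five residues give two sides of five vertices, with [0] and [1] in the other factor, and
only pairs of equal residues are not adjacent. *)
Lemma five_residues_not_projective (c : nat -> R) : e != 0 -> e != 1 ->
  (forall i k, (i < 5)%N -> (k < 5)%N -> i != k -> inv_in e (c i - c k)) -> ~ embeds_in 1.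
Proof.
move=> e0 e1 hc.
have f0 : f != 0 by rewrite subr_eq0 eq_sym.
apply: (K45m_not_projective S_unit S_inv (X := fun i => e * c i + f * 0) (Y := fun i => mixY (c i) 1)).
- by move=> i k hi hk /mix_inj[/(inv_in_inj e0 hc hi hk)].
- by move=> i k hi hk /mixY_inj[/(inv_in_inj e0 hc hi hk)].
- move=> i k hi hk; apply: contra_neq f0 => h.
  by have := congr1 (fun z => f * z) h; rewrite fZf mixY_f mulr0 mulr1.
- move=> i k hi hk ik; exists s => //; rewrite mix_add_mixY.
  apply: mix_unit; first exact: hc.
  by rewrite add0r mulr1; apply: inv_in_unit.
Qed.

(** Each side has four residues, with [0] and [1] in the other factor.  Adjacency may use [s]
or its inverse, and fails only for the two zero residues, which are placed at
the missing edge by reversing the order on one side. *)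
Lemma four_residues_not_projective (b : nat -> R) : e != 1 -> b 0%N = 0 ->
  (forall i k, (i < 4)%N -> (k < 4)%N -> e * b i = e * b k -> i = k) ->
  (forall i k, (i < 4)%N -> (k < 4)%N -> (i, k) != (0, 0)%N ->
     inv_in e (b i + s * b k) \/ inv_in e (b i + s^-1 * b k)) -> ~ embeds_in 1.
Proof.
move=> e1 b0 bi hb.
have f0 : f != 0 by rewrite subr_eq0 eq_sym.
apply: (K44e_not_projective S_unit S_inv (X := fun i => e * b i + f * 0) (Y := fun i => e * b (3 - i)%N + f * 1)).
- by move=> i k hi hk /mix_inj[/(bi _ _ hi hk)].
- move=> i k; rewrite !inE => hi hk /mix_inj[/bi h _].
  have := h _ _; lia.
- move=> i k hi hk; apply: contra_neq f0 => h.
  by have := congr1 (fun z => f * z) h; rewrite !fZf mulr0 mulr1.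
- move=> i k hi hk ik.
  have sum t : (e * b i + f * 0) + t * (e * b (3 - k)%N + f * 1) = e * (b i + t * b (3 - k)%N) + f * (t * 1) by ring.
  have k3 : (3 - k < 4)%N by lia.
  have ik' : (i, (3 - k)%N) != (0%N, 0%N).
    by apply: contra ik => /eqP[-> h]; apply/eqP; congr (_, _); lia.
  have [h|h] := hb i (3 - k)%N hi k3 ik'.
  + by exists s => //; rewrite sum; apply: mix_unit => //; rewrite mulr1; exact: inv_in_unit.
  + exists s^-1; first exact: S_inv.
    by rewrite sum; apply: mix_unit => //; rewrite mulr1; apply: inv_in_unit; rewrite unitrV.
Qed.

End Idempotent.

(** Two factors with three residues make a 3 by 3 grid, and the remaining factor separates
the two sides. *)
Lemma two_ternary_not_projective e1 e2 (c : nat -> R) : e1 * e1 = e1 -> e2 * e2 = e2 -> e1 * e2 = 0 -> e1 != 0 -> e2 != 0 ->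
  1 - e1 - e2 != 0 ->
  (forall i k, (i < 3)%N -> (k < 3)%N -> i != k -> inv_in e1 (c i - c k) /\ inv_in e2 (c i - c k)) ->
  ~ embeds_in 1.
Proof.
move=> ee1 ee2 e12 e10 e20 g0 hc; set g := 1 - e1 - e2 in g0.
have gg : g * g = g.
  rewrite /g; have -> : (1 - e1 - e2) * (1 - e1 - e2) = 1 - e1 - e2 + (e1 * e1 - e1) + (e2 * e2 - e2) + e1 * e2 *+ 2 by ring.
  by rewrite ee1 ee2 e12 mul0rn !subrr !addr0.
have h1 := inv_in_inj e10 (fun i k hi hk ik => (hc i k hi hk ik).1).
have h2 := inv_in_inj e20 (fun i k hi hk ik => (hc i k hi hk ik).2).
pose w i k := e1 * c i + e2 * c k.
have w1 i k t : e1 * (w i k + t * g) = e1 * c i.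
  have -> : e1 * (w i k + t * g) = e1 * e1 * c i + e1 * e2 * (c k - t) + t * (e1 - e1 * e1) by rewrite /w /g; ring.
  by rewrite ee1 e12 mul0r subrr mulr0 !addr0.
have w2 i k t : e2 * (w i k + t * g) = e2 * c k.
  have -> : e2 * (w i k + t * g) = e2 * e2 * c k + e1 * e2 * (c i - t) + t * (e2 - e2 * e2) by rewrite /w /g; ring.
  by rewrite ee2 e12 mul0r subrr mulr0 !addr0.
have wg i k t : g * (w i k + t * g) = t * g.
  have -> : g * (w i k + t * g) = (e1 - e1 * e1) * c i + (e2 - e2 * e2) * c k - e1 * e2 * (c i + c k) + t * (g * g) by rewrite /w /g; ring.
  by rewrite ee1 ee2 e12 gg mul0r !subrr !mul0r subr0 !add0r.
apply: (BZ3_not_projective S_unit S_inv (X := fun i k => w i k + 0 * g) (Y := fun i k => - s^-1 * (w i k + 1 * g))).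
- move=> i k a b hi hk ha hb h; split.
    by apply: h1 => //; have := congr1 (fun z => e1 * z) h; rewrite !w1.
  by apply: h2 => //; have := congr1 (fun z => e2 * z) h; rewrite !w2.
- move=> i k a b hi hk ha hb /mulrI h.
  have {}h : w i a + 1 * g = w k b + 1 * g by apply: h; rewrite unitrN unitrV.
  split.
    by apply: h1 => //; have := congr1 (fun z => e1 * z) h; rewrite !w1.
  by apply: h2 => //; have := congr1 (fun z => e2 * z) h; rewrite !w2.
- move=> i k a b hi hk ha hb; apply: contra_neq g0 => h.
  have := congr1 (fun z => - s * (g * z)) h.
  have -> : - s * (g * (- s^-1 * (w k b + 1 * g))) = (s * s^-1) * (g * (w k b + 1 * g)) by ring.
  by rewrite !wg mul0r mulr0 mulrV // !mul1r.
- move=> i k a b hi hk ha hb ik ab; exists s => //.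
  have -> : w i a + 0 * g + s * (- s^-1 * (w k b + 1 * g)) = w i a - (s * s^-1) * (w k b + g) by ring.
  rewrite mulrV // mul1r.
  have [d1 hd1] := (hc i k hi hk ik).1; have [d2 hd2] := (hc a b ha hb ab).2.
  set z := w i a - _.
  have ez : e1 * z = e1 * (c i - c k).
    by have := w1 i a 0; have := w1 k b 1; rewrite mul0r addr0 mul1r /z !mulrBr => -> ->.
  have ez2 : e2 * z = e2 * (c a - c b).
    by have := w2 i a 0; have := w2 k b 1; rewrite mul0r addr0 mul1r /z !mulrBr => -> ->.
  have ezg : g * z = - g.
    by have := wg i a 0; have := wg k b 1; rewrite !mul0r addr0 !mul1r /z mulrBr => -> ->; rewrite sub0r.
  have zE : z = e1 * z + e2 * z + g * z by rewrite /g; ring.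
  have E : z * (e1 * d1 + e2 * d2 - g) = 1.
    have -> : z * (e1 * d1 + e2 * d2 - g) = e1 * z * d1 + e2 * z * d2 - g * z by ring.
    by rewrite ez ez2 ezg hd1 hd2 /g; ring.
  by apply/unitrP; exists (e1 * d1 + e2 * d2 - g); rewrite mulrC E.
Qed.
End Cayley.

(** * Planarity from cosets, and radicals of order two *)
Section Cayley.
Variables (K : realType) (R : finComUnitRingType) (S : {set R}).
Hypothesis S_unit : {in S, forall s, s \is a GRing.unit}.
Hypothesis S_inv : {in S, forall s, s^-1 \in S}.
Local Notation embeds_in k := (embeds K (Gamma S) (crosscap_sphere K k)).
Implicit Types (x y s u e f g a b : R) (H : {set R}).

(** [r] chooses a representative of each coset, and [copy] is its number. *)
Lemma coset_numbering H : 0 \in H -> {in H &, forall x y, x - y \in H} ->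
  exists (copy : R -> nat) (r : R -> R), [/\ forall x, x - r x \in H,
    forall x y, copy x = copy y -> r x = r y & forall x y, x - y \in H -> copy x = copy y].
Proof.
move=> H0 HB; pose r x := odflt x [pick y | x - y \in H].
have HN x : x \in H -> - x \in H by move=> hx; rewrite -sub0r HB.
have HD x y : x \in H -> y \in H -> x + y \in H by move=> hx hy; rewrite -[y]opprK HB ?HN.
exists (fun x => enum_rank (r x) : nat), r; split.
- by move=> x; rewrite /r; case: pickP => [y //|_]; rewrite subrr.
- by move=> x y h; apply: enum_rank_inj; exact: val_inj.
- move=> x y xy; congr (nat_of_ord (enum_rank _)); rewrite /r.
  rewrite (eq_pick (Q := fun z => y - z \in H)); last first.
    move=> z; apply/idP/idP => h.
      have -> : y - z = (x - z) - (x - y) by ring.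
      exact: HB.
    have -> : x - z = (y - z) + (x - y) by ring.
    exact: HD.
  by case: pickP => [//|/(_ y)]; rewrite subrr H0.
Qed.

Lemma K4_complete (i j : 'I_4) : i != j -> pattern K4 i j.
Proof. by case: i => [[|[|[|[|]]]] ?]; case: j => [[|[|[|[|]]]] ?]. Qed.

(** Every component is contained in a coset of [H], and graphs on four vertices are planar. *)
Lemma cosets_planar H : 0 \in H -> {in H &, forall x y, x - y \in H} -> (#|H| <= 4)%N ->
  (forall x y, Gamma S x y -> x - y \in H) -> embeds_in 0.
Proof.
move=> H0 HB H4 adj; have [copy [r [rH cr Hc]]] := coset_numbering H0 HB.
pose h x : 'I_4 := inord (index (x - r x) (enum H)).
have hi x y : copy x = copy y -> h x = h y -> x = y.
  move=> /cr rxy /(congr1 val) /=.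
  have lt (z : R) : (index (z - r z)%R (enum H) < 4)%N.
    by apply: leq_trans H4; rewrite cardE index_mem mem_enum.
  rewrite !inordK // => /(congr1 (nth 0 (enum H))); rewrite !nth_index ?mem_enum // rxy.
  exact: addIr.
apply: (@K4_planar K R _ copy h hi) => x y xy; split; first exact/Hc/adj.
apply: K4_complete; apply: contraTneq xy => h_xy.
have xy' := hi x y; rewrite /Gamma; apply/negP => /[dup] /adj/Hc c /andP[/eqP ne _].
by apply: ne; exact: xy'.
Qed.

(** As [- 1] is a unit, [2] is in [J], so [J] and [1 + J] together form an additive subgroup,
and adjacent elements differ by an element of [1 + J]. *)
Lemma local_planar : (#|jac R| <= 2)%N -> (forall u, u \is a GRing.unit -> u - 1 \in jac R) -> embeds_in 0.
Proof.
move=> j2 loc; pose H := jac R :|: [set 1 + x | x in jac R].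
have HP x : reflect (x \in jac R \/ x - 1 \in jac R) (x \in H).
  apply: (iffP setUP) => [[h|/imsetP[y yJ ->]]|[h|h]]; [by left| |by left|].
    by right; rewrite addrC addKr.
  by right; apply/imsetP; exists (x - 1) => //; rewrite addrC subrK.
have J2 : 2 \in jac R.
  have := loc (-1); rewrite unitrN unitr1 => /(_ isT)/jacN.
  by rewrite (_ : - (-1 - 1) = 2 :> R) //; ring.
apply: (@cosets_planar H).
- by apply/HP; left; exact: jac0.
- move=> x y /HP[hx|hx] /HP[hy|hy]; apply/HP.
  + by left; rewrite jacD ?jacN.
  + right; have -> : x - y - 1 = x - (y - 1) - 2 by ring.
    exact: jacD (jacD hx (jacN hy)) (jacN J2).
  + right; have -> : x - y - 1 = (x - 1) - y by ring.
    exact: jacD hx (jacN hy).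
  + left; have -> : x - y = (x - 1) - (y - 1) by ring.
    exact: jacD hx (jacN hy).
- rewrite (leq_trans (leq_card_setU _ _)) // (leq_add (n1 := 2) (n2 := 2)) //.
  exact: leq_trans (leq_imset_card _ _) j2.
- move=> x y /GammaP[_ [s sS u]]; apply/HP; right.
  have -> : x - y - 1 = (x + s * y - 1) - y * (s - 1) - y * 2 by ring.
  exact: jacD (jacD (loc _ u) (jacN (jacM _ (loc _ (S_unit sS))))) (jacN (jacM _ J2)).
Qed.

(** The unit [u] fixes the only nonzero element [j] of [J], so the idempotent power [e] of
[u - 1] kills [j].  In the corner of [e], the elements [0], [1] and [u] have invertible
differences; in the other corner, [j] provides pairs of vertices. *)
Lemma nonlocal_not_projective s u : s \in S -> #|jac R| = 2%N -> u \is a GRing.unit -> u - 1 \notin jac R ->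
  ~ embeds_in 1.
Proof.
move=> sS j2 uu uJ.
have [j jJ j0] : exists2 j, j \in jac R & j != 0.
  have : (0 < #|jac R :\ 0%R|)%N by have := cardsD1 0 (jac R); rewrite j2 jac0 add1n => -[<-].
  by move=> /card_gt0P[j]; rewrite !inE => /andP[j0 jJ]; exists j => //; rewrite inE.
have Jj x : x \in jac R -> x != 0 -> x = j.
  move=> xJ x0; apply/eqP/negPn/negP => xj.
  have jx : j != x by rewrite eq_sym.
  have : uniq [:: 0; j; x] by rewrite /= !inE negb_or ![0 == _]eq_sym j0 x0 jx.
  move/card_uniqP => /= c3.
  have /subset_leq_card : [:: 0; j; x] \subset jac R.
    by apply/subsetP => y; rewrite !in_cons in_nil orbF => /or3P[] /eqP-> //; exact: jac0.
  by rewrite c3 j2.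
have uj : (u - 1) * j = 0.
  rewrite mulrBl mul1r (Jj (u * j)) ?subrr ?jacM //.
  by apply: contra_neq j0 => h; rewrite -[j](mulKr uu) h mulr0.
have [n n0 ee] := idem_power (u - 1); set e := (u - 1) ^+ n in ee.
have ej : e * j = 0 by rewrite /e -(prednK n0) exprSr -mulrA uj mulr0.
have e0 : e != 0 by apply: contraNneq uJ => /nilp_jac.
have fj : (1 - e) * j = j by rewrite mulrBl mul1r ej subr0.
have e1 : inv_in e 1 by exists e; rewrite mulr1.
have eu : inv_in e (u - 1).
  by exists ((u - 1) ^+ n.-1); rewrite -mulrA -exprS prednK.
have eu' : inv_in e u by exact: inv_in_unit.
have f0 : 1 - e != 0 by apply: contra_neq j0 => h; rewrite -fj h mul0r.
apply: (@hexagon_not_projective K R S S_unit S_inv s sS e ee (nth 0 [:: 0; 1; u])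
   (nth 0 [:: 0; j]) (nth 0 [:: 1; 1 + j])) => //.
- case=> [|[|[|//]]]; case=> [|[|[|//]]] //= _ _ _; rewrite ?subr0 ?sub0r //.
  + exact: inv_inN.
  + exact: inv_inN.
  + exact: inv_in_subC.
- move=> i k hi hk; apply: inv_in_unit.
  have -> : nth 0 [:: 0; j] i + s * nth 0 [:: 1; 1 + j] k = s + (nth 0 [:: 0; j] i + s * nth 0 [:: 0; j] k).
    by case: k hk => [|[|//]] _ /=; ring.
  have aJ m : (m < 2)%N -> nth 0 [:: 0; j] m \in jac R by case: m => [|[|//]] _ //=; exact: jac0.
  by rewrite unitr_jac ?S_unit ?jacD ?jacM ?aJ.
- by rewrite /= mulr0 fj eq_sym.
- by rewrite /= mulrDr fj mulr1 -subr_eq0 opprD addNKr oppr_eq0.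
- move=> i k hi hk; rewrite -subr_eq0 -mulrBr; apply: contra_neq f0.
  move=> h; have uk : nth 0 [:: 0; j] i - nth 0 [:: 1; 1 + j] k \is a GRing.unit.
    have -> : nth 0 [:: 0; j] i - nth 0 [:: 1; 1 + j] k = - 1 + (nth 0 [:: 0; j] i - nth 0 [:: 0; j] k).
      by case: k hk {h} => [|[|//]] _ /=; ring.
    have aJ m : (m < 2)%N -> nth 0 [:: 0; j] m \in jac R by case: m => [|[|//]] _ //=; exact: jac0.
    by rewrite unitr_jac ?unitrN ?unitr1 ?jacD ?jacN ?aJ.
  by apply: (mulIr uk); rewrite mul0r.
Qed.

End Cayley.

(** * Factors of a reduced ring *)
Section Cayley.
Variables (K : realType) (R : finComUnitRingType) (S : {set R}).
Hypothesis S_unit : {in S, forall s, s \is a GRing.unit}.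
Hypothesis S_inv : {in S, forall s, s^-1 \in S}.
Local Notation embeds_in k := (embeds K (Gamma S) (crosscap_sphere K k)).
Implicit Types (x y s u e f g a b : R) (H : {set R}).

Section Reduced.
Hypothesis jac_triv : forall x, x \in jac R -> x = 0.

Lemma corner_two e x : #|corner e| = 2%N -> e * e = e -> e != 0 -> e * x != 0 -> e * x = e.
Proof.
move=> c2 ee e0 ex0; apply/eqP/negPn/negP => exe.
have : uniq [:: 0; e; e * x] by rewrite /= !inE negb_or eq_sym e0 eq_sym ex0 eq_sym exe.
move/card_uniqP => /= c3.
have /subset_leq_card : [:: 0; e; e * x] \subset corner e.
  apply/subsetP => y; rewrite !in_cons in_nil orbF => /or3P[] /eqP->; apply/cornerP => //.
    by rewrite mulr0.
  by rewrite mulrA ee.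
by rewrite c3 c2.
Qed.

Lemma corner_gt1 e : e * e = e -> e != 0 -> (1 < #|corner e|)%N.
Proof.
move=> ee e0; have /card_uniqP /= <- : uniq [:: 0; e] by rewrite /= inE eq_sym e0.
apply/subset_leq_card/subsetP => y; rewrite !in_cons in_nil orbF => /orP[] /eqP->; apply/cornerP => //.
by rewrite mulr0.
Qed.

(** The factor of [f] is a product of fields with two elements, where [1] is the only unit. *)
Lemma units_fixed f : f * f = f ->
  (forall e, atom e -> e * f = 0 \/ #|corner e| = 2%N) ->
  forall u, u \is a GRing.unit -> f * u = f.
Proof.
move=> ff hf u uu; apply/eqP; rewrite -subr_eq0; apply/eqP/(no_atoms_zero jac_triv) => e at_e.
have -> : e * (f * u - f) = e * f * (u - 1) by ring.
have [->|c2] := hf e at_e; first by rewrite mul0r.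
have [ee e0 _] := at_e; have -> : e * f * (u - 1) = f * (e * u - e) by ring.
by rewrite (corner_two c2) ?subrr ?mulr0 // (atom_unit at_e).
Qed.

(** The element [0] comes first because [four_residues_not_projective] expects it there. *)
Definition residue e := nth 0 (0 :: enum (corner e :\ 0%R)).

Lemma residueP e n : (n <= #|corner e|)%N ->
  (forall i, (i < n)%N -> e * residue e i = residue e i) /\
  (forall i k, (i < n)%N -> (k < n)%N -> residue e i = residue e k -> i = k).
Proof.
have c0 : 0 \in corner e by apply/cornerP; rewrite mulr0.
have sz : size (0 :: enum (corner e :\ 0%R)) = #|corner e|.
  by rewrite /= -cardE [RHS](cardsD1 0) c0.
move=> le; split=> [i hi|i k hi hk].
  have : residue e i \in 0 :: enum (corner e :\ 0%R) by rewrite mem_nth // sz (leq_trans hi).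
  rewrite inE mem_enum => /orP[/eqP->|]; first by rewrite mulr0.
  by rewrite 2!inE => /andP[_ /cornerP].
move/eqP; rewrite nth_uniq ?sz ?(leq_trans hi) ?(leq_trans hk) //; first by move/eqP.
by rewrite /= enum_uniq mem_enum !inE eqxx.
Qed.

Lemma residue_inv e n : atom e -> (n <= #|corner e|)%N ->
  forall i k, (i < n)%N -> (k < n)%N -> i != k -> inv_in e (residue e i - residue e k).
Proof.
move=> [ee e0 h] /residueP[r_c r_i] i k hi hk ik; apply: h.
rewrite mulrBr !r_c // subr_eq0; apply: contraNneq ik => /(r_i _ _ hi hk)->; exact: eqxx.
Qed.

Lemma corner5_not_projective s e : s \in S -> atom e -> e != 1 -> (5 <= #|corner e|)%N -> ~ embeds_in 1.
Proof.
move=> sS at_e e1 q5; have [ee e0 _] := at_e.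
apply: (five_residues_not_projective S_unit S_inv sS ee e0 e1 (c := residue e)).
exact: residue_inv at_e q5.
Qed.

Lemma corner_char e : e * e = e -> e *+ #|corner e| = 0.
Proof.
move=> ee; apply: mulrn_card; [by apply/cornerP; rewrite mulr0| |by apply/cornerP].
by move=> y z /cornerP hy /cornerP hz; apply/cornerP; rewrite mulrDr hy hz.
Qed.

Lemma corner4_char e : atom e -> #|corner e| = 4%N -> e * 2 = 0.
Proof.
move=> at_e q4; have [ee e0 _] := at_e; have := corner_char ee; rewrite q4 => e4.
have [//|e2] := eqVneq (e * 2) 0.
apply: (atom_cancel at_e e2); rewrite -e4 -mulr_natr; ring.
Qed.

(** If both [residue e i + s * residue e k] and the same sum with the inverse of [s] vanish
in the corner, then [s] is its own inverse there; in characteristic two this means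
[(s - 1) ^+ 2 = 0], so [s] acts as [1], contrary to the assumption. *)
Lemma corner4_not_projective s e : s \in S -> atom e -> e != 1 -> #|corner e| = 4%N -> e * s != e -> ~ embeds_in 1.
Proof.
move=> sS at_e e1 q4 es; have [ee e0 he] := at_e; have e2 := corner4_char at_e q4.
have q4' : (4 <= #|corner e|)%N by rewrite q4.
have [r_c r_i] := residueP q4'; have us := S_unit sS.
have r0 i : (i < 4)%N -> i != 0%N -> e * residue e i != 0.
  by move=> hi i0; rewrite r_c //; apply: contraNneq i0 => h; apply/eqP/(r_i i 0%N).
apply: (four_residues_not_projective S_unit S_inv sS ee e1 (b := residue e)) => //.
  by move=> i k hi hk; rewrite !r_c //; exact: r_i.
move=> i k hi hk ik; have [k0|k0] := eqVneq k 0%N.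
  left; rewrite k0 mulr0 addr0; apply/he/r0 => //.
  by apply: contraNneq ik => ->; rewrite k0.
have [h1|h1] := eqVneq (e * (residue e i + s * residue e k)) 0; last by left; exact: he.
have [h2|h2] := eqVneq (e * (residue e i + s^-1 * residue e k)) 0; last by right; exact: he.
exfalso; move/eqP: es; apply; apply/eqP; rewrite -subr_eq0.
have h3 : e * (s - s^-1) = 0.
  apply: (atom_cancel at_e (r0 k hk k0)); have := congr2 (fun a b => a - b) h1 h2.
  by rewrite subrr => <-; ring.
have h4 : e * (s * s - 1) = 0.
  have -> : e * (s * s - 1) = s * (e * (s - s^-1)) + e * (s * s^-1 - 1) by ring.
  by rewrite h3 mulrV // subrr !mulr0 addr0.
have [h|h5] := eqVneq (e * (s - 1)) 0; first by rewrite -h; apply/eqP; ring.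
apply/eqP; have -> : e * s - e = e * (s - 1) by ring.
apply: (atom_cancel at_e h5).
have -> : e * ((s - 1) * (s - 1)) = e * (s * s - 1) - e * 2 * (s - 1) by ring.
by rewrite h4 e2 mul0r subr0.
Qed.

Lemma inv_in_join e f z : f * f = f -> e * f = e -> inv_in e z -> inv_in (f - e) z -> inv_in f z.
Proof.
move=> ff ef [a ha] [b hb]; exists (e * a + (f - e) * b).
have -> : f * z * (e * a + (f - e) * b) = e * f * z * a + (f * f - e * f) * z * b by ring.
by rewrite ff ef ha hb; ring.
Qed.

(** In the field with four elements two elements [a] can be chosen on one side and the other
two on the other side; as the characteristic is two and [s] acts as [1], their sums are
not zero.  The other factor provides the three residues. *)
Lemma corners43_not_projective s e e' : s \in S -> atom e -> #|corner e| = 4%N -> e * s = e ->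
  atom e' -> e != e' -> (3 <= #|corner e'|)%N -> ~ embeds_in 1.
Proof.
move=> sS at_e q4 es at_e' ne q3; have [ee e0 he] := at_e; have [ee' e0' he'] := at_e'.
have orth := atoms_orthogonal at_e at_e' ne; have us := S_unit sS.
have q4' : (4 <= #|corner e|)%N by rewrite q4.
have [r_c r_i] := residueP q4'; have e2 := corner4_char at_e q4.
pose g := 1 - e - e'; pose r := residue e.
have eg : e * g = 0 by rewrite /g !mulrBr mulr1 ee orth subrr subr0.
have e'g : e' * g = 0 by rewrite /g !mulrBr mulr1 ee' [e' * e]mulrC orth subr0 subrr.
have gg : g * g = g by rewrite {1}/g !mulrBl mul1r eg e'g !subr0.
have ef : e * (1 - e') = e by rewrite mulrBr mulr1 orth subr0.
have ff : (1 - e') * (1 - e') = 1 - e' by rewrite mulrBl mul1r mulrBr mulr1 ee' subrr subr0.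
have fr i : (i < 4)%N -> (1 - e') * r i = r i.
  by move=> hi; rewrite /r -(r_c i hi) mulrA [_ * e]mulrC ef.
have fg : (1 - e') * g = g by rewrite mulrBl mul1r e'g subr0.
pose a i := r i; pose b i := r i.+2 + g.
have e_ab i k : (i < 2)%N -> (k < 2)%N -> e * (a i - b k) != 0.
  move=> hi hk; have -> : e * (a i - b k) = e * r i - e * r k.+2 - e * g by rewrite /a /b; ring.
  rewrite eg subr0 !r_c ?(leq_trans hi) // subr_eq0; apply/eqP => h.
  have i4 : (i < 4)%N by lia.
  by have := r_i i k.+2 i4 hk h; lia.
(* The summand [g] in [b] makes the sums invertible in the remaining factors. *)
apply: (@hexagon_not_projective K R S S_unit S_inv s sS e' ee' (residue e') a b) => //.
- exact: residue_inv at_e' q3.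
- move=> i k hi hk; apply: (@inv_in_join e) => //.
    apply: he; have -> : e * (a i + s * b k) = e * (a i - b k) + (e * s - e) * b k + e * 2 * b k by ring.
    by rewrite es subrr e2 !mul0r !addr0 e_ab.
  exists s^-1; have -> : (1 - e' - e) = g by rewrite /g; ring.
  have -> : g * (a i + s * b k) = s * (g * g) + g * r i + s * (g * r k.+2) by rewrite /a /b; ring.
  have gr m : (m < 4)%N -> g * r m = 0 by move=> hm; rewrite /r -(r_c m hm) mulrA [g * e]mulrC eg mul0r.
  by rewrite gg !gr ?(leq_trans hi) // mulr0 !addr0 mulrAC mulrV // mul1r.
- by rewrite /a !fr //; apply/eqP => /r_i; move/(_ isT isT).
- have fb m : (m < 2)%N -> (1 - e') * b m = r m.+2 + g by move=> hm; rewrite mulrDr fr // fg.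
  by rewrite !fb //; apply/eqP => /addIr/r_i; move/(_ isT isT).
- move=> i k hi hk; rewrite -subr_eq0 -mulrBr; apply: contra_neq (e_ab i k hi hk) => h.
  by rewrite -{1}ef -mulrA h mulr0.
Qed.

End Reduced.
End Cayley.

(** * Rings with a Boolean complement, and three factors *)
Section Cayley.
Variables (K : realType) (R : finComUnitRingType) (S : {set R}).
Hypothesis S_unit : {in S, forall s, s \is a GRing.unit}.
Hypothesis S_inv : {in S, forall s, s^-1 \in S}.
Local Notation embeds_in k := (embeds K (Gamma S) (crosscap_sphere K k)).
Implicit Types (x y s u e f g a b : R) (H : {set R}).

(** If [1] is the only unit in the factor of [f], adjacent elements have components in this
factor which differ by [f].  So the graph splits according to the cosets of [{0, f}], and
[side] tells the two elements of a coset apart. *)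
Lemma two_copies f : f * f = f -> f != 0 -> (forall u, u \is a GRing.unit -> f * u = f) ->
  exists (copy : R -> nat) (side : R -> bool),
    (forall x y, copy x = copy y -> side x = side y -> f * x = f * y) /\
    (forall x y, Gamma S x y -> copy x = copy y /\ side x != side y).
Proof.
move=> ff f0 fu; pose H : {set R} := [set x | (x == 0) || (x == f)].
have HP x : reflect (x = 0 \/ x = f) (x \in H).
  by rewrite inE; apply: (iffP orP) => -[/eqP|/eqP]; auto.
have fN : - f = f by have := fu (-1); rewrite mulrN1; apply; rewrite unitrN unitr1.
have H0 : 0 \in H by apply/HP; left.
have HB : {in H &, forall x y, x - y \in H}.
  move=> x y /HP[]-> /HP[]->; apply/HP; rewrite ?subr0 ?sub0r ?subrr ?fN; auto.
have [copy [r [rH cr Hc]]] := coset_numbering H0 HB.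
have same x y : copy (f * x) = copy (f * y) -> (f * x == r (f * x)) = (f * y == r (f * y)) -> f * x = f * y.
  move=> /cr rxy; case: eqP => [->|nx] /esym => [/eqP->|/negbT ny] //.
  have /HP[/eqP|hx] := rH (f * x); first by rewrite subr_eq0 => /eqP/nx.
  have /HP[/eqP|hy] := rH (f * y); first by rewrite subr_eq0 (negbTE ny).
  by apply: (@addIr _ (- r (f * x))); rewrite hx rxy hy.
exists (fun x => copy (f * x)), (fun x => f * x == r (f * x)); split=> // x y /GammaP[_ [s sS u]].
have fxy : f * x - f * y = f.
  rewrite -[RHS](fu _ u); have -> : f * (x + s * y) = f * x + f * s * y by ring.
  by rewrite (fu s) ?S_unit // -{4}fN mulNr.
have c : copy (f * x) = copy (f * y) by apply: Hc; apply/HP; right; exact: fxy.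
split=> //; apply/eqP => sd; move/eqP: f0; apply.
by rewrite -fxy (same x y c sd) subrr.
Qed.

Lemma two_copies_planar (m : nat) (L : seq (nat * nat)) e (code : R -> nat) (adj : rel nat) :
  (0 < m)%N ->
  (forall (copy : R -> nat) (h : R -> 'I_m.*2), (forall x y, copy x = copy y -> h x = h y -> x = y) ->
    (forall x y, Gamma S x y -> copy x = copy y /\ pattern L (h x) (h y)) -> embeds_in 0) ->
  (forall a b : nat, (a < m)%N -> (b < m)%N -> adj a b ->
     ((a, m + b)%N \in L) && ((b, m + a)%N \in L)) ->
  e * e = e -> e != 1 -> (forall u, u \is a GRing.unit -> (1 - e) * u = 1 - e) ->
  (forall x, code x < m)%N -> (forall x y, code x = code y -> e * x = e * y) ->
  (forall x y, Gamma S x y -> adj (code x) (code y)) -> embeds_in 0.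
Proof.
move=> m0 plan Ladj ee e1 fu cm ci cadj.
have ff : (1 - e) * (1 - e) = 1 - e by rewrite mulrBl mul1r mulrBr mulr1 ee subrr subr0.
have f0 : 1 - e != 0 by rewrite subr_eq0 eq_sym.
have [copy [side [same across]]] := two_copies ff f0 fu.
have m2 : (0 < m.*2)%N by rewrite double_gt0.
have lt x : (side x * m + code x < m.*2)%N.
  by have := cm x; rewrite -addnn; case: (side x); lia.
pose h x : 'I_m.*2 := Ordinal (lt x).
apply: (plan copy h).
- move=> x y cxy /(congr1 val) /= hxy; have := cm x; have := cm y => cy cx.
  have sxy : side x = side y by move: hxy; case: (side x); case: (side y) => //=; lia.
  have /ci exy : code x = code y by move: hxy; rewrite sxy; lia.
  have fxy := same x y cxy sxy.
  have -> : x = e * x + (1 - e) * x by ring.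
  by rewrite exy fxy; ring.
- move=> x y xy; have [cxy sxy] := across x y xy; split=> //.
  have /andP[L1 L2] := Ladj _ _ (cm x) (cm y) (cadj x y xy).
  rewrite /pattern /=; case: (side x) (side y) sxy => [] [] //= _.
    by rewrite mul1n mul0n add0n L2 orbT.
  by rewrite mul1n mul0n add0n L1.
Qed.

(** Adjacent elements are on different sides and their components in the field with three
elements are not both zero. *)
Lemma corner3_planar e : atom e -> e != 1 -> #|corner e| = 3%N ->
  (forall u, u \is a GRing.unit -> (1 - e) * u = 1 - e) -> embeds_in 0.
Proof.
move=> at_e e1 q3 fu; have [ee e0 he] := at_e.
have [r_c r_i] := @residueP R e 3 (eq_leq (esym q3)).
have cP x : e * x \in [seq residue e i | i <- iota 0 3].
  have u : uniq [seq residue e i | i <- iota 0 3].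
    rewrite map_inj_in_uniq ?iota_uniq // => i k; rewrite !mem_iota => hi hk.
    exact: r_i.
  have sub : {subset [seq residue e i | i <- iota 0 3] <= enum (corner e)}.
    by move=> y /mapP[i]; rewrite mem_iota mem_enum => hi ->; apply/cornerP; rewrite r_c.
  have le : (size (enum (corner e)) <= size [seq residue e i | i <- iota 0 3])%N by rewrite -cardE q3.
  have [_ ->] := uniq_min_size u sub le.
  by rewrite mem_enum corner_mul.
apply: (@two_copies_planar 3 K33e e (fun x => index (e * x) [seq residue e i | i <- iota 0 3])
  (fun i k => (i != 0)%N || (k != 0)%N)) => //.
- by move=> copy h; apply: K33e_planar.
- by case=> [|[|[|]]] [|[|[|]]].
- by move=> x; rewrite -[X in (_ < X)%N]/(size [seq residue e i | i <- iota 0 3]) index_mem cP.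
- by move=> x y /(congr1 (nth 0 [seq residue e i | i <- iota 0 3])); rewrite !nth_index.
- move=> x y /GammaP[_ [s sS u]]; apply: contraT; rewrite negb_or !negbK => /andP[/eqP x0 /eqP y0].
  have r0 z : index (e * z) [seq residue e i | i <- iota 0 3] = 0%N -> e * z = 0.
    by move=> h; have := nth_index 0 (cP z); rewrite h.
  have /eqP[] := atom_unit at_e u.
  have -> : e * (x + s * y) = e * x + s * (e * y) by ring.
  by rewrite (r0 _ x0) (r0 _ y0) mulr0 addr0.
Qed.

(** Adjacent elements are on different sides and have different components in the field with
four elements. *)
Lemma corner4_planar e : atom e -> e != 1 -> #|corner e| = 4%N -> {in S, forall s, e * s = e} ->
  (forall u, u \is a GRing.unit -> (1 - e) * u = 1 - e) -> embeds_in 0.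
Proof.
move=> at_e e1 q4 es fu; have [ee e0 he] := at_e.
have e2 := corner4_char at_e q4.
have cP x : e * x \in enum (corner e) by rewrite mem_enum corner_mul.
apply: (@two_copies_planar 4 Q3 e (fun x => index (e * x) (enum (corner e))) (fun i k => i != k)) => //.
- by move=> copy h; apply: Q3_planar.
- by case=> [|[|[|[|]]]] [|[|[|[|]]]].
- by move=> x; rewrite -[X in (_ < X)%N]q4 cardE index_mem.
- by move=> x y /(congr1 (nth 0 (enum (corner e)))); rewrite !nth_index.
- move=> x y /GammaP[_ [s sS u]]; apply/eqP => /(congr1 (nth 0 (enum (corner e)))); rewrite !nth_index // => h.
  have /eqP[] := atom_unit at_e u.
  have -> : e * (x + s * y) = e * x - e * y + e * s * y - e * y + e * 2 * y by ring.
  by rewrite h (es s sS) e2 mul0r subrr add0r subrr addr0.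
Qed.

(** The residues [0], [1] and [- 1] have invertible differences in both factors, as [2] is
invertible modulo [3]. *)
Lemma corners33_not_projective s e e' : s \in S -> atom e -> #|corner e| = 3%N -> atom e' -> #|corner e'| = 3%N ->
  e * e' = 0 -> e + e' != 1 -> ~ embeds_in 1.
Proof.
move=> sS at_e q3 at_e' q3' orth ne; have [ee e0 he] := at_e; have [ee' e0' he'] := at_e'.
have two g : atom g -> #|corner g| = 3%N -> g * 2 != 0.
  move=> [gg g0 _] c3; apply: contra_neq g0 => h.
  by rewrite -(corner_char gg) c3 mulrSr -mulr_natr h add0r.
apply: (two_ternary_not_projective S_unit S_inv sS ee ee' orth e0 e0' (c := nth 0 [:: 0; 1; -1])).
  by rewrite -addrA -opprD subr_eq0 eq_sym.
have inv g : atom g -> #|corner g| = 3%N -> forall i k, (i < 3)%N -> (k < 3)%N -> i != k ->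
    inv_in g (nth 0 [:: 0; 1; -1] i - nth 0 [:: 0; 1; -1] k).
  move=> at_g c3; have i2 : inv_in g 2 by have [_ _ h] := at_g; apply/h/two.
  case=> [|[|[|//]]]; case=> [|[|[|//]]] //= _ _ _.
  all: rewrite ?opprK ?subr0 ?sub0r ?add0r; try by apply: inv_in_unit; rewrite ?unitrN unitr1.
    have -> : 1 + 1 = 2 :> R by ring.
    exact: i2.
  have -> : -1 - 1 = - 2 :> R by ring.
  exact: inv_inN.
by move=> i k hi hk ik; split; apply: inv.
Qed.

End Cayley.

(** * Finite fields *)
(** Morphisms from a residue ring are easy to write down; their inverses are wanted. *)
Lemma inverse_rmorphism (A R : pzRingType) (g : A -> R) (f : R -> A) :
  zmod_morphism g -> monoid_morphism g -> cancel g f -> cancel f g ->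
  exists f' : {rmorphism R -> A}, f' =1 f.
Proof.
move=> ga gm gf fg.
pose g' : {rmorphism A -> R} := HB.pack g (GRing.isZmodMorphism.Build A R g ga)
  (GRing.isMonoidMorphism.Build A R g gm).
have fa : zmod_morphism f by apply: (@can2_zmod_morphism _ _ g').
have fm : monoid_morphism f by apply: (@can2_monoid_morphism _ _ g').
pose f' : {rmorphism R -> A} := HB.pack f (GRing.isZmodMorphism.Build R A f fa)
  (GRing.isMonoidMorphism.Build R A f fm).
by exists f'.
Qed.

Lemma fresh (T : finType) (l : seq T) : (size l < #|T|)%N -> exists x, x \notin l.
Proof.
move=> lt; have [/existsP //|] := boolP [exists x, x \notin l].
rewrite negb_exists => /forallP h.
have /subset_leq_card : {: T} \subset l by apply/subsetP => x _; rewrite -[_ \in _]negbK h.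
by move=> /leq_trans/(_ (card_size l)); rewrite leqNgt lt.
Qed.

Section Field.
Variables (K : realType) (R : finComUnitRingType) (S : {set R}).
Hypothesis S_unit : {in S, forall s, s \is a GRing.unit}.
Hypothesis S_inv : {in S, forall s, s^-1 \in S}.
Local Notation embeds_in k := (embeds K (Gamma S) (crosscap_sphere K k)).
Implicit Types (x y s a b : R).
Hypothesis R_field : forall x, x != 0 -> x \is a GRing.unit.

Lemma field_integral x y : x * y = 0 -> x != 0 -> y = 0.
Proof. by move=> xy /R_field ux; rewrite -[y](mulKr ux) xy mulr0. Qed.

(** If [x + s * y] and [x + s^-1 * y] both vanish for nonzero [y], then [s ^+ 2 = 1] and [s] is
[1] or [- 1]. *)
Lemma field_adj s x y : s \in S -> x != y -> x != - y -> Gamma S x y.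
Proof.
move=> sS xy xNy; have us := S_unit sS.
have [h1|/R_field] := eqVneq (x + s * y) 0; last exact: Gamma_adj.
have [h2|/R_field] := eqVneq (x + s^-1 * y) 0; last by apply: Gamma_adj xy; exact: S_inv.
exfalso; have [y0|y0] := eqVneq y 0.
  by move/eqP: xy; rewrite y0 mulr0 addr0 in h1 *; exact.
have h3 : (s - 1) * (s + 1) = 0.
  have : y * ((s - 1) * (s + 1)) = s * ((x + s * y) - (x + s^-1 * y)) + y * (s * s^-1 - 1) by ring.
  by rewrite h1 h2 !subrr mulrV // subrr !mulr0 addr0 => /field_integral; apply.
have [s1|s1] := eqVneq (s - 1) 0.
  move/eqP: xNy; apply; rewrite -[RHS]add0r -h1; have -> : x + s * y - y = x + (s - 1) * y by ring.
  by rewrite s1 mul0r addr0.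
move/eqP: xy; apply; rewrite -[RHS]add0r -h1.
have -> : x + s * y + y = x + (s + 1) * y by ring.
by rewrite (field_integral h3 s1) mul0r addr0.
Qed.

Lemma K1222_not_projective s (g : nat -> R) (sig : nat -> nat) : s \in S -> {in gtn 7 &, injective g} ->
  (forall v, (v < 7)%N -> - g v = g (sig v) /\ (sig v < 7)%N) ->
  all (fun uv => [&& uv.1 < 7, uv.2 < 7, uv.1 != uv.2 & uv.1 != sig uv.2]%N) K1222 -> ~ embeds_in 1.
Proof.
move=> sS gi gs al; apply: (not_projective_sub (Gamma_sym S_unit S_inv) K1222_certificate gi).
apply/allP => uv /(allP al)/and4P[u7 v7 uv1 uv2]; have [Ng s7] := gs _ v7.
by apply: field_adj sS _ _; rewrite ?Ng; [apply: contraNneq uv1 | apply: contraNneq uv2] => /gi->.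
Qed.

(** Apart from characteristic two, where any seven elements will do, take [0] and three
pairs of opposite elements. *)
Lemma field7_not_projective s : s \in S -> (7 <= #|R|)%N -> ~ embeds_in 1.
Proof.
move=> sS q7; have R0 (l : seq R) : (size l < 7)%N -> exists x, x \notin l.
  by move=> h; apply: fresh; apply: leq_trans q7.
have [c2|c2] := eqVneq (2 : R) 0.
  have q7' : (7 <= #|[set: R]|)%N by rewrite cardsT.
  apply: (K1222_not_projective sS (g := nth 0 (enum [set: R])) (sig := id)) => //.
    exact: enum_nth_inj.
  move=> v v7; split=> //; apply/eqP; rewrite -subr_eq0 -opprD oppr_eq0.
  by rewrite -mulr2n -mulr_natr c2 mulr0.
have Ne x : x != 0 -> x != - x.
  move=> x0; apply: contra_neq x0 => h; apply: (field_integral _ c2).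
  by rewrite mulr_natl mulr2n {2}h subrr.
have [a] := R0 [:: 0] isT; rewrite inE => a0.
have [b] := R0 [:: 0; a; -a] isT; rewrite !inE !negb_or => /and3P[b0 ba bNa].
have [c] := R0 [:: 0; a; -a; b; -b] isT; rewrite !inE !negb_or => /and5P[c0 ca cNa cb cNb].
(* Consecutive pairs are the parts of size two of the multipartite graph. *)
pose l := [:: 0; a; -a; b; -b; c; -c].
have ul : uniq l.
  have sw x y : x != - y -> y != - x by rewrite -eqr_oppLR eq_sym.
  have nn x y : x != y -> - x != - y by rewrite eqr_opp.
  have sy x y : x != y -> y != x by rewrite eq_sym.
  have n0 x : x != 0 -> - x != 0 by rewrite oppr_eq0.
  by rewrite /= !inE !negb_or /= !andbT; do !(apply/andP; split); auto.
apply: (K1222_not_projective sS (g := nth 0 l) (sig := nth 0%N [:: 0; 2; 1; 4; 3; 6; 5]%N)) => //.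
  move=> i k; rewrite !inE => hi hk h; apply/eqP; rewrite -(nth_uniq 0 _ _ ul) //.
  exact/eqP.
by do 7?[case=> [|]] => //= _; rewrite ?oppr0 ?opprK.
Qed.

(** Elements of additive orders two and three would make both [2] and [3] zero. *)
Lemma field_not_six : #|R| <> 6%N.
Proof.
move=> q6; have q6' : #|[set: R]| = 6%N by rewrite cardsT.
have [x _ ox] : {x : R | x \in [set: R] & #[x]%g = 2%N} by apply: Cauchy; rewrite // q6'.
have [y _ oy] : {y : R | y \in [set: R] & #[y]%g = 3%N} by apply: Cauchy; rewrite // q6'.
have nz (z : R) n : #[z]%g = n -> (1 < n)%N -> z != 0.
  by move=> <-; apply: contraTneq => ->; rewrite (order1 R).
have chr (z : R) n : #[z]%g = n -> (1 < n)%N -> n%:R = 0 :> R.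
  move=> oz n1; apply: (field_integral _ (nz z n oz n1)).
  by rewrite mulr_natr -oz; exact: (expg_order z).
have /eqP := oner_eq0 R; apply.
have -> : 1 = 3%:R - 2%:R :> R by ring.
by rewrite (chr _ _ ox) // (chr _ _ oy) // subrr.
Qed.

(** The residue class of a natural number acts as the corresponding multiple of [1]; this
is injective because every nonzero residue is invertible modulo five. *)
Lemma field5_iso : #|R| = 5%N -> exists f : {rmorphism R -> 'Z_5}, bijective f.
Proof.
move=> q5; have c5 : 5%:R = 0 :> R.
  rewrite -q5 -cardsT; apply: mulrn_card => [|y z _ _|]; exact: in_setT.
pose g (i : 'Z_5) : R := (i : nat)%:R.
have gmod n : (n %% 5)%:R = n%:R :> R.
  by rewrite [in RHS](divn_eq n 5) natrD natrM c5 mulr0 add0r.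
have ga : zmod_morphism g.
  move=> i j; rewrite /g; apply/eqP; rewrite eq_sym subr_eq; apply/eqP.
  rewrite -natrD -gmod -[in RHS]gmod.
  by have /(congr1 val) /= -> := subrK j i.
have gm : monoid_morphism g by split => [|i j]; rewrite /g //= gmod natrM.
have gi : injective g.
  move=> i j /eqP; rewrite -subr_eq0 -ga => h; apply/eqP; rewrite -subr_eq0.
  apply: contraTT h => ij; rewrite /g.
  have n0 : nat_of_ord (i - j) != 0%N by apply: contraNneq ij => h; apply/eqP/val_inj.
  have := ltn_ord (i - j); move: (nat_of_ord (i - j)) n0 => n; rewrite -lt0n => n0 n5.
  apply/eqP => h; have /eqP := oner_eq0 R; apply.
  have : coprime n 5 by move: n n5 n0 {h} => [|[|[|[|[|[]]]]]].
  move=> /coprimeP-/(_ n0)[[u v] /= uv].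
  have : (u * n)%:R = (1 + v * 5)%:R :> R by congr (_%:R); lia.
  by rewrite natrD !natrM h c5 !mulr0 addr0.
have [f gf fg] : bijective g by apply: inj_card_bij => //; rewrite q5 card_ord.
have [f' ff'] := inverse_rmorphism ga gm gf fg.
by exists f', g => x; rewrite ff'.
Qed.

End Field.

(** * The square of the field with three elements *)
Lemma not_planar_sub (K : realType) (V : finType) (e : rel V) N L z (g : nat -> V) :
  (forall x y, e x y -> e y x) -> (2 < N)%N -> all (fun uv => uv.1 < uv.2 < N)%N L ->
  cocycle L z && xsum (fun ef => interlace ef.1 ef.2) z ->
  {in gtn N &, injective g} -> all (fun uv => e (g uv.1) (g uv.2)) L ->
  ~ embeds K e (crosscap_sphere K 0).
Proof.
move=> e_sym N2 LN /andP[cz xz] gi gL emb; apply: (not_planar (K := K) N2 LN cz xz).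
apply: (embeds_sub (g := fun i : 'I_N => g i)) emb.
  by move=> i j /gi ij; apply: val_inj; apply: ij; rewrite inE.
exact: pattern_hom.
Qed.

Notation Z3Z3 := ('Z_3 * 'Z_3)%type.

(** Elements of the square of the field with three elements are numbered by their two digits
to the base 3, and all statements about this ring are then checked by computation. *)
Definition decode (n : nat) : Z3Z3 := (inZp (n %/ 3), inZp n).
Definition code (p : Z3Z3) : nat := 3 * p.1 + p.2.

Lemma code_lt p : (code p < 9)%N.
Proof.
have h1 : (p.1 < 3)%N := ltn_ord p.1; have h2 : (p.2 < 3)%N := ltn_ord p.2.
by rewrite /code; lia.
Qed.

Lemma codeK : cancel code decode.
Proof.
case=> i j; have h1 : (i < 3)%N := ltn_ord i; have h2 : (j < 3)%N := ltn_ord j.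
congr (_, _); apply: val_inj.
  by rewrite -[LHS]/(((3 * i + j) %/ 3) %% 3)%N -[RHS]/(nat_of_ord i); lia.
by rewrite -[LHS]/((3 * i + j) %% 3)%N -[RHS]/(nat_of_ord j); lia.
Qed.

Lemma decodeK n : (n < 9)%N -> code (decode n) = n.
Proof. by move=> n9; rewrite -[LHS]/(3 * ((n %/ 3) %% 3) + n %% 3)%N; lia. Qed.

Lemma decode_all (P : pred Z3Z3) : all (fun n => P (decode n)) (iota 0 9) -> forall p, P p.
Proof. by move=> /allP h p; rewrite -[p]codeK; apply: h; rewrite mem_iota code_lt. Qed.

Lemma unit_Z3Z3 (p : Z3Z3) : (p \is a GRing.unit) = (p.1 != 0) && (p.2 != 0).
Proof.
apply/idP/idP => [/unitrP[q [qp _]]|h].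
  by apply/andP; split; apply: contra_eq_neq qp => h; rewrite (surjective_pairing (q * p)) /= h mulr0; apply/eqP => -[].
apply/unitrP; exists p; suff -> : p * p = 1 by [].
by apply/eqP; move: h; apply/implyP; move: p; apply: decode_all.
Qed.

Definition square_adj (ls : seq Z3Z3) (p q : Z3Z3) :=
  (p != q) && has (fun s => ((p + s * q).1 != 0) && ((p + s * q).2 != 0)) ls.

Definition sub_pattern ls (L : seq (nat * nat)) :=
  all (fun i => all (fun k => square_adj ls (decode i) (decode k) ==> ((i, k) \in L) || ((k, i) \in L)) (iota 0 9)) (iota 0 9).

Section Ternary.
Variables (K : realType) (R : finComUnitRingType) (S : {set R}).
Hypothesis S_unit : {in S, forall s, s \is a GRing.unit}.
Hypothesis S_inv : {in S, forall s, s^-1 \in S}.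
Local Notation embeds_in k := (embeds K (Gamma S) (crosscap_sphere K k)).
Implicit Types (x y s a b : R).

Section Coordinates.
Variable F : R -> Z3Z3.
Hypothesis F_bij : bijective F.
Hypothesis F_lin : forall x s y, F (x + s * y) = F x + F s * F y.
Hypothesis F_unit : forall x, (x \is a GRing.unit) = (F x \is a GRing.unit).

Lemma square_adj_Gamma ls x y : {subset ls <= F @: S} -> square_adj ls (F x) (F y) -> Gamma S x y.
Proof.
move=> sub /andP[xy /hasP[p /sub/imsetP[s sS ->]]]; rewrite -unit_Z3Z3 -F_lin -F_unit.
by apply: Gamma_adj => //; apply: contraNneq xy => ->.
Qed.

Lemma Gamma_square_adj ls x y : {subset F @: S <= ls} -> Gamma S x y -> square_adj ls (F x) (F y).
Proof.
move=> sub /GammaP[xy [s sS u]]; rewrite /square_adj (inj_eq (bij_inj F_bij)) xy.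
by apply/hasP; exists (F s); [apply/sub/imset_f | rewrite -unit_Z3Z3 -F_lin -F_unit].
Qed.

Lemma coordinates_pattern ls L (h : R -> 'I_9) : (forall x, h x = code (F x) :> nat) ->
  {subset F @: S <= ls} -> sub_pattern ls L ->
  forall x y, Gamma S x y -> pattern L (h x) (h y).
Proof.
move=> hE sub /allP al x y /(Gamma_square_adj sub) xy; rewrite /pattern /= !hE.
have ci z : code (F z) \in iota 0 9 by rewrite mem_iota code_lt.
by have /allP/(_ _ (ci y))/implyP := al _ (ci x); rewrite !codeK; apply.
Qed.

Lemma coordinates_planar ls L :
  (forall (copy : R -> nat) (h : R -> 'I_9), (forall x y, copy x = copy y -> h x = h y -> x = y) ->
    (forall x y, Gamma S x y -> copy x = copy y /\ pattern L (h x) (h y)) -> embeds_in 0) ->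
  {subset F @: S <= ls} -> sub_pattern ls L -> embeds_in 0.
Proof.
move=> plan sub sp; apply: (plan (fun=> 0%N) (fun x => Ordinal (code_lt (F x)))).
  by move=> x y _ /(congr1 val) /= /(can_inj codeK)/(bij_inj F_bij).
by move=> x y xy; split=> //; exact: (@coordinates_pattern ls L (fun x => Ordinal (code_lt (F x))) (fun=> erefl) sub sp x y xy).
Qed.

Lemma coordinates_projective ls : {subset F @: S <= ls} -> sub_pattern ls K333m -> embeds_in 1.
Proof.
move=> sub sp; apply: (embeds_sub (g := fun x => Ordinal (code_lt (F x)))) (K333m_projective K).
  by move=> x y /(congr1 val) /= /(can_inj codeK)/(bij_inj F_bij).
exact: (@coordinates_pattern ls _ (fun x => Ordinal (code_lt (F x))) (fun=> erefl) sub sp).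
Qed.

Lemma coordinates_sub ls L N (tab : seq nat) : {subset ls <= F @: S} ->
  [&& size tab == N, uniq tab, all (gtn 9) tab &
    all (fun uv => [&& uv.1 < N, uv.2 < N & square_adj ls (decode (nth 0 tab uv.1)) (decode (nth 0 tab uv.2))]%N) L] ->
  exists2 g : nat -> R, {in gtn N &, injective g} & all (fun uv => Gamma S (g uv.1) (g uv.2)) L.
Proof.
move=> sub /and4P[/eqP sz ut /allP t9 /allP al]; have [G FG GF] := F_bij.
exists (fun v => G (decode (nth 0%N tab v))).
  move=> u v; rewrite !inE => uN vN /(can_inj GF) h; apply/eqP; rewrite -sz in uN vN.
  rewrite -(nth_uniq 0%N uN vN ut); apply/eqP; move: h.
  have := t9 _ (mem_nth 0%N uN); have := t9 _ (mem_nth 0%N vN); rewrite !inE.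
  move: (nth _ _ u) (nth _ _ v) => i k i9 k9 h; have := congr1 code h.
  by rewrite !decodeK.
by apply/allP => uv /al/and3P[uN vN adj]; apply: (square_adj_Gamma sub); rewrite !GF.
Qed.

Lemma coordinates_not_projective ls L N zs tab : certificate L N zs -> {subset ls <= F @: S} ->
  [&& size tab == N, uniq tab, all (gtn 9) tab &
    all (fun uv => [&& uv.1 < N, uv.2 < N & square_adj ls (decode (nth 0 tab uv.1)) (decode (nth 0 tab uv.2))]%N) L] ->
  ~ embeds_in 1.
Proof.
move=> cert sub /(coordinates_sub sub)[g gi gL].
exact: (not_projective_sub (Gamma_sym S_unit S_inv) cert gi gL).
Qed.

Lemma coordinates_nonplanar : (-1, -1) \in F @: S -> ~ embeds_in 0.
Proof.
move=> h; have sub : {subset [:: (-1, -1) : Z3Z3] <= F @: S} by move=> p; rewrite inE => /eqP->.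
have [|g gi gL] := @coordinates_sub [:: (-1, -1)] K3xK3 9 (iota 0 9) sub; first by vm_compute.
exact: (not_planar_sub (Gamma_sym S_unit S_inv) _ _ K3xK3_cocycle gi gL).
Qed.

(** Stated for any coordinates, so that it can be used with the two factors exchanged. *)
Lemma coordinates_B8_not_projective : (1, 1) \in F @: S -> (1, -1) \in F @: S -> ~ embeds_in 1.
Proof.
move=> h1 h2; have sub : {subset [:: (1, 1); (1, -1) : Z3Z3] <= F @: S} by move=> p; rewrite !inE => /orP[] /eqP->.
by apply: (coordinates_not_projective (tab := [:: 0; 4; 5; 7; 1; 2; 6; 8]%N) B8_certificate sub); vm_compute.
Qed.

Lemma coordinates_pm_planar : {subset F @: S <= [:: (1, -1)]} -> embeds_in 0.
Proof. by move=> sub; apply: (coordinates_planar (Z33pm_planar K (e := Gamma S)) sub); vm_compute. Qed.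

End Coordinates.

Section Square.
Variable f : {rmorphism R -> Z3Z3}.
Hypothesis f_bij : bijective f.

Lemma square_lin x s y : f (x + s * y) = f x + f s * f y.
Proof. by rewrite rmorphD rmorphM. Qed.

Lemma square_unit x : (x \is a GRing.unit) = (f x \is a GRing.unit).
Proof.
apply/idP/idP => [/(rmorph_unit f)//|/unitrP[q [qx xq]]]; have [g fg gf] := f_bij.
by apply/unitrP; exists (g q); split; apply: (bij_inj f_bij); rewrite rmorphM gf rmorph1.
Qed.

Definition swap (p : Z3Z3) : Z3Z3 := (p.2, p.1).

Lemma swap_bij : bijective (swap \o f).
Proof. by apply: bij_comp f_bij; exists swap; case. Qed.

Lemma swap_lin x s y : (swap \o f) (x + s * y) = (swap \o f) x + (swap \o f) s * (swap \o f) y.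
Proof. by rewrite /= square_lin. Qed.

Lemma swap_unit x : (x \is a GRing.unit) = ((swap \o f) x \is a GRing.unit).
Proof. by rewrite square_unit !unit_Z3Z3 andbC. Qed.

Lemma swap_mem p : (swap p \in (swap \o f) @: S) = (p \in f @: S).
Proof. by rewrite imset_comp mem_imset //; case=> ? ? [? ?] [-> ->]. Qed.

Definition signs : seq Z3Z3 := [:: (1, 1); (1, -1); (-1, 1); (-1, -1)].

Lemma S_signs p : p \in f @: S -> p \in signs.
Proof.
move=> /imsetP[s /S_unit + ->]; rewrite square_unit unit_Z3Z3.
by apply/implyP; move: (f s); apply: decode_all.
Qed.

Lemma signs_eq (A : {set Z3Z3}) : all (fun p => (p \in f @: S) == (p \in A)) signs ->
  {subset A <= signs} -> f @: S = A.
Proof.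
move=> /allP al sub; apply/setP => p; have [/al/eqP//|np] := boolP (p \in signs).
by rewrite (contraNF (@S_signs p) np) (contraNF (@sub p) np).
Qed.

(** There are four possible elements of [S], all of them signs.  For each set of signs, the graph
is one of the planar ones, or contains a forbidden graph, or is in the list; exchanging
the factors halves the number of cases. *)
Lemma square_trichotomy : S != set0 ->
  [\/ embeds_in 0, ~ embeds_in 1 |
     [\/ f @: S = [set (-1, -1)], f @: S = [set (1, -1); (-1, -1)] | f @: S = [set (-1, 1); (-1, -1)]]].
Proof.
move=> /set0Pn[s sS]; have fs := imset_f f sS; have /S_signs := fs.
have sub2 (p q : Z3Z3) : p \in f @: S -> q \in f @: S -> {subset [:: p; q] <= f @: S}.
  by move=> hp hq r; rewrite !inE => /orP[] /eqP->.
have sw p : p \in (swap \o f) @: S -> swap p \in f @: S.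
  by rewrite -(swap_mem (swap p)); case: p.
have [h1|n1] := boolP ((1, 1) \in f @: S).
  have [h2|n2] := boolP ((1, -1) \in f @: S).
    by move=> _; apply: Or32; apply: coordinates_B8_not_projective f_bij square_lin square_unit h1 h2.
  have [h3|n3] := boolP ((-1, 1) \in f @: S).
    move=> _; apply: Or32; apply: (coordinates_B8_not_projective swap_bij swap_lin swap_unit).
      by rewrite -swap_mem in h1.
    by rewrite -swap_mem in h3.
  have [h4|n4] := boolP ((-1, -1) \in f @: S).
    move=> _; apply: Or32.
    by apply: (coordinates_not_projective f_bij square_lin square_unit (tab := [:: 4; 0; 1; 2; 3; 6; 5; 7]%N) K35_certificate (sub2 _ _ h1 h4)); vm_compute.
  move=> _; apply: Or31; apply: (coordinates_planar f_bij square_lin square_unit (ls := [:: (1, 1)])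
    (Z33pp_planar K (e := Gamma S))); last by vm_compute.
  move=> p hp; have := S_signs hp; rewrite !inE => /or4P[] // /eqP pE; rewrite pE in hp.
  - by rewrite hp in n2.
  - by rewrite hp in n3.
  - by rewrite hp in n4.
have [h2|n2] := boolP ((1, -1) \in f @: S); have [h3|n3] := boolP ((-1, 1) \in f @: S).
- move=> _; apply: Or32.
  by apply: (coordinates_not_projective f_bij square_lin square_unit (tab := [:: 1; 3; 6; 4; 8; 5; 7]%N) K1222_certificate (sub2 _ _ h2 h3)); vm_compute.
- have [h4|n4] := boolP ((-1, -1) \in f @: S).
    move=> _; apply/Or33/Or32/signs_eq.
      by rewrite /= (negbTE n1) h2 (negbTE n3) h4 !inE.
    by move=> p; rewrite !inE => /orP[] /eqP->.
  move=> _; apply: Or31; apply: (coordinates_pm_planar f_bij square_lin square_unit).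
  move=> p hp; have := S_signs hp; rewrite !inE => /or4P[] // /eqP pE; rewrite pE in hp.
  - by rewrite hp in n1.
  - by rewrite hp in n3.
  - by rewrite hp in n4.
- have [h4|n4] := boolP ((-1, -1) \in f @: S).
    move=> _; apply/Or33/Or33/signs_eq.
      by rewrite /= (negbTE n1) (negbTE n2) h3 h4 !inE.
    by move=> p; rewrite !inE => /orP[] /eqP->.
  move=> _; apply: Or31; apply: (coordinates_pm_planar swap_bij swap_lin swap_unit).
  move=> p /sw hp; have pp : p = swap (swap p) by case: (p).
  have := S_signs hp; rewrite !inE => /or4P[] /eqP pE; rewrite pE in hp.
  - by rewrite hp in n1.
  - by rewrite hp in n2.
  - by rewrite pp pE.
  - by rewrite hp in n4.
- move=> hs; have h4 : (-1, -1) \in f @: S.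
    move: hs fs; rewrite !inE => /or4P[] /eqP -> //.
    - by rewrite (negbTE n1).
    - by rewrite (negbTE n2).
    - by rewrite (negbTE n3).
  apply/Or33/Or31/signs_eq.
    by rewrite /= (negbTE n1) (negbTE n2) (negbTE n3) h4 !inE.
  by move=> p; rewrite !inE => /eqP->.
Qed.

End Square.
End Ternary.

(** * The classification *)
Section Classification.
Variables (K : realType) (R : finComUnitRingType) (S : {set R}).
Hypothesis S_unit : {in S, forall s, s \is a GRing.unit}.
Hypothesis S_inv : {in S, forall s, s^-1 \in S}.
Local Notation embeds_in k := (embeds K (Gamma S) (crosscap_sphere K k)).
Implicit Types (x y s u e a b : R).

(** The natural map from the square of the residue ring is injective, and the ring has at most
nine elements since it is embedded in the product of the two corners. *)
Lemma corners33_iso e : atom e -> #|corner e| = 3%N -> atom (1 - e) -> #|corner (1 - e)| = 3%N ->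
  exists f : {rmorphism R -> Z3Z3}, bijective f.
Proof.
move=> at_e q3 at_f q3'; have [ee e0 _] := at_e; have [ff f0 _] := at_f.
set f := 1 - e in at_f q3' ff f0.
have ef : e * f = 0 by rewrite /f mulrBr mulr1 ee subrr.
have three (d : R) : d * d = d -> #|corner d| = 3%N -> d * 3%:R = 0.
  by move=> dd c3; rewrite mulr_natr -c3 corner_char.
have dmod (d : R) n : d * 3%:R = 0 -> d * (n %% 3)%:R = d * n%:R.
  move=> d3; have /(congr1 (fun m => d * m%:R)) -> := divn_eq n 3; rewrite natrD natrM.
  have -> : d * ((n %/ 3)%:R * 3%:R + (n %% 3)%:R) = d * 3%:R * (n %/ 3)%:R + d * (n %% 3)%:R by ring.
  by rewrite d3 mul0r add0r.
have e3 := three e ee q3; have f3 := three f ff q3'.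
pose g (p : Z3Z3) : R := e * (p.1 : nat)%:R + f * (p.2 : nat)%:R.
have coefB (d : R) (i j : 'Z_3) : d * 3%:R = 0 -> d * (nat_of_ord (i - j))%:R = d * (i : nat)%:R - d * (j : nat)%:R.
  move=> d3; apply/eqP; rewrite eq_sym subr_eq -mulrDr -natrD -dmod //.
  rewrite -[in X in _ == X]dmod //; apply/eqP; congr (_ * _%:R).
  by have /(congr1 val) /= := subrK j i => {1}<-; rewrite modn_mod.
have ga : zmod_morphism g.
  by move=> [i1 i2] [j1 j2]; rewrite /g /= !coefB //; ring.
have gm : monoid_morphism g.
  split=> [|[i1 i2] [j1 j2]]; first by rewrite -[LHS]/(e * 1%:R + f * 1%:R) /f; ring.
  rewrite /g /=.
  rewrite !dmod // !natrM.
  have -> : (e * i1%:R + f * i2%:R) * (e * j1%:R + f * j2%:R) = e * e * (i1%:R * j1%:R) + f * f * (i2%:R * j2%:R)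
    + e * f * (i1%:R * j2%:R + i2%:R * j1%:R) by ring.
  by rewrite ee ff ef mul0r addr0.
have coef0 (d : R) (i : 'Z_3) : d * d = d -> d != 0 -> d * 3%:R = 0 -> d * (i : nat)%:R = 0 -> i = 0.
  move=> dd d0 d3 h; apply/eqP; apply: contraNT d0 => i0; apply/eqP.
  have {}i0 : nat_of_ord i != 0%N by apply: contraNneq i0 => i0; apply/eqP/val_inj.
  have i3 : (i < 3)%N := ltn_ord i; move: (nat_of_ord i) i0 i3 h => [|[|[|n]]] //= _ _.
    by rewrite mulr1.
  move=> d2; have -> : d = d * 3%:R - d * 2%:R by ring.
  by rewrite d2 d3 subrr.
have gi : injective g.
  move=> p q /eqP; rewrite -subr_eq0 -ga => /eqP h; apply/eqP; rewrite -subr_eq0; apply/eqP.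
  move: (p - q) h => [i j]; rewrite /g /= => h; congr (_, _).
    apply: (coef0 e) => //; have := congr1 (fun z => e * z) h; rewrite mulr0 => <-.
    have -> : e * (e * i%:R + f * j%:R) = e * e * i%:R + e * f * j%:R by ring.
    by rewrite ee ef mul0r addr0.
  apply: (coef0 f) => //; have := congr1 (fun z => f * z) h; rewrite mulr0 => <-.
  have -> : f * (e * i%:R + f * j%:R) = f * f * j%:R + e * f * i%:R by ring.
  by rewrite ff ef mul0r addr0.
have R9 : (#|R| <= #|{: Z3Z3}|)%N.
  have -> : #|{: Z3Z3}| = #|setX (corner e) (corner f)|.
    by rewrite cardsX q3 q3' card_prod !card_ord.
  have split_inj : injective (fun x => (e * x, f * x)).
    move=> x y [h1 h2]; have -> : x = e * x + f * x by rewrite /f; ring.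
    by rewrite h1 h2 /f; ring.
  rewrite -cardsT -(card_imset [set: R] split_inj); apply/subset_leq_card/subsetP.
  by move=> _ /imsetP[x _ ->]; rewrite in_setX !corner_mul.
have [h gh hg] : bijective g by apply: inj_card_bij.
have [h' hh] := inverse_rmorphism ga gm gh hg.
by exists h', g => x; rewrite hh.
Qed.

(** Otherwise all corners have order two and [1] is the only unit. *)
Lemma large_corner u : (forall x, x \in jac R -> x = 0) -> u \is a GRing.unit -> u != 1 ->
  exists2 e : R, atom e & (3 <= #|corner e|)%N.
Proof.
move=> jt uu u1; have [//|h] := pselect (exists2 e : R, atom e & (3 <= #|corner e|)%N).
have /eqP[] := u1; rewrite -[u]mul1r; apply: (units_fixed jt (f := 1)) => //; first by rewrite mulr1.
move=> e at_e; right; have [ee e0 _] := at_e; have := corner_gt1 ee e0.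
have : (#|corner e| < 3)%N by rewrite ltnNge; apply/negP => c3; apply: h; exists e.
lia.
Qed.

Lemma other_corners e : (forall x, x \in jac R -> x = 0) -> atom e ->
  (forall e', atom e' -> e != e' -> (#|corner e'| < 3)%N) ->
  forall u, u \is a GRing.unit -> (1 - e) * u = 1 - e.
Proof.
move=> jt at_e h; have [ee e0 _] := at_e; apply: units_fixed => //.
  by rewrite mulrBl mul1r mulrBr mulr1 ee subrr subr0.
move=> e' at_e'; have [<-|ne] := eqVneq e e'; [left|right].
  by rewrite mulrBr mulr1 ee subrr.
by have [ee' e0' _] := at_e'; have := corner_gt1 ee' e0'; have := h e' at_e' ne; lia.
Qed.

Lemma field_planar : (#|R| <= 4)%N -> embeds_in 0.
Proof.
move=> q4; apply: (@cosets_planar K R S [set: R]); rewrite ?cardsT //.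
- exact: in_setT.
- by move=> x y _ _; exact: in_setT.
- by move=> x y _; exact: in_setT.
Qed.

Lemma pentagon_planar (f : {rmorphism R -> 'Z_5}) : bijective f -> f @: S = [set 1] -> embeds_in 0.
Proof.
move=> f_bij fS; apply: (@K5m_planar K R (Gamma S) (fun=> 0%N) f).
  by move=> x y _ /(bij_inj f_bij).
move=> x y /GammaP[xy [s sS /(rmorph_unit f)]]; rewrite rmorphD rmorphM.
have /set1P-> : f s \in [set 1] by rewrite -fS imset_f.
rewrite mul1r => u; split=> //.
have : f x != f y by rewrite (inj_eq (bij_inj f_bij)).
have : f x + f y != 0 by apply: contraTneq u => ->; rewrite unitr0.
by move: (f x) (f y) => i j; case: i => [[|[|[|[|[|]]]]] ?]; case: j => [[|[|[|[|[|]]]]] ?].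
Qed.

(** By [field_adj] only opposite elements could fail to be adjacent, and [s] different from [1]
joins these. *)
Lemma pentagon_complete (f : {rmorphism R -> 'Z_5}) x y : bijective f -> S != set0 -> f @: S != [set 1] ->
  x != y -> Gamma S x y.
Proof.
move=> f_bij S0 fS xy.
have R_field (z : R) : z != 0 -> z \is a GRing.unit.
  move=> z0; have [g fg gf] := f_bij.
  have fz0 : f z != 0 by rewrite -(inj_eq (bij_inj f_bij)) rmorph0 in z0.
  have [i zi] : exists i, f z * i = 1.
    move: (f z) fz0; have E (i : 'Z_5) : i != 0 -> i * i ^+ 3 = 1.
      by case: i => [[|[|[|[|[|]]]]] ?] // _; apply: val_inj.
    by move=> i /E; exists (i ^+ 3).
  by apply/unitrP; exists (g i); split; apply: (bij_inj f_bij); rewrite rmorphM gf rmorph1 // mulrC.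
have [s sS s1] : exists2 s, s \in S & s != 1.
  have [//|h] := pselect (exists2 s, s \in S & s != 1).
  have S1 s : s \in S -> s = 1 by move=> sS; apply/eqP/negPn/negP => s1; apply: h; exists s.
  case/eqP: fS; apply/setP => i; rewrite in_set1; apply/imsetP/eqP => [[s /S1-> ->]|->].
    exact: rmorph1.
  by have [s sS] := set0Pn _ S0; exists s => //; rewrite (S1 s sS) rmorph1.
have [xNy|] := eqVneq x (- y); last by move=> h; exact: (field_adj S_unit S_inv R_field sS xy h).
apply: (Gamma_adj sS xy); apply: (R_field _); rewrite xNy.
have -> : - y + s * y = (s - 1) * y by ring.
apply: contraNneq s1 => h; rewrite -subr_eq0; apply/eqP.
apply: (field_integral R_field (x := y)); first by rewrite mulrC.
by apply: contraNneq xy => y0; rewrite xNy y0 oppr0.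
Qed.

(** Corners of order at least five are forbidden unless they are the whole ring.  A corner of
order four allows planarity only if [S] acts trivially on it and all other corners have
order two.  Otherwise all orders are at most three; one corner of order three gives a
planar graph, and two of them are forbidden unless they make up the ring. *)
Lemma reduced_trichotomy : S != set0 -> (forall x, x \in jac R -> x = 0) ->
  [\/ embeds_in 0, ~ embeds_in 1 |
   (exists f : {rmorphism R -> 'Z_5}, bijective f /\ f @: S != [set 1]) \/
   (exists f : {rmorphism R -> Z3Z3}, bijective f /\
     [\/ f @: S = [set (-1, -1)], f @: S = [set (1, -1); (-1, -1)] | f @: S = [set (-1, 1); (-1, -1)]])].
Proof.
move=> S0 jt; have [s sS] := set0Pn _ S0.
have j1 : #|jac R| = 1%N.
  apply/eqP/cards1P; exists 0; apply/setP => x; rewrite in_set1.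
  by apply/idP/eqP => [/jt|->] //; exact: jac0.
have [h1|/existsPNP[u]] := pselect (forall u, u \is a GRing.unit -> u = 1).
  apply: Or31; apply: (local_planar K S_unit); first by rewrite j1.
  by move=> u /h1->; rewrite subrr jac0.
move=> uu /eqP u1.
have [e at_e c3] := large_corner jt uu u1; have [ee e0 he] := at_e.
have [e1|e1] := eqVneq e 1.
  have R_field (x : R) : x != 0 -> x \is a GRing.unit.
    rewrite -[x]mul1r -{1}e1 => /he[d]; rewrite e1 !mul1r => xd.
    by apply/unitrP; exists d; rewrite mulrC.
  have [q4|q5] := leqP #|R| 4; first by apply: Or31; exact: field_planar.
  have [q7|q7] := leqP 7 #|R|; first by apply: Or32; exact: field7_not_projective sS q7.
  have R6 := field_not_six R_field; have {R6}q5 : #|R| = 5%N by lia.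
  have [f f_bij] := field5_iso q5.
  have [fS|fS] := eqVneq (f @: S) [set 1]; first by apply: Or31; exact: pentagon_planar f_bij fS.
  by apply: Or33; left; exists f.
have [[d [at_d d3 d5]]|n5] := pselect (exists d : R, [/\ atom d, d != 1 & (5 <= #|corner d|)%N]).
  by apply: Or32; exact: corner5_not_projective sS at_d d3 d5.
have proper (d : R) : atom d -> d != 1.
  move=> at_d; apply/eqP => d1; move/eqP: e1; apply; apply/eqP; apply: contraNT e0 => ed.
  by have := atoms_orthogonal at_e at_d; rewrite d1 mulr1 => ->.
have le4 (d : R) : atom d -> (#|corner d| <= 4)%N.
  by move=> at_d; rewrite leqNgt; apply/negP => d5; apply: n5; exists d; split => //; exact: proper.
have [[d at_d d4]|n4] := pselect (exists2 d : R, atom d & #|corner d| = 4%N).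
  have [[t tS td]|nt] := pselect (exists2 t, t \in S & d * t != d).
    by apply: Or32; exact: corner4_not_projective tS at_d (proper d at_d) d4 td.
  have fix_d : {in S, forall t, d * t = d}.
    by move=> t tS; apply/eqP/negPn/negP => td; apply: nt; exists t.
  have [[d' [at_d' ne d3]]|n3] := pselect (exists d' : R, [/\ atom d', d != d' & (3 <= #|corner d'|)%N]).
    by apply: Or32; exact: corners43_not_projective sS at_d d4 (fix_d s sS) at_d' ne d3.
  apply: Or31; apply: (corner4_planar K S_unit at_d (proper d at_d) d4 fix_d).
  apply: other_corners => // d' at_d' ne; rewrite ltnNge; apply/negP => d3; apply: n3.
  by exists d'.
have le3 (d : R) : atom d -> (#|corner d| <= 3)%N.
  move=> at_d; have := le4 d at_d; rewrite leq_eqVlt => /orP[/eqP d4|//].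
  by case: n4; exists d.
have {}c3 : #|corner e| = 3%N by apply/eqP; rewrite eqn_leq le3.
have [[d [at_d ne d3]]|n3] := pselect (exists d : R, [/\ atom d, e != d & (3 <= #|corner d|)%N]).
  have {}d3 : #|corner d| = 3%N by apply/eqP; rewrite eqn_leq le3.
  have [ed1|ed1] := eqVneq (e + d) 1; last first.
    by apply: Or32; exact: corners33_not_projective sS at_e c3 at_d d3 (atoms_orthogonal at_e at_d ne) ed1.
  have dE : d = 1 - e by rewrite -ed1 addrC addKr.
  rewrite dE in at_d d3; have [f f_bij] := corners33_iso at_e c3 at_d d3.
  have [h|h|h] := square_trichotomy K S_unit S_inv f_bij S0; [exact: Or31 | exact: Or32|].
  by apply: Or33; right; exists f.
apply: Or31; apply: (corner3_planar K S_unit at_e e1 c3).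
apply: other_corners => // d at_d ne; rewrite ltnNge; apply/negP => d3; apply: n3.
by exists d.
Qed.

(** Radicals with more than one element are settled by the lemmas above, so that the ring may
be taken to be reduced. *)
Lemma trichotomy : S != set0 ->
  [\/ embeds_in 0, ~ embeds_in 1 |
   (exists f : {rmorphism R -> 'Z_5}, bijective f /\ f @: S != [set 1]) \/
   (exists f : {rmorphism R -> Z3Z3}, bijective f /\
     [\/ f @: S = [set (-1, -1)], f @: S = [set (1, -1); (-1, -1)] | f @: S = [set (-1, 1); (-1, -1)]])].
Proof.
move=> S0; have [s sS] := set0Pn _ S0.
have [j4|j3] := ltnP 3 #|jac R|; first by apply: Or32; exact: jac4_not_projective sS j4.
have [j3'|n3] := eqVneq #|jac R| 3%N; first by apply: Or32; exact: jac3_not_projective sS j3'.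
have j2 : (#|jac R| <= 2)%N by lia.
have j0 : (0 < #|jac R|)%N by apply/card_gt0P; exists 0; exact: jac0.
have [j2'|n2] := eqVneq #|jac R| 2%N; last first.
  apply: reduced_trichotomy => // x xJ; have /eqP/cards1P[y jE] : #|jac R| = 1%N by lia.
  by move: xJ (jac0 R); rewrite jE !in_set1 => /eqP-> /eqP.
have [h|/existsPNP[u uu /negP uJ]] := pselect (forall u, u \is a GRing.unit -> u - 1 \in jac R).
  by apply: Or31; exact: local_planar.
by apply: Or32; exact: nonlocal_not_projective sS j2' uu uJ.
Qed.

Lemma pentagon_projective (f : {rmorphism R -> 'Z_5}) : bijective f -> S != set0 -> f @: S != [set 1] ->
  embeds_in 1 /\ ~ embeds_in 0.
Proof.
move=> f_bij S0 fS; split.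
  apply: (embeds_sub (f := @pattern K5 5) (g := f)) (K5_projective K); first exact: bij_inj.
  move=> x y /GammaP[xy _]; have : f x != f y by rewrite (inj_eq (bij_inj f_bij)).
  by move: (f x) (f y) => i j; case: i => [[|[|[|[|[|]]]]] ?]; case: j => [[|[|[|[|[|]]]]] ?].
have [g fg gf] := f_bij.
apply: (not_planar_sub (N := 5) (L := K5) (g := fun i => g (inord i)) (Gamma_sym S_unit S_inv) _ _ K5_cocycle) => //.
  by move=> i j hi hj /(can_inj gf)/(congr1 (@nat_of_ord 5)); rewrite !inordK.
have inj i j : (i < 5)%N -> (j < 5)%N -> i != j -> Gamma S (g (inord i)) (g (inord j)).
  move=> hi hj ij; apply: (pentagon_complete f_bij) => //; rewrite (inj_eq (can_inj gf)).
  by apply: contraNneq ij => /(congr1 (@nat_of_ord 5)); rewrite !inordK // => ->.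
by rewrite /= !inj.
Qed.

Lemma square_projective (f : {rmorphism R -> Z3Z3}) : bijective f ->
  [\/ f @: S = [set (-1, -1)], f @: S = [set (1, -1); (-1, -1)] | f @: S = [set (-1, 1); (-1, -1)]] ->
  embeds_in 1 /\ ~ embeds_in 0.
Proof.
move=> f_bij fS; have lin := square_lin f; have unit := square_unit f_bij.
have neg : (-1, -1) \in f @: S by case: fS => ->; rewrite !inE eqxx ?orbT.
split; last exact: (coordinates_nonplanar S_unit S_inv f_bij lin unit).
pose ls : seq Z3Z3 := [:: (1, -1); (-1, -1)].
have case1 : {subset f @: S <= ls} -> embeds_in 1.
  by move=> sub; apply: (coordinates_projective K f_bij lin unit sub); vm_compute.
case: fS => fS.
- by apply: case1 => p; rewrite fS !inE => ->; rewrite orbT.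
- by apply: case1 => p; rewrite fS !inE.
apply: (coordinates_projective K (swap_bij f_bij) (swap_lin f) (swap_unit f_bij) (ls := ls)); last by vm_compute.
by move=> _ /imsetP[x xS ->] /=; have := imset_f f xS; rewrite fS !inE => /orP[] /eqP->.
Qed.

End Classification.

Theorem corollary4p11 (K : realType) (R : finComUnitRingType) (S : {set R})
    (S_neq0 : S != set0)
    (S_unit : {in S, forall s, s \is a GRing.unit})
    (S_inv : {in S, forall s, s^-1 \in S}) :
  projective K (Gamma S) <->
  (exists f : {rmorphism R -> 'Z_5}, bijective f /\ f @: S != [set 1]) \/
  (exists f : {rmorphism R -> 'Z_3 * 'Z_3}, bijective f /\
     [\/ f @: S = [set (-1, -1)],
         f @: S = [set (1, -1); (-1, -1)] |
         f @: S = [set (-1, 1); (-1, -1)]]).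
Proof.
split=> [[emb min]|cases].
  have [h|//|//] := trichotomy K S_unit S_inv S_neq0.
  by have := min 0%N h.
have [emb nemb] : embeds K (Gamma S) (crosscap_sphere K 1) /\ ~ embeds K (Gamma S) (crosscap_sphere K 0).
  case: cases => [[f [f_bij fS]]|[f [f_bij fS]]].
    exact: (pentagon_projective K S_unit S_inv f_bij S_neq0 fS).
  exact: (square_projective K S_unit S_inv f_bij fS).
by split=> // -[/nemb|].
Qed.
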